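(* Let $\mathcal A$ be a symmetric monoidal category and let $\mathcal L$ be a braided monoidal left $\mathcal A$-module that is enriched in $\mathcal A$. Then $\mathfrak Z_2({}^{\mathcal A}\mathcal L)={}^{\mathcal A}\mathfrak Z_2(\mathcal L)$, where $\mathfrak Z_2({}^{\mathcal A}\mathcal L)$ denotes the $E_2$-center of the enriched braided monoidal category ${}^{\mathcal A}\mathcal L$ in $\mathbf{ECat}$ and $\mathfrak Z_2(\mathcal L)$ the Müger center of $\mathcal L$.
   Context: Monoidal categories are written as if strict. The $E_2$-center is defined up to equivalence; ''$=$'' means that it is given by the right-hand side. **Enriched categories.** For a monoidal category $\mathcal A$, an $\mathcal A$-enriched category ${}^{\mathcal A|}\mathcal L$ has objects, hom objects ${}^{\mathcal A|}\mathcal L(x,y)\in\mathcal A$, identities and compositions satisfying the usual axioms. The underlying category $\mathcal L$ has the same objects and $\mathcal L(x,y)=\mathcal A(\mathbf 1_{\mathcal A},{}^{\mathcal A|}\mathcal L(x,y))$; $f\in\mathcal L(x,y)$ induces ${}^{\mathcal A|}\mathcal L(w,f)$ and ${}^{\mathcal A|}\mathcal L(f,w)$ by composing with $f$. An enriched functor ${}^|F:{}^{\mathcal A|}\mathcal L\to{}^{\mathcal B|}\mathcal M$ is a lax-monoidal functor $\hat F:\mathcal A\to\mathcal B$, a map $F$ on objects and morphisms ${}^|F_{x,y}:\hat F({}^{\mathcal A|}\mathcal L(x,y))\to{}^{\mathcal B|}\mathcal M(F(x),F(y))$ compatible with identities and compositions. An enriched natural transformation ${}^|\xi:{}^|F\Rightarrow{}^|G$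 is a lax-monoidal natural transformation $\hat\xi$ with morphisms $\xi_x:\mathbf 1_{\mathcal B}\to{}^{\mathcal B|}\mathcal M(F(x),G(x))$ such that ${}^{\mathcal B|}\mathcal M(F(x),\xi_y)\circ{}^|F_{x,y}={}^{\mathcal B|}\mathcal M(\xi_x,G(y))\circ{}^|G_{x,y}\circ\hat\xi$. $\mathbf{ECat}$ is the 2-category of enriched categories, enriched functors with $\hat F$ (strong) monoidal, and enriched natural transformations, symmetric monoidal under the Cartesian product $\times$ with unit $*$. **Enriched braided monoidal categories.** For $\mathcal A$ symmetric with braiding $\hat c$, an enriched braided monoidal category ${}^{\mathcal A|}\mathcal L$ has an enriched functor ${}^|\otimes:{}^{\mathcal A|}\mathcal L\times{}^{\mathcal A|}\mathcal L\to{}^{\mathcal A|}\mathcal L$ with $\hat\otimes=\otimes_{\mathcal A}$ (monoidal via $1\otimes\hat c\otimes1$), a unit object, and enriched natural isomorphisms (associator, unitors, and braiding from $\otimes$ to the reversed $\otimes$) whose background parts are those of $\mathcal A$ and whose underlying parts make $\mathcal L$ a braided monoidal category. Enriched braided monoidal functors have $\hat F$ braided monoidal, with enriched natural isomorphisms ${}^|F^2,{}^|F^0$ whose background parts are the monoidal structure of $\hat F$ and whose underlying parts make $F$ a braided monoidal functor; enriched monoidal natural transformations have $\xi$ monoidal. These form a symmetric monoidal 2-category $\mathbf{ECat}^{\mathrm{br}}$ under $\times$, modelling $E_2$-algebras in $\mathbf{ECat}$. **$E_2$-center.** In a monoidal 2-category, a left unital action on $x$ is $(A,u:*\to A)$ with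 $g:A\times x\to x$ and invertible $\alpha:g(u\times1_x)\Rightarrow1_x$. A 1-morphism of actions is $(p:A_1\to A_2,\ \sigma:u_2\Rightarrow pu_1,\ \rho:g_2(p\times1_x)\Rightarrow g_1)$ with $\sigma,\rho$ invertible and $\alpha_1\cdot(\rho(u_1\times1))\cdot(g_2(\sigma\times1))=\alpha_2$; a 2-morphism $(p,\sigma,\rho)\Rightarrow(q,\beta,\varphi)$ is $\xi:p\Rightarrow q$ with $(\xi u_1)\cdot\sigma=\beta$ and $\varphi\cdot(g_2(\xi\times1))=\rho$. An $E_0$-center is a terminal object of this 2-category (hom categories into it are contractible groupoids). The $E_2$-center in $\mathbf{ECat}$ of an enriched braided monoidal category is its $E_0$-center in $\mathbf{ECat}^{\mathrm{br}}$. **Braided monoidal modules and canonical construction.** For $\mathcal A$ symmetric, a braided monoidal left $\mathcal A$-module is a braided monoidal category $\mathcal L$ with a left $\mathcal A$-module structure whose action $\odot:\mathcal A\times\mathcal L\to\mathcal L$ is a braided (strong) monoidal functor and whose associator and unitor are monoidal natural isomorphisms ($\otimes:\mathcal A\times\mathcal A\to\mathcal A$ being monoidal via the symmetric braiding). Equivalently, it is given by a symmetric monoidal functor $-\odot\mathbf 1_{\mathcal L}:\mathcal A\to\mathfrak Z_2(\mathcal L)$, with $a\odot x\cong(a\odot\mathbf 1_{\mathcal L})\otimes x$. It is enriched in $\mathcal A$ if internal homs $[x,y]\in\mathcal A$ exist: $\mathcal L(a\odot x,y)\cong\mathcal A(a,[x,y])$ naturally in $a$, with counit $[x,y]\odot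 x\to y$. Then ${}^{\mathcal A}\mathcal L$ is the enriched braided monoidal category with the objects of $\mathcal L$, hom objects $[x,y]$, identities corresponding to $\mathbf 1\odot x\to x$, composition corresponding to $([y,z]\otimes[x,y])\odot x\to[y,z]\odot([x,y]\odot x)\to[y,z]\odot y\to z$, tensor product $[x_1,x_2]\otimes[y_1,y_2]\to[x_1\otimes y_1,x_2\otimes y_2]$ corresponding to $([x_1,x_2]\otimes[y_1,y_2])\odot(x_1\otimes y_1)\to([x_1,x_2]\odot x_1)\otimes([y_1,y_2]\odot y_1)\to x_2\otimes y_2$, and braiding given by those of $\mathcal A$ and $\mathcal L$. The Müger center $\mathfrak Z_2(\mathcal L)\subset\mathcal L$ (full subcategory of transparent objects) is a braided monoidal left $\mathcal A$-module by restriction of $\odot$, and ${}^{\mathcal A}\mathfrak Z_2(\mathcal L)$ is its canonical construction. *)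

(* Defs.v *)
Set Implicit Arguments.
Unset Strict Implicit.
Unset Printing Implicit Defensive.

(* Categories, braided monoidal categories and enriched categories are built
   from scratch.  Equality of morphisms is Leibniz equality.  Monoidal
   categories are not assumed strict: associators and unitors are explicit. *)

Record Category := {
  Ob :> Type;
  Hom : Ob -> Ob -> Type;
  idm : forall x, Hom x x;
  comp : forall x y z, Hom y z -> Hom x y -> Hom x z;
  comp_idl : forall x y (f : Hom x y), comp (idm y) f = f;
  comp_idr : forall x y (f : Hom x y), comp f (idm x) = f;
  comp_assoc : forall x y z w (h : Hom z w) (g : Hom y z) (f : Hom x y),
    comp (comp h g) f = comp h (comp g f) }.

Arguments Hom {c} _ _.
Arguments idm {c} x.
Arguments comp {c x y z} _ _.
Arguments comp_idl {c x y} f.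
Arguments comp_idr {c x y} f.
Arguments comp_assoc {c x y z w} h g f.

Declare Scope cat_scope.
Open Scope cat_scope.
Notation "g ∘ f" := (comp g f) (at level 40, left associativity) : cat_scope.

Definition is_inverse {C : Category} {x y : C} (f : Hom x y) (g : Hom y x) : Prop :=
  g ∘ f = idm x /\ f ∘ g = idm y.

Definition is_iso {C : Category} {x y : C} (f : Hom x y) : Prop :=
  exists g : Hom y x, is_inverse f g.

Definition prod_cat (C D : Category) : Category.
Proof.
  refine {| Ob := (C * D)%type;
            Hom := fun x y => (Hom (fst x) (fst y) * Hom (snd x) (snd y))%type;
            idm := fun x => (idm (fst x), idm (snd x));
            comp := fun x y z g f => (fst g ∘ fst f, snd g ∘ snd f) |}.
  - intros x y [f f']; cbn; now rewrite !comp_idl.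
  - intros x y [f f']; cbn; now rewrite !comp_idr.
  - intros x y z w h g f; cbn; now rewrite !comp_assoc.
Defined.

Definition unit_cat : Category.
Proof.
  refine {| Ob := unit; Hom := fun _ _ => unit;
            idm := fun _ => tt; comp := fun _ _ _ _ _ => tt |}.
  - now intros x y [].
  - now intros x y [].
  - reflexivity.
Defined.

Definition full_subcat (C : Category) (P : C -> Prop) : Category :=
  {| Ob := {x : C | P x};
     Hom := fun x y => @Hom C (proj1_sig x) (proj1_sig y);
     idm := fun x => idm (proj1_sig x);
     comp := fun x y z g f => @comp C _ _ _ g f;
     comp_idl := fun x y f => comp_idl f;
     comp_idr := fun x y f => comp_idr f;
     comp_assoc := fun x y z w h g f => comp_assoc h g f |}.

(* Structure maps only; the axioms are [is_braided] below. *)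
Record BMData := {
  bm_cat :> Category;
  tob : bm_cat -> bm_cat -> bm_cat;
  thom : forall x x' y y' : bm_cat,
    Hom x x' -> Hom y y' -> Hom (tob x y) (tob x' y');
  one : bm_cat;
  ass : forall x y z, Hom (tob (tob x y) z) (tob x (tob y z));
  assi : forall x y z, Hom (tob x (tob y z)) (tob (tob x y) z);
  lun : forall x, Hom (tob one x) x;
  luni : forall x, Hom x (tob one x);
  run : forall x, Hom (tob x one) x;
  runi : forall x, Hom x (tob x one);
  br : forall x y, Hom (tob x y) (tob y x);
  bri : forall x y, Hom (tob y x) (tob x y) }.

Arguments tob {b} _ _.
Arguments thom {b x x' y y'} _ _.
Arguments one {b}.
Arguments ass {b} x y z.
Arguments assi {b} x y z.
Arguments lun {b} x.
Arguments luni {b} x.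
Arguments run {b} x.
Arguments runi {b} x.
Arguments br {b} x y.
Arguments bri {b} x y.

Notation "x ⊗ y" := (tob x y) (at level 38, right associativity) : cat_scope.
Notation "f ⊠ g" := (thom f g) (at level 38, right associativity) : cat_scope.

(* Mac Lane's axioms; [lun_one] and [br_unit] are consequences of the others. *)
Record is_braided (C : BMData) : Prop := {
  thom_id : forall x y : C, idm x ⊠ idm y = idm (x ⊗ y);
  thom_comp : forall (x x' x'' y y' y'' : C) (f : Hom x x') (f' : Hom x' x'')
      (g : Hom y y') (g' : Hom y' y''),
    (f' ∘ f) ⊠ (g' ∘ g) = (f' ⊠ g') ∘ (f ⊠ g);
  ass_inv : forall x y z : C, is_inverse (ass x y z) (assi x y z);
  lun_inv : forall x : C, is_inverse (lun x) (luni x);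
  run_inv : forall x : C, is_inverse (run x) (runi x);
  br_inv : forall x y : C, is_inverse (br x y) (bri x y);
  ass_nat : forall (x x' y y' z z' : C) (f : Hom x x') (g : Hom y y') (h : Hom z z'),
    ass x' y' z' ∘ ((f ⊠ g) ⊠ h) = (f ⊠ (g ⊠ h)) ∘ ass x y z;
  lun_nat : forall (x x' : C) (f : Hom x x'), lun x' ∘ (idm one ⊠ f) = f ∘ lun x;
  run_nat : forall (x x' : C) (f : Hom x x'), run x' ∘ (f ⊠ idm one) = f ∘ run x;
  br_nat : forall (x x' y y' : C) (f : Hom x x') (g : Hom y y'),
    br x' y' ∘ (f ⊠ g) = (g ⊠ f) ∘ br x y;
  pentagon : forall x y z w : C,
    ass x y (z ⊗ w) ∘ ass (x ⊗ y) z w =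
    (idm x ⊠ ass y z w) ∘ (ass x (y ⊗ z) w ∘ (ass x y z ⊠ idm w));
  triangle : forall x y : C, (idm x ⊠ lun y) ∘ ass x one y = run x ⊠ idm y;
  lun_one : lun (@one C) = run one;
  hexagon1 : forall x y z : C,
    ass y z x ∘ (br x (y ⊗ z) ∘ ass x y z) =
    (idm y ⊠ br x z) ∘ (ass y x z ∘ (br x y ⊠ idm z));
  hexagon2 : forall x y z : C,
    assi z x y ∘ (br (x ⊗ y) z ∘ assi x y z) =
    (br x z ⊠ idm y) ∘ (assi x z y ∘ (idm x ⊠ br y z));
  br_unit : forall x : C, lun x ∘ br x one = run x }.

Record BrCat := { bc_data :> BMData; bc_law : is_braided bc_data }.

Record SymCat := {
  sc_br :> BrCat;
  sc_sym : forall x y : sc_br, br y x ∘ br x y = idm (x ⊗ y) }.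

Definition prod_bm (C D : BMData) : BMData :=
  {| bm_cat := prod_cat C D;
     tob := fun x y => (fst x ⊗ fst y, snd x ⊗ snd y);
     thom := fun x x' y y' f g => (fst f ⊠ fst g, snd f ⊠ snd g);
     one := (one, one);
     ass := fun x y z => (ass (fst x) (fst y) (fst z), ass (snd x) (snd y) (snd z));
     assi := fun x y z => (assi (fst x) (fst y) (fst z), assi (snd x) (snd y) (snd z));
     lun := fun x => (lun (fst x), lun (snd x));
     luni := fun x => (luni (fst x), luni (snd x));
     run := fun x => (run (fst x), run (snd x));
     runi := fun x => (runi (fst x), runi (snd x));
     br := fun x y => (br (fst x) (fst y), br (snd x) (snd y));
     bri := fun x y => (bri (fst x) (fst y), bri (snd x) (snd y)) |}.

Lemma prod_is_inverse (C D : Category) (x y : prod_cat C D) (f : Hom x y) (g : Hom y x) :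
  is_inverse (fst f) (fst g) -> is_inverse (snd f) (snd g) -> is_inverse f g.
Proof.
  intros [h1 h2] [k1 k2]; split; cbn; [now rewrite h1, k1 | now rewrite h2, k2].
Qed.

Lemma prod_is_braided (C D : BMData) :
  is_braided C -> is_braided D -> is_braided (prod_bm C D).
Proof.
  intros H K; split; intros; try (apply prod_is_inverse); cbn;
    try (apply H); try (apply K); f_equal; try (apply H); try (apply K).
Qed.

Definition prod_br (C D : BrCat) : BrCat :=
  {| bc_data := prod_bm C D; bc_law := prod_is_braided (bc_law C) (bc_law D) |}.

Definition prod_sym (A B : SymCat) : SymCat.
Proof.
  refine {| sc_br := prod_br A B |}.
  intros x y; cbn; f_equal; apply sc_sym.
Defined.

Definition unit_bm : BMData :=
  {| bm_cat := unit_cat; tob := fun _ _ => tt; thom := fun _ _ _ _ _ _ => tt;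
     one := tt; ass := fun _ _ _ => tt; assi := fun _ _ _ => tt;
     lun := fun _ => tt; luni := fun _ => tt; run := fun _ => tt;
     runi := fun _ => tt; br := fun _ _ => tt; bri := fun _ _ => tt |}.

Lemma unit_is_braided : is_braided unit_bm.
Proof.
  split; cbn; intros;
    repeat match goal with u : unit |- _ => destruct u end;
    try split; reflexivity.
Qed.

Definition unit_br : BrCat := {| bc_data := unit_bm; bc_law := unit_is_braided |}.

Definition unit_sym : SymCat :=
  {| sc_br := unit_br; sc_sym := fun _ _ => eq_refl |}.

(* Structure maps of a strong monoidal functor, without axioms, so that
   composites and pairings below need no proofs; axioms in [is_mon_fun]. *)
Record MonFun (C D : BMData) := {
  fob :> C -> D;
  fhom : forall x y, Hom x y -> Hom (fob x) (fob y);
  f2 : forall x y, Hom (fob x ⊗ fob y) (fob (x ⊗ y));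
  f2i : forall x y, Hom (fob (x ⊗ y)) (fob x ⊗ fob y);
  f0 : Hom one (fob one);
  f0i : Hom (fob one) one }.

Arguments fhom {C D} m {x y} _.
Arguments f2 {C D} m x y.
Arguments f2i {C D} m x y.
Arguments f0 {C D} m.
Arguments f0i {C D} m.

Record is_mon_fun {C D : BMData} (F : MonFun C D) : Prop := {
  fhom_id : forall x, fhom F (idm x) = idm (F x);
  fhom_comp : forall (x y z : C) (g : Hom y z) (f : Hom x y),
    fhom F (g ∘ f) = fhom F g ∘ fhom F f;
  f2_inv : forall x y, is_inverse (f2 F x y) (f2i F x y);
  f0_inv : is_inverse (f0 F) (f0i F);
  f2_nat : forall (x x' y y' : C) (f : Hom x x') (g : Hom y y'),
    f2 F x' y' ∘ (fhom F f ⊠ fhom F g) = fhom F (f ⊠ g) ∘ f2 F x y;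
  f2_ass : forall x y z : C,
    fhom F (ass x y z) ∘ (f2 F (x ⊗ y) z ∘ (f2 F x y ⊠ idm (F z))) =
    f2 F x (y ⊗ z) ∘ ((idm (F x) ⊠ f2 F y z) ∘ ass (F x) (F y) (F z));
  f2_lun : forall x : C,
    fhom F (lun x) ∘ (f2 F one x ∘ (f0 F ⊠ idm (F x))) = lun (F x);
  f2_run : forall x : C,
    fhom F (run x) ∘ (f2 F x one ∘ (idm (F x) ⊠ f0 F)) = run (F x) }.

Record is_br_fun {C D : BMData} (F : MonFun C D) : Prop := {
  br_fun_mon :> is_mon_fun F;
  f2_br : forall x y : C,
    fhom F (br x y) ∘ f2 F x y = f2 F y x ∘ br (F x) (F y) }.

Record is_mon_nat {C D : BMData} (F G : MonFun C D)
    (t : forall x : C, Hom (F x) (G x)) : Prop := {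
  mn_nat : forall (x y : C) (f : Hom x y), t y ∘ fhom F f = fhom G f ∘ t x;
  mn_2 : forall x y : C, t (x ⊗ y) ∘ f2 F x y = f2 G x y ∘ (t x ⊠ t y);
  mn_0 : t one ∘ f0 F = f0 G }.

Definition id_mf (C : BMData) : MonFun C C :=
  {| fob := fun x => x; fhom := fun x y f => f;
     f2 := fun x y => idm (x ⊗ y); f2i := fun x y => idm (x ⊗ y);
     f0 := idm one; f0i := idm one |}.

Definition comp_mf {C D E : BMData} (G : MonFun D E) (F : MonFun C D) : MonFun C E :=
  {| fob := fun x => G (F x);
     fhom := fun x y f => fhom G (fhom F f);
     f2 := fun x y => fhom G (f2 F x y) ∘ f2 G (F x) (F y);
     f2i := fun x y => f2i G (F x) (F y) ∘ fhom G (f2i F x y);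
     f0 := fhom G (f0 F) ∘ f0 G;
     f0i := f0i G ∘ fhom G (f0i F) |}.

Definition fst_mf (C D : BMData) : MonFun (prod_bm C D) C :=
  {| fob := fun z : prod_bm C D => fst z : C;
     fhom := fun x y (f : Hom x y) => fst f;
     f2 := fun x y => idm (fst x ⊗ fst y); f2i := fun x y => idm (fst x ⊗ fst y);
     f0 := idm one; f0i := idm one |}.

Definition snd_mf (C D : BMData) : MonFun (prod_bm C D) D :=
  {| fob := fun z : prod_bm C D => snd z : D;
     fhom := fun x y (f : Hom x y) => snd f;
     f2 := fun x y => idm (snd x ⊗ snd y); f2i := fun x y => idm (snd x ⊗ snd y);
     f0 := idm one; f0i := idm one |}.

Definition pair_mf {C D E : BMData} (F : MonFun C D) (G : MonFun C E) :
    MonFun C (prod_bm D E) :=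
  {| fob := fun x => (F x, G x) : prod_bm D E;
     fhom := fun x y f => (fhom F f, fhom G f);
     f2 := fun x y => (f2 F x y, f2 G x y);
     f2i := fun x y => (f2i F x y, f2i G x y);
     f0 := (f0 F, f0 G); f0i := (f0i F, f0i G) |}.

Definition bang_mf (C : BMData) : MonFun C unit_bm :=
  {| fob := fun _ => tt : unit_bm; fhom := fun _ _ _ => tt;
     f2 := fun _ _ => tt; f2i := fun _ _ => tt; f0 := tt; f0i := tt |}.

Definition one_mf (C : BMData) : MonFun unit_bm C :=
  {| fob := fun _ => one; fhom := fun _ _ _ => idm one;
     f2 := fun _ _ => lun one; f2i := fun _ _ => luni one;
     f0 := idm one; f0i := idm one |}.

(* (a ⊗ b) ⊗ (c ⊗ d) -> (a ⊗ c) ⊗ (b ⊗ d), that is, 1 ⊗ c ⊗ 1. *)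
Definition swap_mid {C : BMData} (a b c d : C) :
    Hom ((a ⊗ b) ⊗ (c ⊗ d)) ((a ⊗ c) ⊗ (b ⊗ d)) :=
  assi a c (b ⊗ d) ∘ ((idm a ⊠ (ass c b d ∘ ((br b c ⊠ idm d) ∘ assi b c d)))
    ∘ ass a b (c ⊗ d)).

Definition swap_midi {C : BMData} (a b c d : C) :
    Hom ((a ⊗ c) ⊗ (b ⊗ d)) ((a ⊗ b) ⊗ (c ⊗ d)) :=
  assi a b (c ⊗ d) ∘ ((idm a ⊠ (ass b c d ∘ ((bri b c ⊠ idm d) ∘ assi c b d)))
    ∘ ass a c (b ⊗ d)).

Definition tens_mf (C : BMData) : MonFun (prod_bm C C) C :=
  {| fob := fun z : prod_bm C C => fst z ⊗ snd z;
     fhom := fun x y (f : Hom x y) => fst f ⊠ snd f;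
     f2 := fun x y => swap_mid (fst x) (snd x) (fst y) (snd y);
     f2i := fun x y => swap_midi (fst x) (snd x) (fst y) (snd y);
     f0 := luni one; f0i := lun one |}.

Record EnrCat (A : SymCat) := {
  eob :> Type;
  ehom : eob -> eob -> A;
  eid : forall x, Hom one (ehom x x);
  ecomp : forall x y z, Hom (ehom y z ⊗ ehom x y) (ehom x z);
  ecomp_idl : forall x y, ecomp x y y ∘ (eid y ⊠ idm (ehom x y)) = lun (ehom x y);
  ecomp_idr : forall x y, ecomp x x y ∘ (idm (ehom x y) ⊠ eid x) = run (ehom x y);
  ecomp_assoc : forall x y z w,
    ecomp x y w ∘ (ecomp y z w ⊠ idm (ehom x y)) =
    ecomp x z w ∘ ((idm (ehom z w) ⊠ ecomp x y z)
      ∘ ass (ehom z w) (ehom y z) (ehom x y)) }.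

Arguments ehom {A} e _ _.
Arguments eid {A} e x.
Arguments ecomp {A} e x y z.

Section Underlying.
Context {A : SymCat} (L : EnrCat A).

Let HA : is_braided A := bc_law A.

Definition ucomp (x y z : L) (g : Hom one (ehom L y z)) (f : Hom one (ehom L x y)) :
    Hom one (ehom L x z) :=
  ecomp L x y z ∘ ((g ⊠ f) ∘ luni one).

Lemma thom_split_l (x x' y y' : A) (f : Hom x x') (g : Hom y y') :
  f ⊠ g = (f ⊠ idm y') ∘ (idm x ⊠ g).
Proof. now rewrite <- (thom_comp HA), comp_idl, comp_idr. Qed.

Lemma thom_split_r (x x' y y' : A) (f : Hom x x') (g : Hom y y') :
  f ⊠ g = (idm x' ⊠ g) ∘ (f ⊠ idm y).
Proof. now rewrite <- (thom_comp HA), comp_idl, comp_idr. Qed.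

Lemma ucomp_idl x y (f : Hom one (ehom L x y)) : ucomp (eid L y) f = f.
Proof.
  unfold ucomp; rewrite thom_split_l, comp_assoc, <- (comp_assoc (ecomp _ _ _ _)).
  rewrite ecomp_idl, <- comp_assoc, (lun_nat HA), comp_assoc.
  rewrite (proj2 (lun_inv HA one)); apply comp_idr.
Qed.

Lemma ucomp_idr x y (f : Hom one (ehom L x y)) : ucomp f (eid L x) = f.
Proof.
  unfold ucomp; rewrite thom_split_r, comp_assoc, <- (comp_assoc (ecomp _ _ _ _)).
  rewrite ecomp_idr, <- comp_assoc, (run_nat HA), comp_assoc, <- (lun_one HA).
  rewrite (proj2 (lun_inv HA one)); apply comp_idr.
Qed.

Lemma ass_luni_one :
  ass one one one ∘ (luni one ⊠ idm one) = idm (@one A) ⊠ luni one.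
Proof.
  transitivity (((idm (@one A) ⊠ luni one) ∘ (idm one ⊠ lun one))
                 ∘ (ass one one one ∘ (luni one ⊠ idm one))).
  - rewrite <- (thom_comp HA), (proj1 (lun_inv HA one)), comp_idl, (thom_id HA).
    now rewrite comp_idl.
  - rewrite comp_assoc, <- (comp_assoc (idm one ⊠ lun one)), (triangle HA).
    rewrite <- (thom_comp HA), <- (lun_one HA), (proj2 (lun_inv HA one)), comp_idl.
    now rewrite (thom_id HA), comp_idr.
Qed.

Lemma ucomp_assoc x y z w (h : Hom one (ehom L z w)) (g : Hom one (ehom L y z))
    (f : Hom one (ehom L x y)) : ucomp (ucomp h g) f = ucomp h (ucomp g f).
Proof.
  unfold ucomp.
  assert (E1 : (ecomp L y z w ∘ ((h ⊠ g) ∘ luni one)) ⊠ f =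
    (ecomp L y z w ⊠ idm _) ∘ (((h ⊠ g) ⊠ f) ∘ (luni one ⊠ idm one))).
  { rewrite <- !(thom_comp HA), comp_idl, comp_idr; reflexivity. }
  assert (E2 : h ⊠ (ecomp L x y z ∘ ((g ⊠ f) ∘ luni one)) =
    (idm _ ⊠ ecomp L x y z) ∘ ((h ⊠ (g ⊠ f)) ∘ (idm one ⊠ luni one))).
  { rewrite <- !(thom_comp HA), comp_idl, comp_idr; reflexivity. }
  rewrite E1, E2, <- ass_luni_one, !comp_assoc.
  rewrite <- (comp_assoc (ecomp L x y w)), ecomp_assoc, !comp_assoc.
  do 2 f_equal.
  rewrite <- !comp_assoc, (ass_nat HA), !comp_assoc; reflexivity.
Qed.

Definition und : Category :=
  {| Ob := L; Hom := fun x y => Hom one (ehom L x y);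
     idm := eid L; comp := ucomp;
     comp_idl := ucomp_idl; comp_idr := ucomp_idr; comp_assoc := ucomp_assoc |}.

(* L(w, f) and L(f, w) for a morphism f of the underlying category. *)
Definition postc {x y : L} (w : L) (f : Hom one (ehom L x y)) :
    Hom (ehom L w x) (ehom L w y) :=
  ecomp L w x y ∘ ((f ⊠ idm (ehom L w x)) ∘ luni (ehom L w x)).

Definition prec {x y : L} (w : L) (f : Hom one (ehom L x y)) :
    Hom (ehom L y w) (ehom L x w) :=
  ecomp L x y w ∘ ((idm (ehom L y w) ⊠ f) ∘ runi (ehom L y w)).

End Underlying.

Arguments postc {A L x y} w f.
Arguments prec {A L x y} w f.

Definition prod_enr {A B : SymCat} (L : EnrCat A) (M : EnrCat B) :
    EnrCat (prod_sym A B).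
Proof.
  refine {| eob := (L * M)%type;
     ehom := fun x y => (ehom L (fst x) (fst y), ehom M (snd x) (snd y)) : prod_sym A B;
     eid := fun x => (eid L (fst x), eid M (snd x));
     ecomp := fun x y z =>
       (ecomp L (fst x) (fst y) (fst z), ecomp M (snd x) (snd y) (snd z)) |}.
  - intros x y; cbn; f_equal; apply ecomp_idl.
  - intros x y; cbn; f_equal; apply ecomp_idr.
  - intros x y z w; cbn; f_equal; apply ecomp_assoc.
Defined.

Definition unit_enr : EnrCat unit_sym :=
  {| eob := unit; ehom := fun _ _ => tt : unit_sym; eid := fun _ => tt;
     ecomp := fun _ _ _ => tt; ecomp_idl := fun _ _ => eq_refl;
     ecomp_idr := fun _ _ => eq_refl; ecomp_assoc := fun _ _ _ _ => eq_refl |}.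

(* Structure maps only; axioms in [is_enr_fun]. *)
Record EnrFun {A B : SymCat} (L : EnrCat A) (M : EnrCat B) := {
  ef_hat : MonFun A B;
  ef_ob :> L -> M;
  ef_hom : forall x y, Hom (ef_hat (ehom L x y)) (ehom M (ef_ob x) (ef_ob y)) }.

Arguments ef_hat {A B L M} e.
Arguments ef_hom {A B L M} e x y.

Record is_enr_fun {A B : SymCat} {L : EnrCat A} {M : EnrCat B} (F : EnrFun L M) : Prop := {
  ef_hat_law : is_mon_fun (ef_hat F);
  ef_id : forall x : L,
    ef_hom F x x ∘ (fhom (ef_hat F) (eid L x) ∘ f0 (ef_hat F)) = eid M (F x);
  ef_comp : forall x y z : L,
    ef_hom F x z ∘ (fhom (ef_hat F) (ecomp L x y z)
      ∘ f2 (ef_hat F) (ehom L y z) (ehom L x y)) =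
    ecomp M (F x) (F y) (F z) ∘ (ef_hom F y z ⊠ ef_hom F x y) }.

Record is_enr_nat {A B : SymCat} {L : EnrCat A} {M : EnrCat B} (F G : EnrFun L M)
    (hat : forall a : A, Hom (ef_hat F a) (ef_hat G a))
    (xi : forall x : L, Hom one (ehom M (F x) (G x))) : Prop := {
  en_hat_law : is_mon_nat hat;
  en_eq : forall x y : L,
    postc (F x) (xi y) ∘ ef_hom F x y =
    prec (G y) (xi x) ∘ (ef_hom G x y ∘ hat (ehom L x y)) }.

Arguments is_enr_nat {A B L M} F G hat xi.

Definition ufun {A B : SymCat} {L : EnrCat A} {M : EnrCat B} (F : EnrFun L M) {x y : L}
    (f : Hom one (ehom L x y)) : Hom one (ehom M (F x) (F y)) :=
  ef_hom F x y ∘ (fhom (ef_hat F) f ∘ f0 (ef_hat F)).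

Definition id_ef {A : SymCat} (L : EnrCat A) : EnrFun L L :=
  {| ef_hat := id_mf A; ef_ob := fun x => x; ef_hom := fun x y => idm (ehom L x y) |}.

Definition comp_ef {A B C : SymCat} {L : EnrCat A} {M : EnrCat B} {N : EnrCat C}
    (G : EnrFun M N) (F : EnrFun L M) : EnrFun L N :=
  {| ef_hat := comp_mf (ef_hat G) (ef_hat F);
     ef_ob := fun x => G (F x);
     ef_hom := fun x y => ef_hom G (F x) (F y) ∘ fhom (ef_hat G) (ef_hom F x y) |}.

Definition fst_ef {A B : SymCat} (L : EnrCat A) (M : EnrCat B) :
    EnrFun (prod_enr L M) L :=
  {| ef_hat := fst_mf A B : MonFun (prod_sym A B) A;
     ef_ob := fun z : prod_enr L M => fst z;
     ef_hom := fun x y => idm (ehom L (fst x) (fst y)) |}.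

Definition snd_ef {A B : SymCat} (L : EnrCat A) (M : EnrCat B) :
    EnrFun (prod_enr L M) M :=
  {| ef_hat := snd_mf A B : MonFun (prod_sym A B) B;
     ef_ob := fun z : prod_enr L M => snd z;
     ef_hom := fun x y => idm (ehom M (snd x) (snd y)) |}.

Definition pair_ef {A B C : SymCat} {L : EnrCat A} {M : EnrCat B} {N : EnrCat C}
    (F : EnrFun L M) (G : EnrFun L N) : EnrFun L (prod_enr M N) :=
  {| ef_hat := pair_mf (ef_hat F) (ef_hat G) : MonFun A (prod_sym B C);
     ef_ob := fun x => (F x, G x) : prod_enr M N;
     ef_hom := fun x y => (ef_hom F x y, ef_hom G x y) |}.

Definition bang_ef {A : SymCat} (L : EnrCat A) : EnrFun L unit_enr :=
  {| ef_hat := bang_mf A : MonFun A unit_sym; ef_ob := fun _ => tt : unit_enr;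
     ef_hom := fun _ _ => tt |}.

(* Structure maps only; the axioms are [is_eb].  The background parts of the
   tensor product, the unit and the constraints are those of [eb_base], hence
   are not stored. *)
Record EBData := {
  eb_base : SymCat;
  eb_cat :> EnrCat eb_base;
  et : eb_cat -> eb_cat -> eb_cat;
  eth : forall x x' y y' : eb_cat,
    Hom (ehom eb_cat x x' ⊗ ehom eb_cat y y') (ehom eb_cat (et x y) (et x' y'));
  e1 : eb_cat;
  ea : forall x y z, Hom one (ehom eb_cat (et (et x y) z) (et x (et y z)));
  eai : forall x y z, Hom one (ehom eb_cat (et x (et y z)) (et (et x y) z));
  el : forall x, Hom one (ehom eb_cat (et e1 x) x);
  eli : forall x, Hom one (ehom eb_cat x (et e1 x));
  er : forall x, Hom one (ehom eb_cat (et x e1) x);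
  eri : forall x, Hom one (ehom eb_cat x (et x e1));
  ec : forall x y, Hom one (ehom eb_cat (et x y) (et y x));
  eci : forall x y, Hom one (ehom eb_cat (et y x) (et x y)) }.

Arguments et {e} _ _.
Arguments eth {e} x x' y y'.
Arguments e1 {e}.
Arguments ea {e} x y z.
Arguments eai {e} x y z.
Arguments el {e} x.
Arguments eli {e} x.
Arguments er {e} x.
Arguments eri {e} x.
Arguments ec {e} x y.
Arguments eci {e} x y.

Definition und_bm (X : EBData) : BMData :=
  {| bm_cat := und X;
     tob := fun x y => et x y : und X;
     thom := fun x x' y y' (f : Hom one (ehom X x x')) (g : Hom one (ehom X y y')) =>
       eth x x' y y' ∘ ((f ⊠ g) ∘ luni one);
     one := e1 : und X;
     ass := fun x y z => ea x y z; assi := fun x y z => eai x y z;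
     lun := fun x => el x; luni := fun x => eli x;
     run := fun x => er x; runi := fun x => eri x;
     br := fun x y => ec x y; bri := fun x y => eci x y |}.

Definition tens_ef (X : EBData) : EnrFun (prod_enr X X) X :=
  {| ef_hat := tens_mf (eb_base X) : MonFun (prod_sym (eb_base X) (eb_base X)) (eb_base X);
     ef_ob := fun z : prod_enr X X => et (fst z) (snd z);
     ef_hom := fun x y => eth (fst x) (fst y) (snd x) (snd y) |}.

Definition one_ef (X : EBData) : EnrFun unit_enr X :=
  {| ef_hat := one_mf (eb_base X) : MonFun unit_sym (eb_base X);
     ef_ob := fun _ : unit_enr => e1 : X;
     ef_hom := fun _ _ => eid X e1 |}.

(* The enriched functor z |-> F z ⊗ G z. *)
Definition tens2_ef {B : SymCat} {K : EnrCat B} {X : EBData} (F G : EnrFun K X) :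
    EnrFun K X :=
  comp_ef (tens_ef X) (pair_ef F G).

Section Laws.
Variable X : EBData.
Let p1 := fst_ef X X.
Let p2 := snd_ef X X.
Let q1 := comp_ef p1 (fst_ef (prod_enr X X) X).
Let q2 := comp_ef p2 (fst_ef (prod_enr X X) X).
Let q3 := snd_ef (prod_enr X X) X.
Let const1 := comp_ef (one_ef X) (bang_ef X).

Record is_eb : Prop := {
  eb_tens : is_enr_fun (tens_ef X);
  eb_ass : is_enr_nat (tens2_ef (tens2_ef q1 q2) q3) (tens2_ef q1 (tens2_ef q2 q3))
    (fun a => ass (fst (fst a)) (snd (fst a)) (snd a))
    (fun x => ea (fst (fst x)) (snd (fst x)) (snd x));
  eb_lun : is_enr_nat (tens2_ef const1 (id_ef X)) (id_ef X)
    (fun a => lun a) (fun x => el x);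
  eb_run : is_enr_nat (tens2_ef (id_ef X) const1) (id_ef X)
    (fun a => run a) (fun x => er x);
  eb_br : is_enr_nat (tens2_ef p1 p2) (tens2_ef p2 p1)
    (fun a => br (fst a) (snd a)) (fun x => ec (fst x) (snd x));
  eb_und : is_braided (und_bm X) }.

End Laws.

Definition prod_eb (X Y : EBData) : EBData :=
  {| eb_base := prod_sym (eb_base X) (eb_base Y);
     eb_cat := prod_enr X Y;
     et := fun x y : prod_enr X Y => (et (fst x) (fst y), et (snd x) (snd y));
     eth := fun x x' y y' =>
       (eth (fst x) (fst x') (fst y) (fst y'), eth (snd x) (snd x') (snd y) (snd y'));
     e1 := (e1, e1) : prod_enr X Y;
     ea := fun x y z => (ea (fst x) (fst y) (fst z), ea (snd x) (snd y) (snd z));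
     eai := fun x y z => (eai (fst x) (fst y) (fst z), eai (snd x) (snd y) (snd z));
     el := fun x => (el (fst x), el (snd x));
     eli := fun x => (eli (fst x), eli (snd x));
     er := fun x => (er (fst x), er (snd x));
     eri := fun x => (eri (fst x), eri (snd x));
     ec := fun x y => (ec (fst x) (fst y), ec (snd x) (snd y));
     eci := fun x y => (eci (fst x) (fst y), eci (snd x) (snd y)) |}.

Definition unit_eb : EBData :=
  {| eb_base := unit_sym; eb_cat := unit_enr; et := fun _ _ => tt : unit_enr;
     eth := fun _ _ _ _ => tt; e1 := tt : unit_enr;
     ea := fun _ _ _ => tt; eai := fun _ _ _ => tt;
     el := fun _ => tt; eli := fun _ => tt; er := fun _ => tt; eri := fun _ => tt;
     ec := fun _ _ => tt; eci := fun _ _ => tt |}.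

(* Structure maps only; axioms in [is_ebf].  The background parts of the two
   constraints are those of [ef_hat]. *)
Record EBFunData (X Y : EBData) := {
  ebf :> EnrFun X Y;
  g2 : forall x y : X, Hom one (ehom Y (et (ebf x) (ebf y)) (ebf (et x y)));
  g2i : forall x y : X, Hom one (ehom Y (ebf (et x y)) (et (ebf x) (ebf y)));
  g0 : Hom one (ehom Y e1 (ebf e1));
  g0i : Hom one (ehom Y (ebf e1) e1) }.

Arguments g2 {X Y} e x y.
Arguments g2i {X Y} e x y.
Arguments g0 {X Y} e.
Arguments g0i {X Y} e.

Definition und_mf {X Y : EBData} (F : EBFunData X Y) : MonFun (und_bm X) (und_bm Y) :=
  {| fob := fun x : und_bm X => F x : und_bm Y;
     fhom := fun x y f => @ufun _ _ X Y F x y f;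
     f2 := fun x y => g2 F x y; f2i := fun x y => g2i F x y;
     f0 := g0 F; f0i := g0i F |}.

Record is_ebf {X Y : EBData} (F : EBFunData X Y) : Prop := {
  ebf_enr : is_enr_fun F;
  ebf_hat : is_br_fun (ef_hat F);
  ebf_2 : is_enr_nat
    (tens2_ef (comp_ef F (fst_ef X X)) (comp_ef F (snd_ef X X)))
    (comp_ef F (tens_ef X))
    (fun a => f2 (ef_hat F) (fst a) (snd a)) (fun x => g2 F (fst x) (snd x));
  ebf_0 : is_enr_nat (one_ef Y) (comp_ef F (one_ef X))
    (fun _ => f0 (ef_hat F)) (fun _ => g0 F);
  ebf_und : is_br_fun (und_mf F) }.

Record EBFun (X Y : EBData) := {
  ebf_data :> EBFunData X Y;
  ebf_law : is_ebf ebf_data }.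

Definition id_eb (X : EBData) : EBFunData X X :=
  {| ebf := id_ef X;
     g2 := fun x y => eid X (et x y); g2i := fun x y => eid X (et x y);
     g0 := eid X e1; g0i := eid X e1 |}.

Definition comp_eb {X Y Z : EBData} (G : EBFunData Y Z) (F : EBFunData X Y) :
    EBFunData X Z :=
  {| ebf := comp_ef G F;
     g2 := fun x y => f2 (comp_mf (und_mf G) (und_mf F)) x y;
     g2i := fun x y => f2i (comp_mf (und_mf G) (und_mf F)) x y;
     g0 := f0 (comp_mf (und_mf G) (und_mf F));
     g0i := f0i (comp_mf (und_mf G) (und_mf F)) |}.

Definition fst_eb (X Y : EBData) : EBFunData (prod_eb X Y) X :=
  {| ebf := fst_ef X Y : EnrFun (prod_eb X Y) X;
     g2 := fun x y => eid X (et (fst x) (fst y));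
     g2i := fun x y => eid X (et (fst x) (fst y));
     g0 := eid X e1; g0i := eid X e1 |}.

Definition snd_eb (X Y : EBData) : EBFunData (prod_eb X Y) Y :=
  {| ebf := snd_ef X Y : EnrFun (prod_eb X Y) Y;
     g2 := fun x y => eid Y (et (snd x) (snd y));
     g2i := fun x y => eid Y (et (snd x) (snd y));
     g0 := eid Y e1; g0i := eid Y e1 |}.

Definition pair_eb {X Y Z : EBData} (F : EBFunData X Y) (G : EBFunData X Z) :
    EBFunData X (prod_eb Y Z) :=
  {| ebf := pair_ef F G : EnrFun X (prod_eb Y Z);
     g2 := fun x y => (g2 F x y, g2 G x y);
     g2i := fun x y => (g2i F x y, g2i G x y);
     g0 := (g0 F, g0 G); g0i := (g0i F, g0i G) |}.

Definition times_id {X Y : EBData} (F : EBFunData X Y) (Z : EBData) :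
    EBFunData (prod_eb X Z) (prod_eb Y Z) :=
  pair_eb (comp_eb F (fst_eb X Z)) (snd_eb X Z).

Record EBNat {X Y : EBData} (F G : EBFunData X Y) := {
  nhat : forall a : eb_base X, Hom (ef_hat F a) (ef_hat G a);
  nob :> forall x : X, @Hom (und Y) (F x) (G x);
  nlaw : is_enr_nat F G nhat nob;
  nmon : @is_mon_nat _ _ (und_mf F) (und_mf G) nob }.

Arguments nhat {X Y F G} e a.
Arguments nob {X Y F G} e x.

Definition ebnat_eq {X Y : EBData} {F G : EBFunData X Y} (s t : EBNat F G) : Prop :=
  (forall a, nhat s a = nhat t a) /\ (forall x, s x = t x).

(* An inverse computed componentwise is automatically a 2-morphism. *)
Definition is_ebnat_iso {X Y : EBData} {F G : EBFunData X Y} (s : EBNat F G) : Prop :=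
  (forall a, is_iso (nhat s a)) /\ (forall x, is_iso (s x)).

(* A left unital action of Z on X in ECat^br: [act_alpha] is g (u × 1) => 1, where
   [snd_eb unit_eb X] is the left unitor * × X -> X of the Cartesian product. *)
Record UnitalAction (X Z : EBData) := {
  act_u : EBFun unit_eb Z;
  act_g : EBFun (prod_eb Z X) X;
  act_alpha : EBNat (comp_eb act_g (times_id act_u X)) (snd_eb unit_eb X);
  act_alpha_iso : is_ebnat_iso act_alpha }.

Arguments act_u {X Z} u.
Arguments act_g {X Z} u.
Arguments act_alpha {X Z} u.

Section ActionMorphisms.
Context {X W Z : EBData} (S : UnitalAction X W) (T : UnitalAction X Z).

(* The equation alpha_1 . (rho (u_1 × 1)) . (g_2 (sigma × 1)) = alpha_2, on
   background and on underlying components. *)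
Definition act_coherent (p : EBFun W Z)
    (sigma : EBNat (act_u T) (comp_eb p (act_u S)))
    (rho : EBNat (comp_eb (act_g T) (times_id p X)) (act_g S)) : Prop :=
  (forall a : eb_base X,
     nhat (act_alpha S) (tt, a)
     ∘ (nhat rho (ef_hat (act_u S) tt, a)
        ∘ @fhom _ _ (ef_hat (act_g T))
            (ef_hat (act_u T) tt, a) (ef_hat p (ef_hat (act_u S) tt), a)
            (nhat sigma tt, idm a))
     = nhat (act_alpha T) (tt, a))
  /\
  (forall x : X,
     @comp (und X) _ _ _ (act_alpha S (tt, x))
       (@comp (und X) _ _ _ (rho (act_u S tt, x))
         (@ufun _ _ (prod_eb Z X) X (act_g T)
            (act_u T tt, x) (p (act_u S tt), x) (sigma tt, eid X x)))
     = act_alpha T (tt, x)).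

Record ActHom := {
  ah_p : EBFun W Z;
  ah_sigma : EBNat (act_u T) (comp_eb ah_p (act_u S));
  ah_rho : EBNat (comp_eb (act_g T) (times_id ah_p X)) (act_g S);
  ah_sigma_iso : is_ebnat_iso ah_sigma;
  ah_rho_iso : is_ebnat_iso ah_rho;
  ah_coherent : act_coherent ah_sigma ah_rho }.

(* xi : p => q is a 2-morphism (p, sigma, rho) => (q, beta, phi):
   (xi u_1) . sigma = beta and phi . (g_2 (xi × 1)) = rho. *)
Definition is_act_2mor (P Q : ActHom) (xi : EBNat (ah_p P) (ah_p Q)) : Prop :=
  (nhat xi (ef_hat (act_u S) tt) ∘ nhat (ah_sigma P) tt = nhat (ah_sigma Q) tt
   /\ @comp (und Z) _ _ _ (xi (act_u S tt)) (ah_sigma P tt) = ah_sigma Q tt)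
  /\
  ((forall (b : eb_base W) (a : eb_base X),
      nhat (ah_rho Q) (b, a)
      ∘ @fhom _ _ (ef_hat (act_g T)) (ef_hat (ah_p P) b, a) (ef_hat (ah_p Q) b, a)
          (nhat xi b, idm a)
      = nhat (ah_rho P) (b, a))
   /\
   (forall (w : W) (x : X),
      @comp (und X) _ _ _ (ah_rho Q (w, x))
        (@ufun _ _ (prod_eb Z X) X (act_g T) (ah_p P w, x) (ah_p Q w, x)
           (xi w, eid X x))
      = ah_rho P (w, x))).

End ActionMorphisms.

Arguments is_act_2mor {X W Z S T} P Q xi.

(* Every hom category into T is a contractible groupoid: it is inhabited and has
   exactly one morphism between any two objects. *)
Definition is_terminal_action {X Z : EBData} (T : UnitalAction X Z) : Prop :=
  forall (W : EBData) (S : UnitalAction X W), is_eb W ->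
    inhabited (ActHom S T) /\
    forall P Q : ActHom S T,
      exists xi : EBNat (ah_p P) (ah_p Q),
        is_act_2mor P Q xi /\
        forall zeta : EBNat (ah_p P) (ah_p Q), is_act_2mor P Q zeta -> ebnat_eq zeta xi.

(* Z, with some left unital action on X, is terminal among the left unital
   actions on X in ECat^br. *)
Definition is_E2_center (X Z : EBData) : Prop :=
  is_eb X /\ is_eb Z /\ exists T : UnitalAction X Z, is_terminal_action T.

(* a ⊙ x and f ⊙ g for a functor ⊙ : C × D -> E *)
Definition mob {C D E : BMData} (F : MonFun (prod_bm C D) E) (a : C) (x : D) : E :=
  F (a, x).
Definition mhom {C D E : BMData} (F : MonFun (prod_bm C D) E) {a b : C} {x y : D}
    (f : Hom a b) (g : Hom x y) : Hom (mob F a x) (mob F b y) :=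
  @fhom _ _ F (a, x) (b, y) (f, g).

Record BrModule (A : SymCat) := {
  bm_br :> BrCat;
  mact : MonFun (prod_bm A bm_br) bm_br;
  mact_law : is_br_fun mact;
  mass : forall (a b : A) (x : bm_br),
    Hom (mob mact (a ⊗ b) x) (mob mact a (mob mact b x));
  munit : forall x : bm_br, Hom (mob mact one x) x;
  mass_iso : forall (a b : A) (x : bm_br), is_iso (mass a b x);
  munit_iso : forall x : bm_br, is_iso (munit x);
  mass_mon :
    let q := fst_mf (prod_bm A A) bm_br in
    @is_mon_nat (prod_bm (prod_bm A A) bm_br) bm_br
      (comp_mf mact (pair_mf (comp_mf (tens_mf A) q) (snd_mf _ _)))
      (comp_mf mact (pair_mf (comp_mf (fst_mf A A) q)
         (comp_mf mact (pair_mf (comp_mf (snd_mf A A) q) (snd_mf _ _)))))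
      (fun z => mass (fst (fst z)) (snd (fst z)) (snd z));
  munit_mon :
    @is_mon_nat bm_br bm_br
      (comp_mf mact (pair_mf (comp_mf (one_mf A) (bang_mf bm_br)) (id_mf bm_br)))
      (id_mf bm_br) munit;
  mod_pentagon : forall (a b c : A) (x : bm_br),
    mass a b (mob mact c x) ∘ mass (a ⊗ b) c x =
    mhom mact (idm a) (mass b c x)
    ∘ (mass a (b ⊗ c) x ∘ mhom mact (ass a b c) (idm x));
  mod_triangle : forall (a : A) (x : bm_br),
    mhom mact (idm a) (munit x) ∘ mass a one x = mhom mact (run a) (idm x) }.

Arguments mact {A} L : rename.
Arguments mact_law {A} L : rename.
Arguments mass {A} L a b x : rename.
Arguments munit {A} L x : rename.
Arguments mass_iso {A} L a b x : rename.
Arguments munit_iso {A} L x : rename.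
Arguments mass_mon {A} L : rename.
Arguments munit_mon {A} L : rename.
Arguments mod_pentagon {A} L a b c x : rename.
Arguments mod_triangle {A} L a x : rename.

Notation "a ⊙ x" := (mob (mact _) a x) (at level 38, right associativity) : cat_scope.
Notation "f ⊡ g" := (mhom (mact _) f g) (at level 38, right associativity) : cat_scope.

(* "L is enriched in A": internal homs, with L(a ⊙ x, y) ≅ A(a, [x, y]) natural
   in a. *)
Record Enriched {A : SymCat} (L : BrModule A) := {
  ih : L -> L -> A;
  cur : forall (a : A) (x y : L), Hom (a ⊙ x) y -> Hom a (ih x y);
  unc : forall (a : A) (x y : L), Hom a (ih x y) -> Hom (a ⊙ x) y;
  unc_cur : forall a x y (f : Hom (a ⊙ x) y), unc (cur f) = f;
  cur_unc : forall a x y (f : Hom a (ih x y)), cur (unc f) = f;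
  cur_nat : forall (a b : A) (x y : L) (f : Hom (b ⊙ x) y) (h : Hom a b),
    cur (f ∘ (h ⊡ idm x)) = cur f ∘ h }.

Arguments ih {A L} e x y.
Arguments cur {A L} e {a x y} _.
Arguments unc {A L} e {a x y} _.

Lemma epi_of_iso (C : Category) (x y z : C) (f g : Hom y z) (h : Hom x y) :
  is_iso h -> f ∘ h = g ∘ h -> f = g.
Proof.
  intros [k [_ hk]] E; rewrite <- (comp_idr f), <- (comp_idr g), <- hk.
  now rewrite <- !comp_assoc, E.
Qed.

Lemma mono_of_iso (C : Category) (x y z : C) (f g : Hom x y) (h : Hom y z) :
  is_iso h -> h ∘ f = h ∘ g -> f = g.
Proof.
  intros [k [kh _]] E; rewrite <- (comp_idl f), <- (comp_idl g), <- kh.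
  now rewrite !comp_assoc, E.
Qed.

Section ModuleFacts.
Context {A : SymCat} {L : BrModule A}.

Let HA : is_braided A := bc_law A.

Lemma mhom_id (a : A) (x : L) : idm a ⊡ idm x = idm (a ⊙ x).
Proof. exact (fhom_id (mact_law L) (a, x)). Qed.

Lemma mhom_comp (a b c : A) (x y z : L) (f' : Hom b c) (f : Hom a b) (g' : Hom y z)
    (g : Hom x y) : (f' ∘ f) ⊡ (g' ∘ g) = (f' ⊡ g') ∘ (f ⊡ g).
Proof.
  exact (@fhom_comp _ _ _ (mact_law L) (a, x) (b, y) (c, z) (f', g') (f, g)).
Qed.

Lemma mass_nat (a a' b b' : A) (x x' : L) (f : Hom a a') (g : Hom b b') (h : Hom x x') :
  mass L a' b' x' ∘ ((f ⊠ g) ⊡ h) = (f ⊡ (g ⊡ h)) ∘ mass L a b x.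
Proof.
  exact (@mn_nat _ _ _ _ _ (mass_mon L) (a, b, x) (a', b', x') (f, g, h)).
Qed.

Lemma munit_nat (x x' : L) (h : Hom x x') :
  munit L x' ∘ (idm one ⊡ h) = h ∘ munit L x.
Proof. exact (@mn_nat _ _ _ _ _ (munit_mon L) x x' h). Qed.

Lemma pentagon_mod (a b c : A) (x : L) :
  mass L a b (c ⊙ x) ∘ mass L (a ⊗ b) c x =
  (idm a ⊡ mass L b c x) ∘ (mass L a (b ⊗ c) x ∘ (ass a b c ⊡ idm x)).
Proof. exact (@mod_pentagon A L a b c x). Qed.

Lemma triangle_mod (a : A) (x : L) :
  (idm a ⊡ munit L x) ∘ mass L a one x = run a ⊡ idm x.
Proof. exact (@mod_triangle A L a x). Qed.

Lemma one_act_faithful (x y : L) (f g : Hom x y) :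
  idm (@one A) ⊡ f = idm one ⊡ g -> f = g.
Proof.
  intro E; apply (epi_of_iso (@munit_iso A L x)).
  now rewrite <- !munit_nat, E.
Qed.

Lemma munit_mass (b : A) (x : L) :
  munit L (b ⊙ x) ∘ mass L one b x = lun b ⊡ idm x.
Proof.
  apply one_act_faithful.
  apply (epi_of_iso (@mass_iso A L one (one ⊗ b) x)).
  assert (I : is_iso (ass one one b ⊡ idm x)).
  { exists (assi one one b ⊡ idm x); destruct (ass_inv HA one one b) as [e e'].
    split; rewrite <- mhom_comp, ?e, ?e', comp_idl; apply mhom_id. }
  apply (epi_of_iso I).
  transitivity ((idm one ⊡ munit L (b ⊙ x)) ∘ (mass L one one (b ⊙ x)
                 ∘ mass L (one ⊗ one) b x)).
  - rewrite pentagon_mod, <- !comp_assoc, <- mhom_comp, comp_idl; reflexivity.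
  - rewrite <- comp_assoc, triangle_mod, <- mhom_id, <- mass_nat, <- (triangle HA).
    rewrite <- (comp_idl (idm x)), mhom_comp, <- comp_assoc, mass_nat.
    now rewrite !comp_idl.
Qed.

End ModuleFacts.

Section Canonical.
Context {A : SymCat} {L : BrModule A} (H : Enriched L).

(* The counit [x, y] ⊙ x -> y. *)
Definition ev (x y : L) : Hom (ih H x y ⊙ x) y := unc H (idm (ih H x y)).

Definition can_id (x : L) : Hom one (ih H x x) := cur H (munit L x).

Definition can_comp (x y z : L) : Hom (ih H y z ⊗ ih H x y) (ih H x z) :=
  cur H (ev y z ∘ ((idm (ih H y z) ⊡ ev x y) ∘ mass L (ih H y z) (ih H x y) x)).

Definition can_tens (x x' y y' : L) :
    Hom (ih H x x' ⊗ ih H y y') (ih H (x ⊗ y) (x' ⊗ y')) :=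
  cur H ((ev x x' ⊠ ev y y') ∘ f2i (mact L) (ih H x x', x) (ih H y y', y)).

(* The bijection L(x, y) ≅ A(1, [x, y]). *)
Definition can_mor {x y : L} (f : Hom x y) : Hom one (ih H x y) :=
  cur H (f ∘ munit L x).

Lemma ev_cur (a : A) (x y : L) (f : Hom (a ⊙ x) y) : ev x y ∘ (cur H f ⊡ idm x) = f.
Proof.
  rewrite <- (@unc_cur _ _ H _ _ _ (ev x y ∘ _)), cur_nat.
  unfold ev; rewrite cur_unc, comp_idl, unc_cur; reflexivity.
Qed.

Lemma cur_ext (a : A) (x y : L) (f g : Hom a (ih H x y)) :
  ev x y ∘ (f ⊡ idm x) = ev x y ∘ (g ⊡ idm x) -> f = g.
Proof.
  intro E; rewrite <- (comp_idl f), <- (comp_idl g), <- (@cur_unc _ _ H _ _ _ (idm _)).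
  rewrite <- !cur_nat; exact (f_equal (cur H) E).
Qed.

Lemma mhom_comp_l (a b c : A) (x : L) (f' : Hom b c) (f : Hom a b) :
  (f' ∘ f) ⊡ idm x = (f' ⊡ idm x) ∘ (f ⊡ idm x).
Proof. now rewrite <- mhom_comp, comp_idl. Qed.

Lemma mhom_comp_r (a : A) (x y z : L) (g' : Hom y z) (g : Hom x y) :
  idm a ⊡ (g' ∘ g) = (idm a ⊡ g') ∘ (idm a ⊡ g).
Proof. now rewrite <- mhom_comp, comp_idl. Qed.

Lemma mhom_slide (a b : A) (x y : L) (f : Hom a b) (g : Hom x y) :
  (idm b ⊡ g) ∘ (f ⊡ idm x) = (f ⊡ idm y) ∘ (idm a ⊡ g).
Proof. now rewrite <- !mhom_comp, !comp_idl, !comp_idr. Qed.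

Lemma can_idl x y :
  can_comp x y y ∘ (can_id y ⊠ idm (ih H x y)) = lun (ih H x y).
Proof.
  apply cur_ext; unfold can_comp.
  rewrite mhom_comp_l, <- comp_assoc, ev_cur, !comp_assoc, mass_nat, mhom_id.
  rewrite <- (comp_assoc (_ ⊡ _) (_ ⊡ _)), mhom_slide, <- !comp_assoc.
  unfold can_id; rewrite ev_cur, munit_nat, comp_assoc.
  now rewrite munit_mass.
Qed.

Lemma can_idr x y :
  can_comp x x y ∘ (idm (ih H x y) ⊠ can_id x) = run (ih H x y).
Proof.
  apply cur_ext; unfold can_comp.
  rewrite mhom_comp_l, <- comp_assoc, ev_cur, !comp_assoc, mass_nat.
  rewrite <- (comp_assoc (_ ⊡ _) (_ ⊡ _)), <- mhom_comp_r.
  unfold can_id; now rewrite ev_cur, triangle_mod.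
Qed.

Lemma can_assoc x y z w :
  can_comp x y w ∘ (can_comp y z w ⊠ idm (ih H x y)) =
  can_comp x z w ∘ ((idm (ih H z w) ⊠ can_comp x y z)
    ∘ ass (ih H z w) (ih H y z) (ih H x y)).
Proof.
  apply cur_ext.
  transitivity (ev z w ∘ ((idm _ ⊡ ev y z) ∘ ((idm _ ⊡ (idm _ ⊡ ev x y)) ∘
    (mass L (ih H z w) (ih H y z) (ih H x y ⊙ x) ∘
     mass L (ih H z w ⊗ ih H y z) (ih H x y) x)))).
  - unfold can_comp at 1.
    rewrite mhom_comp_l, <- comp_assoc, ev_cur, !comp_assoc, mass_nat, mhom_id.
    rewrite <- (comp_assoc (_ ⊡ _) (_ ⊡ _)), mhom_slide.
    rewrite <- !comp_assoc; unfold can_comp; rewrite ev_cur, !comp_assoc.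
    do 2 f_equal; rewrite <- !comp_assoc; f_equal.
    now rewrite <- mass_nat, (thom_id (bc_law A)).
  - rewrite pentagon_mod.
    unfold can_comp at 1.
    rewrite !mhom_comp_l, <- (comp_assoc (ev x w)), ev_cur, !comp_assoc; f_equal.
    rewrite <- (comp_assoc (mass _ _ _ _)), mass_nat, !comp_assoc.
    rewrite <- !(comp_assoc (idm _ ⊡ _)), <- !mhom_comp_r.
    unfold can_comp; now rewrite ev_cur, !mhom_comp_r, !comp_assoc.
Qed.

Definition can_enr : EnrCat A :=
  {| eob := L; ehom := ih H; eid := can_id; ecomp := can_comp;
     ecomp_idl := can_idl; ecomp_idr := can_idr; ecomp_assoc := can_assoc |}.

Definition canonical : EBData :=
  {| eb_base := A; eb_cat := can_enr;
     et := fun x y : can_enr => @tob L x y : can_enr;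
     eth := can_tens;
     e1 := @one L : can_enr;
     ea := fun x y z => can_mor (ass x y z); eai := fun x y z => can_mor (assi x y z);
     el := fun x => can_mor (lun x); eli := fun x => can_mor (luni x);
     er := fun x => can_mor (run x); eri := fun x => can_mor (runi x);
     ec := fun x y => can_mor (br x y); eci := fun x y => can_mor (bri x y) |}.

End Canonical.

Definition transparent {C : BMData} (x : C) : Prop :=
  forall y : C, br y x ∘ br x y = idm (x ⊗ y).

Section TransparentFacts.
Context {C : BMData} (HC : is_braided C).

Lemma inv_iso (x y : C) (f : Hom x y) (g : Hom y x) : is_inverse f g -> is_iso f.
Proof. now exists g. Qed.

Lemma inv_iso' (x y : C) (f : Hom x y) (g : Hom y x) : is_inverse f g -> is_iso g.
Proof. intros [h k]; now exists f. Qed.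

Lemma thom_iso (x x' y y' : C) (f : Hom x x') (g : Hom y y') :
  is_iso f -> is_iso g -> is_iso (f ⊠ g).
Proof.
  intros [f' [h1 h2]] [g' [k1 k2]]; exists (f' ⊠ g').
  split; rewrite <- (thom_comp HC); [rewrite h1, k1 | rewrite h2, k2]; apply (thom_id HC).
Qed.

Lemma id_iso (x : C) : is_iso (idm x).
Proof. exists (idm x); split; apply comp_idl. Qed.

Lemma one_tens_faithful (x y : C) (f g : Hom x y) :
  idm (@one C) ⊠ f = idm one ⊠ g -> f = g.
Proof.
  intro E; apply (epi_of_iso (inv_iso (lun_inv HC x))).
  now rewrite <- !(lun_nat HC), E.
Qed.

Lemma tens_one_faithful (x y : C) (f g : Hom x y) :
  f ⊠ idm (@one C) = g ⊠ idm one -> f = g.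
Proof.
  intro E; apply (epi_of_iso (inv_iso (run_inv HC x))).
  now rewrite <- !(run_nat HC), E.
Qed.

Lemma lun_ass (x y : C) : lun (x ⊗ y) ∘ ass one x y = lun x ⊠ idm y.
Proof.
  apply one_tens_faithful.
  apply (epi_of_iso (inv_iso (ass_inv HC one (one ⊗ x) y))).
  apply (epi_of_iso (thom_iso (inv_iso (ass_inv HC one one x)) (id_iso y))).
  transitivity ((idm one ⊠ lun (x ⊗ y)) ∘ (ass one one (x ⊗ y) ∘ ass (one ⊗ one) x y)).
  - rewrite (pentagon HC), <- !comp_assoc, <- (thom_comp HC), comp_idl; reflexivity.
  - rewrite <- comp_assoc, (triangle HC), <- (thom_id HC), <- (ass_nat HC).
    rewrite <- (triangle HC), <- (comp_idl (idm y)), (thom_comp HC).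
    rewrite <- comp_assoc, (ass_nat HC); now rewrite !comp_idl.
Qed.

Lemma lun_one_tens (x : C) : lun (one ⊗ x) = idm one ⊠ lun x.
Proof.
  apply (mono_of_iso (inv_iso (lun_inv HC x))).
  now rewrite (lun_nat HC).
Qed.

Lemma br_hex2 (x y z : C) :
  br (x ⊗ y) z = ass z x y ∘ ((br x z ⊠ idm y)
    ∘ (assi x z y ∘ ((idm x ⊠ br y z) ∘ ass x y z))).
Proof.
  apply (epi_of_iso (inv_iso' (ass_inv HC x y z))).
  apply (mono_of_iso (inv_iso' (ass_inv HC z x y))).
  rewrite (hexagon2 HC), !comp_assoc, (proj2 (ass_inv HC x y z)), comp_idr.
  now rewrite <- (comp_assoc (assi z x y)), (proj1 (ass_inv HC z x y)), comp_idl.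
Qed.

Lemma br_hex1 (x y z : C) :
  br x (y ⊗ z) = assi y z x ∘ ((idm y ⊠ br x z)
    ∘ (ass y x z ∘ ((br x y ⊠ idm z) ∘ assi x y z))).
Proof.
  apply (epi_of_iso (inv_iso (ass_inv HC x y z))).
  apply (mono_of_iso (inv_iso (ass_inv HC y z x))).
  rewrite (hexagon1 HC), !comp_assoc, (proj1 (ass_inv HC x y z)), comp_idr.
  now rewrite <- (comp_assoc (ass y z x)), (proj2 (ass_inv HC y z x)), comp_idl.
Qed.

Lemma br_unit_l (y : C) : run y ∘ br one y = lun y.
Proof.
  apply tens_one_faithful.
  apply (epi_of_iso (inv_iso' (ass_inv HC one y one))).
  apply (epi_of_iso (thom_iso (id_iso one) (inv_iso (br_inv HC one y)))).
  apply (epi_of_iso (inv_iso (ass_inv HC one one y))).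
  transitivity (br one y ∘ (lun one ⊠ idm y)).
  - rewrite (br_nat HC), br_hex2, <- (comp_assoc (idm y ⊠ lun one)), (triangle HC).
    assert (E : (run y ∘ br one y) ⊠ idm one = (run y ⊠ idm one) ∘ (br one y ⊠ idm one))
      by now rewrite <- (thom_comp HC), comp_idl.
    now rewrite E, !comp_assoc.
  - rewrite (lun_one HC), <- (triangle HC), <- lun_one_tens, <- comp_assoc.
    rewrite <- (lun_nat HC), <- lun_ass, !comp_assoc.
    f_equal; rewrite <- !comp_assoc.
    now rewrite (proj2 (ass_inv HC one y one)), comp_idl.
Qed.

Lemma transparent_one : transparent (@one C).
Proof.
  intro y.
  apply (mono_of_iso (inv_iso (lun_inv HC y))).
  now rewrite <- comp_assoc, (br_unit HC), br_unit_l, comp_idr.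
Qed.

Lemma transparent_tens (x y : C) : transparent x -> transparent y -> transparent (x ⊗ y).
Proof.
  intros tx ty z; rewrite br_hex1, br_hex2, !comp_assoc.
  rewrite <- (comp_assoc (assi z x y)), (proj1 (ass_inv HC z x y)), comp_idl.
  rewrite <- (comp_assoc (br z x ⊠ _)), <- (thom_comp HC), tx, comp_idl, (thom_id HC), comp_idl.
  rewrite <- (comp_assoc (ass x z y)), (proj2 (ass_inv HC x z y)), comp_idl.
  rewrite <- (comp_assoc (idm x ⊠ _)), <- (thom_comp HC), ty, comp_idl, (thom_id HC), comp_idl.
  apply (proj1 (ass_inv HC x y z)).
Qed.

Lemma transparent_iso (x x' : C) (f : Hom x x') : is_iso f -> transparent x -> transparent x'.
Proof.
  intros If tx y.
  apply (epi_of_iso (thom_iso If (id_iso y))).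
  now rewrite comp_assoc, (br_nat HC), <- comp_assoc, (br_nat HC), comp_assoc, tx,
    comp_idl, comp_idr.
Qed.

End TransparentFacts.

Definition muger_bm (C : BrCat) : BMData :=
  let P := @transparent C in
  let t (x y : full_subcat P) : full_subcat P :=
    exist P (tob (proj1_sig x) (proj1_sig y))
      (transparent_tens (bc_law C) (proj2_sig x) (proj2_sig y)) in
  {| bm_cat := full_subcat P;
     tob := t;
     thom := fun x x' y y' f g => @thom C _ _ _ _ f g;
     one := exist P one (transparent_one (bc_law C));
     ass := fun x y z => @ass C _ _ _; assi := fun x y z => @assi C _ _ _;
     lun := fun x => @lun C _; luni := fun x => @luni C _;
     run := fun x => @run C _; runi := fun x => @runi C _;
     br := fun x y => @br C _ _; bri := fun x y => @bri C _ _ |}.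

Lemma muger_is_braided (C : BrCat) : is_braided (muger_bm C).
Proof.
  pose proof (bc_law C) as HC; split; cbn; intros; apply HC.
Qed.

Definition muger (C : BrCat) : BrCat :=
  {| bc_data := muger_bm C; bc_law := muger_is_braided C |}.

Lemma br_fun_transparent {C D : BMData} (HD : is_braided D) (F : MonFun C D)
    (HF : is_br_fun F) (x y : C) :
  br y x ∘ br x y = idm (x ⊗ y) -> br (F y) (F x) ∘ br (F x) (F y) = idm (F x ⊗ F y).
Proof.
  intro E; apply (mono_of_iso (inv_iso (f2_inv HF x y))).
  rewrite <- comp_assoc, <- (f2_br HF y x), comp_assoc, <- (f2_br HF x y).
  now rewrite <- comp_assoc, <- (fhom_comp HF), E, (fhom_id HF), comp_idl, comp_idr.
Qed.

Lemma transparent_act {A : SymCat} (L : BrModule A) (a : A) (x : L) :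
  transparent x -> transparent (a ⊙ x).
Proof.
  intros tx y; pose proof (bc_law L) as HL.
  assert (K : br (one ⊙ y) (a ⊙ x) ∘ br (a ⊙ x) (one ⊙ y) = idm _).
  { apply (br_fun_transparent HL (mact_law L) (x := (a, x)) (y := (one, y))).
    cbn; f_equal; [apply sc_sym | apply tx]. }
  apply (epi_of_iso (thom_iso HL (id_iso (C := L) (a ⊙ x)) (munit_iso L y))).
  rewrite comp_assoc, (br_nat HL), <- comp_assoc, (br_nat HL), comp_assoc, K.
  now rewrite comp_idl, comp_idr.
Qed.

Definition muger_act {A : SymCat} (L : BrModule A) : MonFun (prod_bm A (muger L)) (muger L).
Proof.
  refine {| fob := fun z : prod_bm A (muger L) =>
      exist (@transparent L) (fst z ⊙ proj1_sig (snd z))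
        (transparent_act (fst z) (proj2_sig (snd z))) : muger L;
    fhom := fun x y f => @fhom _ _ (mact L) (fst x, proj1_sig (snd x))
      (fst y, proj1_sig (snd y)) f;
    f2 := fun x y => f2 (mact L) (fst x, proj1_sig (snd x)) (fst y, proj1_sig (snd y));
    f2i := fun x y => f2i (mact L) (fst x, proj1_sig (snd x)) (fst y, proj1_sig (snd y));
    f0 := f0 (mact L); f0i := f0i (mact L) |}.
Defined.

Lemma muger_act_law {A : SymCat} (L : BrModule A) : is_br_fun (muger_act L).
Proof.
  pose proof (mact_law L) as HM.
  pose (i := fun z : prod_bm A (muger L) => (fst z, proj1_sig (snd z)) : prod_bm A L).
  split; [split |]; intros.
  - exact (fhom_id HM (i x)).
  - exact (@fhom_comp _ _ _ HM (i x) (i y) (i z) g f).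
  - exact (f2_inv HM (i x) (i y)).
  - exact (f0_inv HM).
  - exact (@f2_nat _ _ _ HM (i x) (i x') (i y) (i y') f g).
  - exact (f2_ass HM (i x) (i y) (i z)).
  - exact (f2_lun HM (i x)).
  - exact (f2_run HM (i x)).
  - exact (f2_br HM (i x) (i y)).
Qed.

Lemma muger_is_iso (C : BrCat) (x y : muger C) (f : Hom x y) :
  @is_iso C (proj1_sig x) (proj1_sig y) f -> is_iso f.
Proof. intros [g [h k]]; exists g; now split. Qed.

Definition muger_mod {A : SymCat} (L : BrModule A) : BrModule A.
Proof.
  refine {| bm_br := muger L;
            mact := muger_act L;
            mact_law := muger_act_law L;
            mass := fun a b x => mass L a b (proj1_sig x);
            munit := fun x => munit L (proj1_sig x) |}.
  - intros a b x; apply muger_is_iso, (mass_iso L).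
  - intros x; apply muger_is_iso, (munit_iso L).
  - pose (i := fun z : prod_bm (prod_bm A A) (muger L) =>
      (fst z, proj1_sig (snd z)) : prod_bm (prod_bm A A) L).
    pose proof (mass_mon L) as HL; split.
    + intros x y f; exact (@mn_nat _ _ _ _ _ HL (i x) (i y) f).
    + intros x y; exact (@mn_2 _ _ _ _ _ HL (i x) (i y)).
    + exact (mn_0 HL).
  - pose proof (munit_mon L) as HL; split.
    + intros x y f; exact (@mn_nat _ _ _ _ _ HL (proj1_sig x) (proj1_sig y) f).
    + intros x y; exact (@mn_2 _ _ _ _ _ HL (proj1_sig x) (proj1_sig y)).
    + exact (mn_0 HL).
  - intros a b c x; exact (mod_pentagon L a b c (proj1_sig x)).
  - intros a x; exact (mod_triangle L a (proj1_sig x)).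
Defined.

Definition muger_enriched {A : SymCat} {L : BrModule A} (H : Enriched L) :
    Enriched (muger_mod L) :=
  {| ih := fun x y : muger_mod L => ih H (proj1_sig x) (proj1_sig y);
     cur := fun a (x y : muger_mod L) f => @cur _ _ H a (proj1_sig x) (proj1_sig y) f;
     unc := fun a (x y : muger_mod L) f => @unc _ _ H a (proj1_sig x) (proj1_sig y) f;
     unc_cur := fun a x y f => @unc_cur _ _ H a (proj1_sig x) (proj1_sig y) f;
     cur_unc := fun a x y f => @cur_unc _ _ H a (proj1_sig x) (proj1_sig y) f;
     cur_nat := fun a b x y f h => @cur_nat _ _ H a b (proj1_sig x) (proj1_sig y) f h |}.

(* Main.v *)
Require Import Defs.
From Stdlib Require Import IndefiniteDescription ProofIrrelevance.

Set Implicit Arguments.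
Unset Strict Implicit.
Unset Printing Implicit Defensive.

(** The E_2-center of any enriched braided category X is its full enriched
    subcategory on the objects that are transparent in the underlying braided
    category, acting on X by the tensor product ([regular_terminal]).

    The argument takes place in ordinary braided categories.  Let D act unitally on C
    by a braided functor G : D × C -> C, with a unit object u of D and
    alpha : G(u, x) ≅ x.  Put p(d) = G(d, 1).
    - p(d) is transparent: y ≅ G(u, y), and the double braiding of G(d, 1) with
      G(u, y) is the image under G of that of (d, 1) with (u, y), which is trivial as
      u ≅ 1 ([action_transparent]).
    - p recovers the action, through the monoidal isomorphism
      p(d) ⊗ x ≅ G(d, 1) ⊗ G(u, x) ≅ G(d ⊗ u, 1 ⊗ x) ≅ G(d, x)  ([rho_action_map]).
    - If r : p(d) ⊗ x ≅ G(d, x) and r' : q(d) ⊗ x ≅ G(d, x) are two such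
      presentations of the action, the only candidate for a comparison p ⇒ q is read
      off at x = 1.  It is compatible with r and r' at every x, because monoidality at
      the pair (d, 1), (u, x) expresses r(d, x) by r(d, 1) and r(u, x), and r(u, x) is
      fixed by the coherence with alpha ([xi_all]).

    An enriched action consists of a background level and an underlying level, and both
    are instances of this situation.  What is left is enriched naturality of the
    morphisms so constructed.  All of them are composites of structure morphisms, and
    naturality squares ([sq]) can be composed, inverted, tensored and transported along
    enriched functors.

    For X the canonical construction of L, squares transpose along the adjunction
    between the action and the internal hom to equations in L
    ([sq_transpose_iff]).  This gives both that X is an enriched braided
    category ([can_eb]) and that its underlying braided category is L, so that
    transparency in X is transparency in L.  Then the full enriched subcategory on the
    transparent objects is the canonical construction of the Müger center
    ([canonical_muger]). *)

(** * Isomorphisms *)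

Definition inv_of {C : Category} {x y : C} {f : Hom x y} (h : is_iso f) : Hom y x :=
  proj1_sig (constructive_indefinite_description _ h).

Lemma inv_of_spec {C : Category} {x y : C} {f : Hom x y} (h : is_iso f) :
  is_inverse f (inv_of h).
Proof. exact (proj2_sig (constructive_indefinite_description _ h)). Qed.

Lemma inv_of_l {C : Category} {x y : C} {f : Hom x y} (h : is_iso f) :
  inv_of h ∘ f = idm x.
Proof. apply (inv_of_spec h). Qed.

Lemma comp_iso {C : Category} {x y z : C} (g : Hom y z) (f : Hom x y) :
  is_iso g -> is_iso f -> is_iso (g ∘ f).
Proof.
  intros [g' [a b]] [f' [c d]]; exists (f' ∘ g'); split.
  - now rewrite comp_assoc, <- (comp_assoc g'), a, comp_idl.
  - now rewrite comp_assoc, <- (comp_assoc f), d, comp_idl.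
Qed.

Lemma inverse_sym {C : Category} {x y : C} (f : Hom x y) (g : Hom y x) :
  is_inverse f g -> is_inverse g f.
Proof. intros []; now split. Qed.

Lemma inverse_comp {C : Category} {x y z : C} (g : Hom y z) (f : Hom x y) f' g' :
  is_inverse g g' -> is_inverse f f' -> is_inverse (g ∘ f) (f' ∘ g').
Proof.
  intros [a b] [c d]; split.
  - now rewrite comp_assoc, <- (comp_assoc g'), a, comp_idl.
  - now rewrite comp_assoc, <- (comp_assoc f), d, comp_idl.
Qed.

Lemma inverse_id {C : Category} (x : C) : is_inverse (idm x) (idm x).
Proof. split; apply comp_idl. Qed.

Lemma inverse_thom {C : BMData} (HC : is_braided C) {x x' y y' : C}
    (f : Hom x x') (g : Hom y y') f' g' :
  is_inverse f f' -> is_inverse g g' -> is_inverse (f ⊠ g) (f' ⊠ g').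
Proof.
  intros [a b] [c d]; split; rewrite <- (thom_comp HC), ?a, ?b, ?c, ?d; apply (thom_id HC).
Qed.

(** * Coherence in braided categories *)

Section Coherence.
Context {C : BMData} (HC : is_braided C).

Lemma wh_comp (a x y z : C) (g : Hom y z) (f : Hom x y) :
  idm a ⊠ (g ∘ f) = (idm a ⊠ g) ∘ (idm a ⊠ f).
Proof. now rewrite <- (thom_comp HC), comp_idl. Qed.

Lemma wh_comp_r (a x y z : C) (g : Hom y z) (f : Hom x y) :
  (g ∘ f) ⊠ idm a = (g ⊠ idm a) ∘ (f ⊠ idm a).
Proof. now rewrite <- (thom_comp HC), comp_idl. Qed.

Lemma thom_split1 (x x' y y' : C) (f : Hom x x') (g : Hom y y') :
  f ⊠ g = (f ⊠ idm y') ∘ (idm x ⊠ g).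
Proof. now rewrite <- (thom_comp HC), comp_idl, comp_idr. Qed.

Lemma thom_split2 (x x' y y' : C) (f : Hom x x') (g : Hom y y') :
  f ⊠ g = (idm x' ⊠ g) ∘ (f ⊠ idm y).
Proof. now rewrite <- (thom_comp HC), comp_idl, comp_idr. Qed.

Lemma thom_comp_l (x y z w v : C) (g : Hom y z) (f : Hom x y) (k : Hom w v) :
  (g ∘ f) ⊠ k = (g ⊠ k) ∘ (f ⊠ idm w).
Proof. now rewrite <- (thom_comp HC), comp_idr. Qed.

Lemma thom_comp_r (x y z w v : C) (g : Hom y z) (f : Hom x y) (k : Hom w v) :
  k ⊠ (g ∘ f) = (k ⊠ g) ∘ (idm w ⊠ f).
Proof. now rewrite <- (thom_comp HC), comp_idr. Qed.

(** An object of C is made to act on C by tensoring on the left.  Acting by a bracketed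
    word amounts to acting by its letters one after the other, so associators and unitors
    act as identities, definitionally, and an equation between structure morphisms
    is reduced to one between braidings of adjacent letters.  The action is faithful
    since it can be evaluated at the unit. *)
Inductive word := wvar (x : C) | wone | wtens (s t : word).

Fixpoint sem (s : word) : C :=
  match s with wvar x => x | wone => one | wtens s t => sem s ⊗ sem t end.

Fixpoint act (s : word) (v : C) : C :=
  match s with wvar x => x ⊗ v | wone => v | wtens s t => act s (act t v) end.

Fixpoint acth (s : word) {v w : C} (f : Hom v w) : Hom (act s v) (act s w) :=
  match s with wvar x => idm x ⊠ f | wone => f | wtens s t => acth s (acth t f) end.

Fixpoint flat (s : word) (v : C) : Hom (sem s ⊗ v) (act s v) :=
  match s return Hom (sem s ⊗ v) (act s v) with
  | wvar x => idm (x ⊗ v)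
  | wone => lun v
  | wtens s t => flat s (act t v) ∘ ((idm (sem s) ⊠ flat t v) ∘ ass (sem s) (sem t) v)
  end.

Lemma flat_iso s : forall v, is_iso (flat s v).
Proof.
  induction s as [x | | s IHs t IHt]; intro v; cbn.
  - apply id_iso.
  - apply (inv_iso (lun_inv HC v)).
  - apply comp_iso; [apply IHs | apply comp_iso].
    + apply (thom_iso HC); [apply id_iso | apply IHt].
    + apply (inv_iso (ass_inv HC _ _ _)).
Qed.

Lemma acth_id s : forall v, acth s (idm v) = idm (act s v).
Proof.
  induction s as [x | | s IHs t IHt]; intro v; cbn.
  - apply (thom_id HC).
  - reflexivity.
  - now rewrite IHt, IHs.
Qed.

Lemma flat_nat s : forall (v w : C) (f : Hom v w),
  flat s w ∘ (idm (sem s) ⊠ f) = acth s f ∘ flat s v.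
Proof.
  induction s as [x | | s IHs t IHt]; intros; cbn.
  - now rewrite comp_idl, comp_idr.
  - apply (lun_nat HC).
  - rewrite <- (comp_assoc (acth s _)), <- IHs, !comp_assoc; f_equal.
    rewrite <- !comp_assoc, <- wh_comp, <- IHt, wh_comp, !comp_assoc; f_equal.
    rewrite <- (thom_id HC); apply (ass_nat HC).
Qed.

(** F is f ⊗ v, read through the normalizations [flat]. *)
Definition acts_as (s t : word) (f : Hom (sem s) (sem t))
    (F : forall v, Hom (act s v) (act t v)) : Prop :=
  forall v, F v ∘ flat s v = flat t v ∘ (f ⊠ idm v).

Lemma acts_as_eq s t (f g : Hom (sem s) (sem t)) F G :
  acts_as f F -> acts_as g G -> (forall v, F v = G v) -> f = g.
Proof.
  intros rf rg E; apply (tens_one_faithful HC), (mono_of_iso (flat_iso t one)).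
  now rewrite <- rf, <- rg, E.
Qed.

Lemma acts_as_ext s t (f : Hom (sem s) (sem t)) F G :
  acts_as f F -> (forall v, F v = G v) -> acts_as f G.
Proof. intros rf E v; rewrite <- E; apply rf. Qed.

Lemma acts_as_id s : acts_as (s := s) (t := s) (idm (sem s)) (fun v => idm _).
Proof. intro v; rewrite comp_idl, (thom_id HC); symmetry; apply comp_idr. Qed.

Lemma acts_as_comp s t r (g : Hom (sem t) (sem r)) (f : Hom (sem s) (sem t)) G F :
  acts_as g G -> acts_as f F -> acts_as (s := s) (t := r) (g ∘ f) (fun v => G v ∘ F v).
Proof.
  intros rg rf v.
  now rewrite comp_assoc, rf, <- comp_assoc, rg, comp_assoc, wh_comp_r.
Qed.

Lemma acts_as_tens s t s' t' (f : Hom (sem s) (sem t)) (g : Hom (sem s') (sem t')) F G :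
  acts_as f F -> acts_as g G ->
  acts_as (s := wtens s s') (t := wtens t t') (f ⊠ g) (fun v => F (act t' v) ∘ acth s (G v)).
Proof.
  intros rf rg v; cbn.
  rewrite comp_assoc, <- (comp_assoc (acth s _)), <- flat_nat, !comp_assoc.
  rewrite <- (comp_assoc (F _)), rf, !comp_assoc; f_equal.
  rewrite (ass_nat HC), <- !comp_assoc; f_equal.
  rewrite <- !(thom_comp HC), !comp_idl, !comp_idr; f_equal; apply rg.
Qed.

Lemma acts_as_inv s t (f : Hom (sem s) (sem t)) g F G :
  is_inverse f g -> acts_as f F -> (forall v, G v ∘ F v = idm _) -> acts_as g G.
Proof.
  intros [a b] rf E v.
  apply (epi_of_iso (thom_iso HC (inv_iso (conj a b)) (id_iso v))).
  rewrite !comp_assoc, <- wh_comp_r, a, (thom_id HC), comp_idr, <- rf.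
  now rewrite <- comp_assoc, E, comp_idl.
Qed.

(** After naturality of [flat], this is the pentagon. *)
Lemma acts_as_ass s t r :
  acts_as (s := wtens (wtens s t) r) (t := wtens s (wtens t r))
    (ass (sem s) (sem t) (sem r)) (fun v => idm _).
Proof.
  intro v; cbn; rewrite comp_idl, !comp_assoc; f_equal.
  rewrite !wh_comp, !comp_assoc; f_equal.
  rewrite <- (pentagon HC), <- !comp_assoc; f_equal.
  rewrite <- (thom_id HC); apply (ass_nat HC).
Qed.

Lemma acts_as_assi s t r :
  acts_as (s := wtens s (wtens t r)) (t := wtens (wtens s t) r)
    (assi (sem s) (sem t) (sem r)) (fun v => idm _).
Proof.
  refine (acts_as_inv (s := wtens (wtens s t) r) (t := wtens s (wtens t r))
    (ass_inv HC _ _ _) (acts_as_ass s t r) _); intro; apply comp_idl.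
Qed.

Lemma acts_as_lun s : acts_as (s := wtens wone s) (t := s) (lun (sem s)) (fun v => idm _).
Proof.
  intro v; cbn; rewrite comp_idl, <- comp_assoc, (lun_nat HC), comp_assoc.
  now rewrite (lun_ass HC).
Qed.

Lemma acts_as_luni s : acts_as (s := s) (t := wtens wone s) (luni (sem s)) (fun v => idm _).
Proof.
  refine (acts_as_inv (s := wtens wone s) (t := s) (lun_inv HC _) (acts_as_lun s) _).
  intro; apply comp_idl.
Qed.

(** This is the triangle, since [flat] removes the unit by [lun]. *)
Lemma acts_as_run s : acts_as (s := wtens s wone) (t := s) (run (sem s)) (fun v => idm _).
Proof. intro v; cbn; now rewrite comp_idl, (triangle HC). Qed.

Lemma acts_as_runi s : acts_as (s := s) (t := wtens s wone) (runi (sem s)) (fun v => idm _).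
Proof.
  refine (acts_as_inv (s := wtens s wone) (t := s) (run_inv HC _) (acts_as_run s) _).
  intro; apply comp_idl.
Qed.

(** The braiding of two adjacent letters in front of v. *)
Definition brv (x y v : C) : Hom (x ⊗ (y ⊗ v)) (y ⊗ (x ⊗ v)) :=
  ass y x v ∘ ((br x y ⊠ idm v) ∘ assi x y v).

(** The hexagons dictate how a braiding of words acts: as successive braidings of
    letters. *)
Fixpoint brw1 (x : C) (t : word) (v : C) : Hom (x ⊗ act t v) (act t (x ⊗ v)) :=
  match t return Hom (x ⊗ act t v) (act t (x ⊗ v)) with
  | wvar y => brv x y v
  | wone => idm _
  | wtens t r => acth t (brw1 x r v) ∘ brw1 x t (act r v)
  end.

Fixpoint brw (s t : word) (v : C) : Hom (act s (act t v)) (act t (act s v)) :=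
  match s return Hom (act s (act t v)) (act t (act s v)) with
  | wvar x => brw1 x t v
  | wone => idm _
  | wtens s r => brw s t (act r v) ∘ acth s (brw r t v)
  end.

Lemma br_one_r (x : C) : br x one = luni x ∘ run x.
Proof.
  apply (mono_of_iso (inv_iso (lun_inv HC x))).
  now rewrite (br_unit HC), <- comp_assoc, (proj2 (lun_inv HC x)), comp_idl.
Qed.

Lemma br_one_l (x : C) : br one x = runi x ∘ lun x.
Proof.
  apply (mono_of_iso (inv_iso (run_inv HC x))).
  now rewrite (br_unit_l HC), <- comp_assoc, (proj2 (run_inv HC x)), comp_idl.
Qed.

Lemma acts_as_br1 (x : C) (t : word) :
  acts_as (s := wtens (wvar x) t) (t := wtens t (wvar x)) (br x (sem t)) (brw1 x t).
Proof.
  induction t as [y | | t IHt r IHr].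
  - intro v; cbn; unfold brv.
    rewrite !(thom_id HC), !comp_idl, !comp_assoc.
    now rewrite (proj1 (ass_inv HC _ _ _)), comp_idr.
  - cbn [sem]; rewrite br_one_r.
    refine (acts_as_ext (acts_as_comp (acts_as_luni (wvar x)) (acts_as_run (wvar x))) _).
    intro v; apply comp_idl.
  - cbn [sem]; rewrite (br_hex1 HC).
    refine (acts_as_ext (acts_as_comp (acts_as_assi t r (wvar x)) (acts_as_comp
       (acts_as_tens (acts_as_id t) IHr) (acts_as_comp (acts_as_ass t (wvar x) r)
         (acts_as_comp (acts_as_tens IHt (acts_as_id r)) (acts_as_assi (wvar x) t r))))) _).
    intro v; cbn; now rewrite !comp_idl, acth_id, (thom_id HC), !comp_idr.
Qed.

Lemma acts_as_br (s t : word) :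
  acts_as (s := wtens s t) (t := wtens t s) (br (sem s) (sem t)) (brw s t).
Proof.
  induction s as [x | | s IHs r IHr].
  - apply acts_as_br1.
  - cbn [sem]; rewrite br_one_l.
    refine (acts_as_ext (acts_as_comp (acts_as_runi t) (acts_as_lun t)) _).
    intro v; apply comp_idl.
  - cbn [sem]; rewrite (br_hex2 HC).
    refine (acts_as_ext (acts_as_comp (acts_as_ass t s r) (acts_as_comp
       (acts_as_tens IHs (acts_as_id r)) (acts_as_comp (acts_as_assi s t r)
         (acts_as_comp (acts_as_tens (acts_as_id s) IHr) (acts_as_ass s r t))))) _).
    intro v; cbn; now rewrite !comp_idl, !acth_id, !comp_idr.
Qed.

Lemma brv_nat (x y v w : C) (f : Hom v w) :
  brv x y w ∘ (idm x ⊠ (idm y ⊠ f)) = (idm y ⊠ (idm x ⊠ f)) ∘ brv x y v.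
Proof.
  unfold brv; rewrite !comp_assoc.
  assert (E : assi x y w ∘ (idm x ⊠ (idm y ⊠ f)) = (idm (x ⊗ y) ⊠ f) ∘ assi x y v).
  { apply (epi_of_iso (inv_iso (ass_inv HC x y v))).
    rewrite !comp_assoc, <- (ass_nat HC), (proj1 (ass_inv HC x y v)), comp_idr.
    now rewrite <- comp_assoc, (proj1 (ass_inv HC x y w)), comp_idl, (thom_id HC). }
  rewrite E, <- (comp_assoc (br x y ⊠ _)), <- thom_split1, thom_split2.
  rewrite <- !comp_assoc; do 2 f_equal.
  rewrite <- (thom_id HC); apply (ass_nat HC).
Qed.

Lemma brv_sym (x y v : C) : br y x ∘ br x y = idm _ -> brv y x v ∘ brv x y v = idm _.
Proof.
  intro E; unfold brv; rewrite !comp_assoc.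
  rewrite <- (comp_assoc (assi y x v)), (proj1 (ass_inv HC y x v)), comp_idl.
  rewrite <- (comp_assoc (br y x ⊠ _)), <- wh_comp_r, E, (thom_id HC), comp_idl.
  apply (ass_inv HC).
Qed.

End Coherence.

Arguments wvar {C} x.
Arguments wone {C}.

Ltac reify_ob x :=
  lazymatch x with
  | ?a ⊗ ?b => let s := reify_ob a in let t := reify_ob b in constr:(wtens s t)
  | @one ?D => constr:(@wone D)
  | _ => constr:(wvar x)
  end.

Ltac reify_hom HC f :=
  lazymatch f with
  | idm ?x => let s := reify_ob x in constr:(acts_as_id HC s)
  | ?g ∘ ?h => let a := reify_hom HC g in let b := reify_hom HC h in
      constr:(acts_as_comp HC a b)
  | ?g ⊠ ?h => let a := reify_hom HC g in let b := reify_hom HC h in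
      constr:(acts_as_tens HC a b)
  | ass ?x ?y ?z => let s := reify_ob x in let t := reify_ob y in let r := reify_ob z in
      constr:(acts_as_ass HC s t r)
  | assi ?x ?y ?z => let s := reify_ob x in let t := reify_ob y in let r := reify_ob z in
      constr:(acts_as_assi HC s t r)
  | lun ?x => let s := reify_ob x in constr:(acts_as_lun HC s)
  | luni ?x => let s := reify_ob x in constr:(acts_as_luni HC s)
  | run ?x => let s := reify_ob x in constr:(acts_as_run HC s)
  | runi ?x => let s := reify_ob x in constr:(acts_as_runi HC s)
  | br ?x ?y => let s := reify_ob x in let t := reify_ob y in constr:(acts_as_br HC s t)
  end.

(** Turns an equation between composites of structure morphisms into the equation
    between their actions.  Such goals then differ at most by naturality of [brv] in its
    last argument and, for symmetric braidings, by cancellations. *)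
Ltac strictify HC :=
  lazymatch goal with
  | |- ?f = ?g =>
    let a := reify_hom HC f in let b := reify_hom HC g in
    refine (acts_as_eq HC a b _);
    let v := fresh "v" in intro v; cbn [act acth brw brw1];
    rewrite ?(wh_comp HC); repeat rewrite ?(thom_id HC), ?comp_idl, ?comp_idr;
    rewrite ?comp_assoc
  end.

(** * The tensor product of a braided category as a functor *)

Section Tens.
Context {C : BMData} (HC : is_braided C).

Lemma swap_mid_inverse (a b c d : C) : is_inverse (swap_mid a b c d) (swap_midi a b c d).
Proof.
  assert (E : swap_midi a b c d = (assi a b (c ⊗ d) ∘
      (idm a ⊠ ((ass b c d ∘ (bri b c ⊠ idm d)) ∘ assi c b d))) ∘ ass a c (b ⊗ d))
    by (unfold swap_midi; now rewrite !comp_assoc).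
  rewrite E; unfold swap_mid; apply inverse_comp; [apply inverse_sym, (ass_inv HC) |].
  apply inverse_comp; [| apply (ass_inv HC)].
  apply (inverse_thom HC); [apply inverse_id |].
  apply inverse_comp; [apply (ass_inv HC) | apply inverse_comp].
  - apply (inverse_thom HC); [apply (br_inv HC) | apply inverse_id].
  - apply inverse_sym, (ass_inv HC).
Qed.

Lemma assi_nat (x x' y y' z z' : C) (f : Hom x x') (g : Hom y y') (h : Hom z z') :
  assi x' y' z' ∘ (f ⊠ (g ⊠ h)) = ((f ⊠ g) ⊠ h) ∘ assi x y z.
Proof.
  apply (epi_of_iso (inv_iso (ass_inv HC x y z))).
  rewrite !comp_assoc, <- (ass_nat HC), (proj1 (ass_inv HC x y z)), comp_idr.
  now rewrite <- comp_assoc, (proj1 (ass_inv HC x' y' z')), comp_idl.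
Qed.

Lemma luni_nat (x x' : C) (f : Hom x x') : (idm one ⊠ f) ∘ luni x = luni x' ∘ f.
Proof.
  apply (mono_of_iso (inv_iso (lun_inv HC x'))).
  rewrite <- !comp_assoc, (lun_nat HC), (proj2 (lun_inv HC x')), comp_idl.
  now rewrite comp_assoc, (proj2 (lun_inv HC x)), comp_idr.
Qed.

Lemma runi_nat (x x' : C) (f : Hom x x') : (f ⊠ idm one) ∘ runi x = runi x' ∘ f.
Proof.
  apply (mono_of_iso (inv_iso (run_inv HC x'))).
  rewrite <- !comp_assoc, (run_nat HC), (proj2 (run_inv HC x')), comp_idl.
  now rewrite comp_assoc, (proj2 (run_inv HC x)), comp_idr.
Qed.

Lemma luni_one : luni (@one C) = runi one.
Proof.
  apply (mono_of_iso (inv_iso (lun_inv HC one))).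
  rewrite (proj2 (lun_inv HC _)), (lun_one HC); symmetry; apply (run_inv HC).
Qed.

Lemma brv_natural (b b' c c' d d' : C) (g : Hom b b') (h : Hom c c') (k : Hom d d') :
  brv b' c' d' ∘ (g ⊠ (h ⊠ k)) = (h ⊠ (g ⊠ k)) ∘ brv b c d.
Proof.
  assert (E : (br b' c' ⊠ idm d') ∘ ((g ⊠ h) ⊠ k) = ((h ⊠ g) ⊠ k) ∘ (br b c ⊠ idm d))
    by now rewrite <- !(thom_comp HC), (br_nat HC), comp_idl, comp_idr.
  unfold brv; rewrite !comp_assoc, assi_nat, <- (comp_assoc (br b' c' ⊠ _)), E.
  now rewrite !comp_assoc, <- !comp_assoc, (ass_nat HC).
Qed.

Lemma swap_mid_nat (a b c d a' b' c' d' : C) (f : Hom a a') (g : Hom b b') (h : Hom c c')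
    (k : Hom d d') :
  swap_mid a' b' c' d' ∘ ((f ⊠ g) ⊠ (h ⊠ k)) = ((f ⊠ h) ⊠ (g ⊠ k)) ∘ swap_mid a b c d.
Proof.
  change (assi a' c' (b' ⊗ d') ∘ ((idm a' ⊠ brv b' c' d') ∘ ass a' b' (c' ⊗ d'))
      ∘ ((f ⊠ g) ⊠ (h ⊠ k)) =
    ((f ⊠ h) ⊠ (g ⊠ k)) ∘ (assi a c (b ⊗ d) ∘ ((idm a ⊠ brv b c d) ∘ ass a b (c ⊗ d)))).
  assert (E : (idm a' ⊠ brv b' c' d') ∘ (f ⊠ (g ⊠ (h ⊠ k))) =
      (f ⊠ (h ⊠ (g ⊠ k))) ∘ (idm a ⊠ brv b c d))
    by now rewrite <- !(thom_comp HC), brv_natural, comp_idl, comp_idr.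
  rewrite !comp_assoc, (ass_nat HC), <- (comp_assoc (idm a' ⊠ _)), E.
  now rewrite <- !comp_assoc, assi_nat.
Qed.

Lemma tens_ass (a b a' b' a'' b'' : C) :
  (ass a a' a'' ⊠ ass b b' b'')
    ∘ (swap_mid (a ⊗ a') (b ⊗ b') a'' b'' ∘ (swap_mid a b a' b' ⊠ idm (a'' ⊗ b''))) =
  swap_mid a b (a' ⊗ a'') (b' ⊗ b'')
    ∘ ((idm (a ⊗ b) ⊠ swap_mid a' b' a'' b'') ∘ ass (a ⊗ b) (a' ⊗ b') (a'' ⊗ b'')).
Proof.
  unfold swap_mid; strictify HC.
  now rewrite <- !(wh_comp HC), (brv_nat HC).
Qed.

Lemma tens_lun (a b : C) :
  (lun a ⊠ lun b) ∘ (swap_mid one one a b ∘ (luni one ⊠ idm (a ⊗ b))) = lun (a ⊗ b).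
Proof. unfold swap_mid; strictify HC; reflexivity. Qed.

Lemma tens_run (a b : C) :
  (run a ⊠ run b) ∘ (swap_mid a b one one ∘ (idm (a ⊗ b) ⊠ luni one)) = run (a ⊗ b).
Proof. unfold swap_mid; strictify HC; reflexivity. Qed.

Lemma tens_mon : is_mon_fun (tens_mf C).
Proof.
  split; cbn; intros.
  - apply (thom_id HC).
  - apply (thom_comp HC).
  - apply swap_mid_inverse.
  - apply inverse_sym, (lun_inv HC).
  - apply swap_mid_nat.
  - apply tens_ass.
  - apply tens_lun.
  - apply tens_run.
Qed.

(** The two sides braid the same pairs except that the right-hand side braids a past d
    and back; this is where transparency enters. *)
Lemma tens_br (a b c d : C) : br d a ∘ br a d = idm _ ->
  (br a c ⊠ br b d) ∘ swap_mid a b c d = swap_mid c d a b ∘ br (a ⊗ b) (c ⊗ d).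
Proof.
  intro E; unfold swap_mid; strictify HC.
  rewrite <- (comp_assoc (idm c ⊠ brv d a _)), <- (@wh_comp _ HC c).
  now rewrite (brv_sym HC _ E), (thom_id HC), comp_idl.
Qed.

Lemma ass_tens (a b c a' b' c' : C) :
  ass (a ⊗ a') (b ⊗ b') (c ⊗ c')
    ∘ ((swap_mid a b a' b' ⊠ idm (c ⊗ c')) ∘ swap_mid (a ⊗ b) c (a' ⊗ b') c') =
  ((idm (a ⊗ a') ⊠ swap_mid b c b' c') ∘ swap_mid a (b ⊗ c) a' (b' ⊗ c'))
    ∘ (ass a b c ⊠ ass a' b' c').
Proof.
  unfold swap_mid; strictify HC.
  now rewrite <- !(@wh_comp _ HC a), <- !comp_assoc, (brv_nat HC).
Qed.

Lemma ass_tens_one :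
  ass (@one C) one one ∘ ((luni one ⊠ idm one) ∘ luni one) = (idm one ⊠ luni one) ∘ luni one.
Proof. strictify HC; reflexivity. Qed.

Lemma lun_tens (a b : C) :
  lun (a ⊗ b) ∘ ((lun one ⊠ idm (a ⊗ b)) ∘ swap_mid one a one b) = lun a ⊠ lun b.
Proof. unfold swap_mid; strictify HC; reflexivity. Qed.

Lemma run_tens (a b : C) :
  run (a ⊗ b) ∘ ((idm (a ⊗ b) ⊠ lun one) ∘ swap_mid a one b one) = run a ⊠ run b.
Proof. unfold swap_mid; strictify HC; reflexivity. Qed.

(** The left-hand side braids b past c and back. *)
Lemma br_tens (a b c d : C) : br c b ∘ br b c = idm _ ->
  br (a ⊗ c) (b ⊗ d) ∘ swap_mid a b c d = swap_mid b a d c ∘ (br a b ⊠ br c d).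
Proof.
  intro E; unfold swap_mid; strictify HC.
  rewrite <- (@wh_comp _ HC a _ _ _ (brv c b _)), (brv_sym HC _ E), (thom_id HC).
  now rewrite comp_idr.
Qed.

Lemma br_one_tens : br (@one C) one ∘ luni one = luni one.
Proof. strictify HC; reflexivity. Qed.

End Tens.

(** * Braided monoidal functors *)

Lemma fhom_inverse {C D : BMData} (F : MonFun C D) (HF : is_mon_fun F) {x y : C}
    (f : Hom x y) (g : Hom y x) :
  is_inverse f g -> is_inverse (fhom F f) (fhom F g).
Proof.
  intros [a b]; split; rewrite <- (fhom_comp HF), ?a, ?b; apply (fhom_id HF).
Qed.

Lemma fhom_iso {C D : BMData} (F : MonFun C D) (HF : is_mon_fun F) {x y : C}
    (f : Hom x y) : is_iso f -> is_iso (fhom F f).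
Proof. intros [g h]; exists (fhom F g); now apply fhom_inverse. Qed.

(** Inverting the horizontal sides of a commutative square. *)
Lemma swap_inverse {C : Category} {x y z w : C} (P : Hom x y) (Q : Hom z w)
    (f : Hom y w) f' (g : Hom x z) g' :
  is_inverse f f' -> is_inverse g g' -> f ∘ P = Q ∘ g -> f' ∘ Q = P ∘ g'.
Proof.
  intros [a b] [c d] E; rewrite <- (comp_idr Q), <- d, <- (comp_assoc Q), <- E.
  now rewrite <- !comp_assoc, a, comp_idl.
Qed.

Section F2.
Context {C D : BMData} (HC : is_braided C) (HD : is_braided D).
Context (F : MonFun C D) (HF : is_br_fun F).

Let f3 (x y z : C) : Hom (F x ⊗ (F y ⊗ F z)) (F (x ⊗ (y ⊗ z))) :=
  f2 F x (y ⊗ z) ∘ (idm (F x) ⊠ f2 F y z).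

Let f22 (x y z w : C) : Hom ((F x ⊗ F y) ⊗ (F z ⊗ F w)) (F ((x ⊗ y) ⊗ (z ⊗ w))) :=
  f2 F (x ⊗ y) (z ⊗ w) ∘ (f2 F x y ⊠ f2 F z w).

Let f4 (x y z w : C) : Hom (F x ⊗ (F y ⊗ (F z ⊗ F w))) (F (x ⊗ (y ⊗ (z ⊗ w)))) :=
  f2 F x (y ⊗ (z ⊗ w)) ∘ (idm (F x) ⊠ f3 y z w).

Let f3_ass (x y z : C) :
  fhom F (ass x y z) ∘ (f2 F (x ⊗ y) z ∘ (f2 F x y ⊠ idm (F z))) =
  f3 x y z ∘ ass (F x) (F y) (F z).
Proof. unfold f3; rewrite comp_assoc; apply (f2_ass HF). Qed.

Let f3_nat (x z z' : C) (k : Hom z z') :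
  fhom F (idm x ⊠ k) ∘ f2 F x z = f2 F x z' ∘ (idm (F x) ⊠ fhom F k).
Proof. now rewrite <- (f2_nat HF), (fhom_id HF). Qed.

Let f4_ass (x y z w : C) :
  fhom F (ass x y (z ⊗ w)) ∘ f22 x y z w = f4 x y z w ∘ ass (F x) (F y) (F z ⊗ F w).
Proof.
  unfold f22, f4; rewrite (thom_split1 HD (f2 F x y)).
  rewrite <- (comp_assoc (f2 F (x ⊗ y) _)), <- comp_assoc, f3_ass, !comp_assoc.
  rewrite <- (thom_id HD), (ass_nat HD), <- !comp_assoc; f_equal.
  unfold f3; now rewrite comp_assoc, <- (wh_comp HD).
Qed.

Let f3_br (x y z : C) : fhom F (brv x y z) ∘ f3 x y z = f3 y x z ∘ brv (F x) (F y) (F z).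
Proof.
  unfold brv; rewrite !(fhom_comp HF), !comp_assoc.
  rewrite (swap_inverse (fhom_inverse HF (ass_inv HC x y z)) (ass_inv HD _ _ _) (f3_ass x y z)).
  rewrite <- !comp_assoc, <- f3_ass, !comp_assoc; f_equal.
  rewrite <- (comp_assoc (fhom F (_ ⊠ _))), <- (f2_nat HF), (fhom_id HF), !comp_assoc.
  f_equal; rewrite <- !comp_assoc; f_equal.
  now rewrite <- !(wh_comp_r HD), (f2_br HF).
Qed.

(** The structure morphism of a braided functor is itself monoidal.  Both sides are
    rewritten through the four-fold structure morphism [f4] on right-nested products, on
    which F(ass) and F(br) act as ass and br. *)
Lemma f2_swap (x y z w : C) :
  fhom F (swap_mid x y z w) ∘ (f2 F (x ⊗ y) (z ⊗ w) ∘ (f2 F x y ⊠ f2 F z w)) =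
  (f2 F (x ⊗ z) (y ⊗ w) ∘ (f2 F x z ⊠ f2 F y w)) ∘ swap_mid (F x) (F y) (F z) (F w).
Proof.
  change (fhom F (assi x z (y ⊗ w) ∘ ((idm x ⊠ brv y z w) ∘ ass x y (z ⊗ w))) ∘ f22 x y z w =
    f22 x z y w ∘ (assi (F x) (F z) (F y ⊗ F w) ∘ ((idm (F x) ⊠ brv (F y) (F z) (F w))
      ∘ ass (F x) (F y) (F z ⊗ F w)))).
  rewrite !(fhom_comp HF), !comp_assoc, f4_ass.
  rewrite <- (comp_assoc (f22 x z y w)).
  rewrite <- (swap_inverse (fhom_inverse HF (ass_inv HC _ _ _)) (ass_inv HD _ _ _)
    (f4_ass x z y w)).
  rewrite !comp_assoc; f_equal; rewrite <- !comp_assoc; f_equal; unfold f4.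
  rewrite <- comp_assoc, f3_nat, !comp_assoc, <- !(wh_comp HD); do 2 f_equal.
  apply f3_br.
Qed.

End F2.

Lemma id_mf_law (C : BMData) : is_braided C -> is_br_fun (id_mf C).
Proof.
  intro HC; split; [split |]; cbn; intros;
    rewrite ?(thom_id HC), ?comp_idl, ?comp_idr; try reflexivity; apply inverse_id.
Qed.

Lemma bang_mf_law (C : BMData) : is_br_fun (bang_mf C).
Proof. split; [split |]; cbn; intros; reflexivity || (split; reflexivity). Qed.

Lemma one_mf_law (C : BMData) : is_braided C -> is_br_fun (one_mf C).
Proof.
  intro HC; split; [split |]; cbn; intros; rewrite ?comp_idl; try reflexivity.
  - apply (lun_inv HC).
  - apply inverse_id.
  - now rewrite (thom_id HC), comp_idr.
  - f_equal; strictify HC; reflexivity.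
  - now rewrite (thom_id HC), comp_idr.
  - rewrite (thom_id HC), comp_idr; apply (lun_one HC).
  - now rewrite (br_one_r HC), <- comp_assoc, (proj2 (lun_inv HC one)), comp_idl, (lun_one HC).
Qed.

Lemma comp_mf_mon {C D E : BMData} (HE : is_braided E)
    (G : MonFun D E) (F : MonFun C D) :
  is_mon_fun G -> is_mon_fun F -> is_mon_fun (comp_mf G F).
Proof.
  intros HG HF; split; cbn; intros.
  - now rewrite (fhom_id HF), (fhom_id HG).
  - now rewrite (fhom_comp HF), (fhom_comp HG).
  - apply inverse_comp; [apply (fhom_inverse HG), (f2_inv HF) | apply (f2_inv HG)].
  - apply inverse_comp; [apply (fhom_inverse HG), (f0_inv HF) | apply (f0_inv HG)].
  - rewrite !comp_assoc, (f2_nat HG), <- !comp_assoc, <- !(fhom_comp HG).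
    now rewrite (f2_nat HF).
  - transitivity (fhom G (fhom F (ass x y z) ∘ (f2 F (x ⊗ y) z ∘ (f2 F x y ⊠ idm (F z))))
        ∘ (f2 G (F x ⊗ F y) (F z) ∘ (f2 G (F x) (F y) ⊠ idm (G (F z))))).
    + rewrite !(fhom_comp HG), (wh_comp_r HE), !comp_assoc; do 2 f_equal.
      now rewrite <- !comp_assoc, <- (f2_nat HG), (fhom_id HG).
    + rewrite (f2_ass HF), !(fhom_comp HG), (wh_comp HE), !comp_assoc, (f2_ass HG).
      f_equal; rewrite <- !comp_assoc; do 2 f_equal.
      now rewrite <- (f2_nat HG), (fhom_id HG).
  - transitivity (fhom G (fhom F (lun x) ∘ (f2 F one x ∘ (f0 F ⊠ idm (F x)))) ∘ (f2 G one (F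
      x) ∘ (f0 G ⊠ idm (G (F x))))).
    + rewrite !(fhom_comp HG), (wh_comp_r HE), !comp_assoc; do 2 f_equal.
      now rewrite <- !comp_assoc, <- (f2_nat HG), (fhom_id HG).
    + rewrite (f2_lun HF); apply (f2_lun HG).
  - transitivity (fhom G (fhom F (run x) ∘ (f2 F x one ∘ (idm (F x) ⊠ f0 F))) ∘ (f2 G (F x)
      one ∘ (idm (G (F x)) ⊠ f0 G))).
    + rewrite !(fhom_comp HG), (wh_comp HE), !comp_assoc; do 2 f_equal.
      now rewrite <- !comp_assoc, <- (f2_nat HG), (fhom_id HG).
    + rewrite (f2_run HF); apply (f2_run HG).
Qed.

Lemma comp_mf_law {C D E : BMData} (HE : is_braided E)
    (G : MonFun D E) (F : MonFun C D) :
  is_br_fun G -> is_br_fun F -> is_br_fun (comp_mf G F).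
Proof.
  intros HG HF; split; [exact (comp_mf_mon HE HG HF) |]; cbn; intros.
  rewrite <- comp_assoc, <- (fhom_comp HG), (f2_br HF), (fhom_comp HG), !comp_assoc.
  now rewrite (f2_br HG).
Qed.

Lemma pair_mf_mon {C D E : BMData} (F : MonFun C D) (G : MonFun C E) :
  is_mon_fun F -> is_mon_fun G -> is_mon_fun (pair_mf F G).
Proof.
  intros HF HG; split; cbn; intros; try (apply prod_is_inverse); cbn;
    try (apply HF); try (apply HG); f_equal; try (apply HF); try (apply HG).
Qed.

Lemma pair_mf_law {C D E : BMData} (F : MonFun C D) (G : MonFun C E) :
  is_br_fun F -> is_br_fun G -> is_br_fun (pair_mf F G).
Proof.
  intros HF HG; split; [exact (pair_mf_mon HF HG) |]; cbn; intros; f_equal; apply f2_br;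
    assumption.
Qed.

Lemma sym_tens_law (A : SymCat) : is_br_fun (tens_mf A).
Proof.
  split; [apply tens_mon, bc_law |]; cbn; intros x y.
  apply (tens_br (bc_law A)), sc_sym.
Qed.

Section MonoidalUnits.
Context {C D : BMData} (HC : is_braided C) (HD : is_braided D).
Context (F : MonFun C D) (HF : is_mon_fun F).

Lemma fhom_luni (c : C) :
  fhom F (luni c) = f2 F one c ∘ ((f0 F ⊠ idm _) ∘ luni (F c)).
Proof.
  apply (mono_of_iso (inv_iso (fhom_inverse HF (lun_inv HC c)))).
  rewrite <- (fhom_comp HF), (proj2 (lun_inv HC c)), (fhom_id HF), <- !comp_assoc.
  rewrite (comp_assoc _ _ (f0 _ ⊠ _)), (f2_lun HF); symmetry; apply (lun_inv HD).
Qed.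

Lemma fhom_runi (c : C) :
  fhom F (runi c) = f2 F c one ∘ ((idm _ ⊠ f0 F) ∘ runi (F c)).
Proof.
  apply (mono_of_iso (inv_iso (fhom_inverse HF (run_inv HC c)))).
  rewrite <- (fhom_comp HF), (proj2 (run_inv HC c)), (fhom_id HF), <- !comp_assoc.
  rewrite (comp_assoc _ _ (_ ⊠ f0 _)), (f2_run HF); symmetry; apply (run_inv HD).
Qed.

Lemma f0_lun : fhom F (lun one) ∘ (f2 F one one ∘ (f0 F ⊠ f0 F)) = f0 F ∘ lun one.
Proof.
  rewrite (thom_split1 HD), <- (comp_assoc (f2 F one one)), <- comp_assoc, (f2_lun HF).
  apply (lun_nat HD).
Qed.

Lemma f0_mon_nat : @is_mon_nat _ _ (one_mf D) (comp_mf F (one_mf C)) (fun _ => f0 F).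
Proof.
  split; cbn; intros.
  - now rewrite (fhom_id HF), comp_idl, comp_idr.
  - symmetry; rewrite comp_assoc; apply f0_lun.
  - now rewrite (fhom_id HF), comp_idl, comp_idr.
Qed.

End MonoidalUnits.

Lemma f2_mon_nat {C D : BMData} (HC : is_braided C) (HD : is_braided D)
    (F : MonFun C D) (HF : is_br_fun F) :
  @is_mon_nat _ _
    (comp_mf (tens_mf D) (pair_mf (comp_mf F (fst_mf C C)) (comp_mf F (snd_mf C C))))
    (comp_mf F (tens_mf C)) (fun a => f2 F (fst a) (snd a)).
Proof.
  split; cbn; intros.
  - apply (f2_nat HF).
  - rewrite !(fhom_id HF), !comp_idl, <- comp_assoc; symmetry.
    rewrite comp_assoc, (f2_swap HC HD HF); reflexivity.
  - rewrite !(fhom_id HF), !comp_idl, (fhom_luni HC HD HF), (thom_split1 HD), !comp_assoc.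
    now rewrite <- (luni_nat HD).
Qed.

Lemma unit_mon_nat {C : BMData} (HC : is_braided C) (F : MonFun unit_bm C)
    (HF : is_mon_fun F) :
  @is_mon_nat _ _ (one_mf C) F (fun x : unit =>
    match x return Hom one (F x) with tt => f0 F end).
Proof.
  assert (E : fhom F (x := tt) (y := tt) tt = idm _) by exact (fhom_id HF tt).
  split; cbn.
  - intros [] [] []; now rewrite E, comp_idl, comp_idr.
  - intros [] []; pose proof (f0_lun HC HF) as E'; cbn in E'.
    rewrite E, comp_idl in E'; now symmetry.
  - apply comp_idr.
Qed.

(** * Unital actions of braided categories *)

Lemma iso_double_braiding {C : BMData} (HC : is_braided C) (x y z : C) (f : Hom y z) :
  is_iso f -> br y x ∘ br x y = idm (x ⊗ y) -> br z x ∘ br x z = idm (x ⊗ z).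
Proof.
  intros If E; apply (epi_of_iso (thom_iso HC (id_iso x) If)).
  now rewrite comp_assoc, (br_nat HC), <- comp_assoc, (br_nat HC), comp_assoc, E,
    comp_idl, comp_idr.
Qed.

(** The functor G(-, 1); its structure morphism absorbs 1 ⊗ 1 into 1. *)
Definition act_one {D C : BMData} (G : MonFun (prod_bm D C) C) : MonFun D C :=
  {| fob := fun d => G (d, one);
     fhom := fun d d' f => @fhom _ _ G (d, one) (d', one) (f, idm one);
     f2 := fun d d' => @fhom _ _ G (d ⊗ d', one ⊗ one) (d ⊗ d', one) (idm _, lun one)
       ∘ f2 G (d, one) (d', one);
     f2i := fun d d' => f2i G (d, one) (d', one)
       ∘ @fhom _ _ G (d ⊗ d', one) (d ⊗ d', one ⊗ one) (idm _, luni one);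
     f0 := f0 G; f0i := f0i G |}.

(** Replaces the action on morphisms by one that is only propositionally equal, as for
    composites of underlying functors. *)
Definition rehom {C D : BMData} (F : MonFun C D)
    (h : forall x y : C, Hom x y -> Hom (F x) (F y)) : MonFun C D :=
  {| fob := F; fhom := h; f2 := f2 F; f2i := f2i F; f0 := f0 F; f0i := f0i F |}.

Lemma rehom_law {C D : BMData} (F : MonFun C D)
    (h : forall x y : C, Hom x y -> Hom (F x) (F y)) :
  (forall x y (f : Hom x y), h x y f = fhom F f) -> is_br_fun F -> is_br_fun (rehom h).
Proof.
  intros E HF; split; [split |]; cbn; intros; rewrite ?E; try apply HF.
Qed.

Section Action.
Context {D C : BMData} (HD : is_braided D) (HC : is_braided C).
Context (G : MonFun (prod_bm D C) C) (HG : is_br_fun G).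

Definition star {d d' : D} {x x' : C} (f : Hom d d') (h : Hom x x') :
    Hom (G (d, x)) (G (d', x')) :=
  @fhom _ _ G (d, x) (d', x') (f, h).

Definition star2 (d : D) (x : C) (d' : D) (x' : C) :
    Hom (G (d, x) ⊗ G (d', x')) (G (d ⊗ d', x ⊗ x')) :=
  f2 G (d, x) (d', x').

Definition star0 : Hom one (G (one, one)) := f0 G.

Infix "⋆" := star (at level 38).

Lemma star_comp (d d' d'' : D) (x x' x'' : C) (f' : Hom d' d'') (f : Hom d d')
    (h' : Hom x' x'') (h : Hom x x') : (f' ⋆ h') ∘ (f ⋆ h) = (f' ∘ f) ⋆ (h' ∘ h).
Proof. symmetry; exact (@fhom_comp _ _ _ HG (d, x) (d', x') (d'', x'') (f', h') (f, h)). Qed.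

Lemma star_id (d : D) (x : C) : idm d ⋆ idm x = idm (G (d, x)).
Proof. exact (fhom_id HG (d, x)). Qed.

Lemma star_f2 (d d' e e' : D) (x x' y y' : C) (f : Hom d d') (f' : Hom e e')
    (h : Hom x x') (h' : Hom y y') :
  star2 d' x' e' y' ∘ ((f ⋆ h) ⊠ (f' ⋆ h')) = ((f ⊠ f') ⋆ (h ⊠ h')) ∘ star2 d x e y.
Proof. exact (@f2_nat _ _ _ HG (d, x) (d', x') (e, y) (e', y') (f, h) (f', h')). Qed.

Lemma star_inverse (d d' : D) (x x' : C) (f : Hom d d') f' (h : Hom x x') h' :
  is_inverse f f' -> is_inverse h h' -> is_inverse (f ⋆ h) (f' ⋆ h').
Proof.
  intros [a b] [a' b']; split; rewrite star_comp, ?a, ?a', ?b, ?b'; apply star_id.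
Qed.

(** G(-, 1) is the composite of G with the pairing of the identity and the constant
    functor 1, up to identities. *)
Lemma act_one_law : is_br_fun (act_one G).
Proof.
  pose (c := comp_mf G (pair_mf (id_mf D) (comp_mf (one_mf C) (bang_mf D)))).
  assert (Hc : is_br_fun c).
  { apply (comp_mf_law HC HG), pair_mf_law; [apply (id_mf_law HD) |].
    apply (comp_mf_law HC); [apply (one_mf_law HC) | apply bang_mf_law]. }
  assert (E2 : forall d d', f2 c d d' = f2 (act_one G) d d')
    by (intros; cbn; now rewrite comp_idl).
  assert (E0 : f0 c = f0 (act_one G)).
  { transitivity ((idm one ⋆ idm one) ∘ f0 G); [cbn; now rewrite comp_idl |].
    rewrite star_id; apply comp_idl. }
  split; [split |].
  - exact (fhom_id Hc).
  - exact (fun x y z => @fhom_comp _ _ _ Hc x y z).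
  - intros d d'; apply inverse_comp; [| apply (f2_inv HG)].
    apply (fhom_inverse HG), prod_is_inverse; [apply inverse_id | apply (lun_inv HC)].
  - apply (f0_inv HG).
  - intros; rewrite <- !E2; apply (f2_nat Hc).
  - intros; rewrite <- !E2; apply (f2_ass Hc).
  - intros; rewrite <- !E2, <- E0; apply (f2_lun Hc).
  - intros; rewrite <- !E2, <- E0; apply (f2_run Hc).
  - intros; rewrite <- !E2; apply (f2_br Hc).
Qed.

Context (u : D) (u0 : Hom one u) (u0i : Hom u one) (u2 : Hom (u ⊗ u) u).
Context (al : forall x : C, Hom (G (u, x)) x) (ali : forall x : C, Hom x (G (u, x))).

(** The data of an action (D, u) on C with alpha = al, where [u0] and [u2] are
    the components of the monoidal functor picking u. *)
Record is_unital_action : Prop := {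
  un_u0 : is_inverse u0 u0i;
  un_u2 : u2 ∘ (idm u ⊠ u0) = run u;
  un_inv : forall x, is_inverse (al x) (ali x);
  un_nat : forall (x y : C) (h : Hom x y), al y ∘ (idm u ⋆ h) = h ∘ al x;
  un_2 : forall x y : C,
    al (x ⊗ y) ∘ ((u2 ⋆ idm (x ⊗ y)) ∘ star2 u x u y) = al x ⊠ al y;
  un_0 : al one ∘ ((u0 ⋆ idm one) ∘ star0) = idm one }.

Context (Hu : is_unital_action).
Let Hu0 : is_inverse u0 u0i := un_u0 Hu.
Let Hu2 : u2 ∘ (idm u ⊠ u0) = run u := un_u2 Hu.
Let Hal : forall x, is_inverse (al x) (ali x) := un_inv Hu.
Let al_nat : forall (x y : C) (h : Hom x y), al y ∘ (idm u ⋆ h) = h ∘ al x := un_nat Hu.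
Let al_2 : forall x y : C,
  al (x ⊗ y) ∘ ((u2 ⋆ idm (x ⊗ y)) ∘ star2 u x u y) = al x ⊠ al y := un_2 Hu.
Let al_0 : al one ∘ ((u0 ⋆ idm one) ∘ star0) = idm one := un_0 Hu.

(** y ≅ G(u, y) and u ≅ 1, so that the double braiding of G(d, 1) with y is the
    image of a trivial one. *)
Lemma action_transparent (d : D) : transparent (G (d, one)).
Proof.
  intro y.
  apply (iso_double_braiding HC (inv_iso (Hal y))).
  apply (br_fun_transparent HC HG (x := (d, one)) (y := (u, y))); cbn; f_equal.
  - apply (iso_double_braiding HD (inv_iso Hu0)).
    apply (epi_of_iso (inv_iso' (br_inv HD d one))).
    pose proof (transparent_one HD d) as E.
    apply (mono_of_iso (inv_iso (br_inv HD d one))).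
    rewrite comp_idl, (proj2 (br_inv HD d one)), comp_assoc, (proj2 (br_inv HD d one)).
    now rewrite comp_idr, E.
  - apply (transparent_one HC).
Qed.

Lemma ali_2 (x y : C) : (u2 ⋆ idm (x ⊗ y)) ∘ (star2 u x u y ∘ (ali x ⊠ ali y)) = ali (x ⊗ y).
Proof.
  apply (mono_of_iso (inv_iso (Hal (x ⊗ y)))).
  rewrite (proj2 (Hal (x ⊗ y))), <- (comp_assoc (_ ⋆ _)), <- comp_assoc, al_2.
  apply (inverse_thom HC (Hal x) (Hal y)).
Qed.

Lemma ali_0 : (u0 ⋆ idm one) ∘ star0 = ali one.
Proof.
  apply (mono_of_iso (inv_iso (Hal one))); rewrite al_0; symmetry; apply (Hal one).
Qed.

Lemma ali_nat (x y : C) (h : Hom x y) : (idm u ⋆ h) ∘ ali x = ali y ∘ h.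
Proof.
  apply (mono_of_iso (inv_iso (Hal y))).
  rewrite <- !comp_assoc, al_nat, (proj2 (Hal y)), comp_idl, comp_assoc, (proj2 (Hal x)).
  apply comp_idr.
Qed.

Definition runu (d : D) : Hom (d ⊗ u) d := run d ∘ (idm d ⊠ u0i).

Lemma runu_nat (d d' : D) (f : Hom d d') : runu d' ∘ (f ⊠ idm u) = f ∘ runu d.
Proof.
  unfold runu; rewrite comp_assoc, <- (thom_split2 HD), (thom_split1 HD), <- !comp_assoc.
  now rewrite (run_nat HD).
Qed.

(** The isomorphism u ≅ 1 is one of monoids. *)
Lemma u0i_2 : u0i ∘ u2 = lun one ∘ (u0i ⊠ u0i).
Proof.
  apply (epi_of_iso (inv_iso (inverse_thom HD Hu0 Hu0))).
  rewrite !comp_assoc, <- (thom_comp HD), (proj1 Hu0), (thom_id HD), comp_idr.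
  rewrite (thom_split2 HD), <- (comp_assoc u2), Hu2, (run_nat HD), <- comp_assoc.
  now rewrite (proj1 Hu0), comp_idl, (lun_one HD).
Qed.

Lemma runu_2 (d d' : D) :
  runu (d ⊗ d') ∘ ((idm (d ⊗ d') ⊠ u2) ∘ swap_mid d u d' u) = runu d ⊠ runu d'.
Proof.
  unfold runu; rewrite (thom_comp HD), <- (run_tens HD), !comp_assoc, <- (comp_assoc (_ ⊠ u0i)).
  rewrite <- (wh_comp HD), u0i_2, (wh_comp HD), !comp_assoc, (swap_mid_nat HD).
  now rewrite (thom_id HD).
Qed.

Lemma runu_u : runu u = u2.
Proof.
  unfold runu; rewrite <- Hu2, comp_assoc, <- (wh_comp HD), (proj2 Hu0), (thom_id HD).
  apply comp_idr.
Qed.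

Definition rho (d : D) (x : C) : Hom (G (d, one) ⊗ x) (G (d, x)) :=
  (runu d ⋆ lun x) ∘ (star2 d one u x ∘ (idm (G (d, one)) ⊠ ali x)).

Lemma rho_iso (d : D) (x : C) : is_iso (rho d x).
Proof.
  apply comp_iso; [| apply comp_iso].
  - refine (inv_iso (star_inverse _ (lun_inv HC x))).
    unfold runu; apply inverse_comp; [apply (run_inv HD) |].
    apply (inverse_thom HD); [apply inverse_id | apply inverse_sym, Hu0].
  - exact (inv_iso (f2_inv HG (d, one) (u, x))).
  - apply (thom_iso HC); [apply id_iso | apply (inv_iso' (Hal x))].
Qed.

Lemma rho_nat (d d' : D) (x x' : C) (f : Hom d d') (h : Hom x x') :
  rho d' x' ∘ ((f ⋆ idm one) ⊠ h) = (f ⋆ h) ∘ rho d x.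
Proof.
  assert (E : (idm _ ⊠ ali x') ∘ ((f ⋆ idm one) ⊠ h) =
      ((f ⋆ idm one) ⊠ (idm u ⋆ h)) ∘ (idm _ ⊠ ali x))
    by now rewrite <- !(thom_comp HC), comp_idl, comp_idr, ali_nat.
  unfold rho; rewrite !comp_assoc, E, <- (comp_assoc (star2 _ _ _ _)), star_f2.
  rewrite <- !comp_assoc, !star_comp; do 3 f_equal; [apply runu_nat | apply (lun_nat HC)].
Qed.

(** All the factors of rho are monoidal: alpha, the structure morphism of G by
    [f2_swap], and the unit isomorphisms that G is applied to. *)
Lemma rho_2 (d d' : D) (x x' : C) :
  rho (d ⊗ d') (x ⊗ x') ∘ ((f2 (act_one G) d d' ⊠ idm (x ⊗ x'))
     ∘ swap_mid (G (d, one)) x (G (d', one)) x') =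
  star2 d x d' x' ∘ (rho d x ⊠ rho d' x').
Proof.
  change (f2 (act_one G) d d') with ((idm (d ⊗ d') ⋆ lun one) ∘ star2 d one d' one).
  set (t := (idm (G (d, one)) ⊠ ali x) ⊠ (idm (G (d', one)) ⊠ ali x')).
  (* monoidality of alpha moves its inverse before the interchange *)
  transitivity ((runu (d ⊗ d') ⋆ lun (x ⊗ x'))
    ∘ (star2 (d ⊗ d') one u (x ⊗ x')
       ∘ ((((idm (d ⊗ d') ⋆ lun one) ∘ star2 d one d' one)
            ⊠ ((u2 ⋆ idm (x ⊗ x')) ∘ star2 u x u x'))
          ∘ (swap_mid (G (d, one)) (G (u, x)) (G (d', one)) (G (u, x')) ∘ t)))).
  { unfold rho, t; rewrite (swap_mid_nat HC), (thom_id HC), !comp_assoc; do 2 f_equal.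
    rewrite <- !comp_assoc; f_equal; rewrite <- !(thom_comp HC), !comp_idl, !comp_idr.
    now rewrite !comp_assoc, ali_2. }
  rewrite (thom_comp HC), !comp_assoc, <- (comp_assoc (star2 (d ⊗ d') _ _ _)), star_f2.
  (* monoidality of the structure morphism of G *)
  assert (E : star2 (d ⊗ d') (one ⊗ one) (u ⊗ u) (x ⊗ x') ∘ ((star2 d one d' one ⊠ star2 u x u x')
      ∘ swap_mid (G (d, one)) (G (u, x)) (G (d', one)) (G (u, x'))) =
    (swap_mid d u d' u ⋆ swap_mid one x one x')
      ∘ (star2 (d ⊗ u) (one ⊗ x) (d' ⊗ u) (one ⊗ x') ∘ (star2 d one u x ⊠ star2 d' one u x'))).
  { rewrite <- comp_assoc; symmetry.
    exact (f2_swap (prod_is_braided HD HC) HC HG (d, one) (u, x) (d', one) (u, x')). }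
  rewrite <- !comp_assoc, (comp_assoc _ (star2 _ _ _ _)), (comp_assoc _ _ (swap_mid _ _ _ _)).
  rewrite (comp_assoc (star2 _ _ _ _)), E, <- !comp_assoc, !star_comp.
  rewrite !comp_assoc, runu_2, (lun_tens HC), <- (comp_assoc (star2 (d ⊗ u) _ _ _)).
  unfold rho; rewrite !(thom_comp HC); fold t.
  now rewrite <- !comp_assoc, star_f2.
Qed.

Lemma rho_0 : rho one one ∘ ((star0 ⊠ idm one) ∘ luni one) = star0.
Proof.
  unfold rho; rewrite !comp_assoc, <- (comp_assoc (idm _ ⊠ ali one)), <- (thom_split2 HC).
  rewrite <- ali_0.
  assert (E : star0 ⊠ ((u0 ⋆ idm one) ∘ star0) =
    ((idm one ⋆ idm one) ⊠ (u0 ⋆ idm one)) ∘ ((star0 ⊠ idm _) ∘ (idm one ⊠ star0))).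
  { now rewrite star_id, <- (thom_split1 HC), <- (thom_comp HC), comp_idl. }
  rewrite E, !comp_assoc, <- (comp_assoc (star2 _ _ _ _)), star_f2, <- !comp_assoc, star_comp.
  assert (E1 : runu one ∘ (idm one ⊠ u0) = lun one).
  { unfold runu; rewrite comp_assoc, <- (wh_comp HD), (proj1 Hu0), (thom_id HD), comp_idr.
    symmetry; apply (lun_one HD). }
  rewrite E1, (thom_id HC), comp_idr.
  assert (E2 : (lun one ⋆ lun one) ∘ (star2 one one one one ∘ (star0 ⊠ idm (G (one, one)))) =
    lun (G (one, one))) by exact (f2_lun HG one).
  rewrite <- (comp_assoc _ (star2 _ _ _ _)) in E2; rewrite E2.
  now rewrite (lun_nat HC), comp_assoc, (proj2 (lun_inv HC one)), comp_idr.
Qed.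

(** The unit isomorphism d ⊗ u ≅ d at d = u is the multiplication of u, and
    alpha is monoidal. *)
Lemma rho_coherent (x : C) :
  al x ∘ (rho u x ∘ (((u0 ⋆ idm one) ∘ star0) ⊠ idm x)) = lun x.
Proof.
  rewrite ali_0; unfold rho; rewrite runu_u, !comp_assoc, <- (thom_split2 HC).
  rewrite <- (comp_idl u2), <- (comp_idr (lun x)), <- star_comp, !comp_assoc, ali_2.
  rewrite <- comp_assoc, al_nat, comp_assoc, (proj2 (Hal (one ⊗ x))).
  now rewrite !comp_idr.
Qed.

(** What a morphism from the action G into the action of C on itself amounts to: a
    functor p, with r comparing the actions and s comparing the units. *)
Record is_action_map (p : MonFun D C) (r : forall (d : D) (x : C), Hom (p d ⊗ x) (G (d, x)))
    (s : Hom one (p u)) : Prop := {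
  am_iso : forall d x, is_iso (r d x);
  am_unit_iso : is_iso s;
  am_nat : forall (d d' : D) (x x' : C) (f : Hom d d') (h : Hom x x'),
    r d' x' ∘ (fhom p f ⊠ h) = (f ⋆ h) ∘ r d x;
  am_2 : forall (d d' : D) (x x' : C),
    r (d ⊗ d') (x ⊗ x') ∘ ((f2 p d d' ⊠ idm (x ⊗ x')) ∘ swap_mid (p d) x (p d') x') =
    star2 d x d' x' ∘ (r d x ⊠ r d' x');
  am_0 : r one one ∘ ((f0 p ⊠ idm one) ∘ luni one) = star0;
  am_coherent : forall x : C, al x ∘ (r u x ∘ (s ⊠ idm x)) = lun x }.

Section Comparison.
Context (p q : MonFun D C) (Hp : is_mon_fun p) (Hq : is_mon_fun q).
Context (r : forall (d : D) (x : C), Hom (p d ⊗ x) (G (d, x))) (s : Hom one (p u)).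
Context (r' : forall (d : D) (x : C), Hom (q d ⊗ x) (G (d, x))) (s' : Hom one (q u)).
Context (Hr : is_action_map r s) (Hr' : is_action_map r' s').
Context (ri' : forall (d : D) (x : C), Hom (G (d, x)) (q d ⊗ x)).
Context (Hri' : forall (d : D) (x : C), is_inverse (r' d x) (ri' d x)).

(** Forced by compatibility with r and r' at the unit object. *)
Definition xi (d : D) : Hom (p d) (q d) :=
  run (q d) ∘ (ri' d one ∘ (r d one ∘ runi (p d))).

Lemma xi_one (d : D) : r' d one ∘ (xi d ⊠ idm one) = r d one.
Proof.
  assert (E : xi d ⊠ idm one = ri' d one ∘ r d one).
  { apply (mono_of_iso (inv_iso (run_inv HC (q d)))).
    rewrite (run_nat HC); unfold xi; rewrite !comp_assoc, (proj1 (run_inv HC (p d))).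
    now rewrite comp_idr. }
  now rewrite E, <- comp_assoc, (proj2 (Hri' d one)), comp_idl.
Qed.

(** Both sides are determined by alpha. *)
Lemma action_map_unit (x : C) : r' u x ∘ (s' ⊠ idm x) = r u x ∘ (s ⊠ idm x).
Proof.
  apply (mono_of_iso (inv_iso (Hal x))); now rewrite (am_coherent Hr), (am_coherent Hr').
Qed.

Lemma xi_of_tens_one (d : D) (x : C) (f g : Hom x (q d)) :
  r' d one ∘ (f ⊠ idm one) = r' d one ∘ (g ⊠ idm one) -> f = g.
Proof.
  intro E; apply (tens_one_faithful HC), (mono_of_iso (am_iso Hr' d one)), E.
Qed.

Lemma xi_unit : xi u ∘ s = s'.
Proof.
  apply xi_of_tens_one.
  now rewrite (wh_comp_r HC), <- comp_assoc, xi_one, action_map_unit.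
Qed.

Lemma xi_at_unit (x : C) : r' u x ∘ (xi u ⊠ idm x) = r u x.
Proof.
  apply (epi_of_iso (thom_iso HC (am_unit_iso Hr) (id_iso x))).
  now rewrite comp_assoc, <- (wh_comp_r HC), xi_unit, action_map_unit.
Qed.

Lemma xi_nat (d d' : D) (f : Hom d d') : xi d' ∘ fhom p f = fhom q f ∘ xi d.
Proof.
  apply xi_of_tens_one.
  rewrite !(wh_comp_r HC), <- !comp_assoc, xi_one, (am_nat Hr), (am_nat Hr').
  now rewrite comp_assoc, xi_one.
Qed.

(** Monoidality of r and r' propagates compatibility with them from two pairs to their
    tensor product.  It is used at (d, 1), (d', 1) for monoidality of xi, and at
    (d, 1), (u, x) for compatibility at all x. *)
Lemma xi_2_aux (d d' : D) (x x' : C) :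
  r' d x ∘ (xi d ⊠ idm x) = r d x -> r' d' x' ∘ (xi d' ⊠ idm x') = r d' x' ->
  r' (d ⊗ d') (x ⊗ x') ∘ ((f2 q d d' ∘ (xi d ⊠ xi d')) ⊠ idm (x ⊗ x')) =
  r (d ⊗ d') (x ⊗ x') ∘ (f2 p d d' ⊠ idm (x ⊗ x')).
Proof.
  intros E E'.
  apply (epi_of_iso (inv_iso (swap_mid_inverse HC (p d) x (p d') x'))).
  rewrite (comp_assoc (r _ _)), (am_2 Hr), <- E, <- E', (thom_comp HC), <- comp_assoc.
  rewrite <- (am_2 Hr'), (wh_comp_r HC), !comp_assoc; do 2 f_equal.
  now rewrite (swap_mid_nat HC), (thom_id HC).
Qed.

Lemma xi_2 (d d' : D) : xi (d ⊗ d') ∘ f2 p d d' = f2 q d d' ∘ (xi d ⊠ xi d').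
Proof.
  apply xi_of_tens_one.
  apply (epi_of_iso (thom_iso HC (id_iso _) (inv_iso (lun_inv HC one)))).
  (* naturality of r and r' along 1 ⊗ 1 ≅ 1 brings the tensor product back to the unit *)
  pose proof (xi_2_aux (xi_one d) (xi_one d')) as E.
  apply (f_equal (fun k => (idm (d ⊗ d') ⋆ lun one) ∘ k)) in E.
  rewrite <- !comp_assoc, <- (am_nat Hr'), <- (am_nat Hr), (fhom_id Hp), (fhom_id Hq) in E.
  rewrite (wh_comp_r HC _ (xi _)), <- (comp_assoc _ (xi _ ⊠ _)), xi_one.
  rewrite !comp_assoc, <- !(thom_comp HC), ?comp_idl, ?comp_idr in E.
  rewrite !comp_assoc, <- !(thom_comp HC), !comp_idl, !comp_idr.
  now symmetry.
Qed.

Lemma xi_0 : xi one ∘ f0 p = f0 q.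
Proof.
  apply xi_of_tens_one.
  apply (epi_of_iso (inv_iso' (lun_inv HC one))).
  rewrite (wh_comp_r HC), <- (comp_assoc _ (xi _ ⊠ _)), xi_one, !comp_assoc.
  now rewrite (am_0 Hr), (am_0 Hr').
Qed.

(** Every (d, x) is isomorphic to (d, 1) ⊗ (u, x), where compatibility is known. *)
Lemma xi_all (d : D) (x : C) : r' d x ∘ (xi d ⊠ idm x) = r d x.
Proof.
  assert (I : is_iso (f2 p d u)) by apply (inv_iso (f2_inv Hp d u)).
  assert (J : is_iso (fhom p (runu d))).
  { apply (fhom_iso Hp), comp_iso; [apply (inv_iso (run_inv HD d)) |].
    apply (thom_iso HD); [apply id_iso | apply (inv_iso' Hu0)]. }
  apply (epi_of_iso (thom_iso HC (comp_iso J I) (inv_iso (lun_inv HC x)))).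
  (* naturality of r and r' along (d, 1) ⊗ (u, x) ≅ (d, x) *)
  pose proof (xi_2_aux (xi_one d) (xi_at_unit x)) as E.
  apply (f_equal (fun k => (runu d ⋆ lun x) ∘ k)) in E.
  rewrite <- !comp_assoc, <- (am_nat Hr'), <- (am_nat Hr) in E.
  rewrite !comp_assoc, <- !(thom_comp HC), ?comp_idl, ?comp_idr in E.
  rewrite !comp_assoc, <- !(thom_comp HC), ?comp_idl, ?comp_idr.
  now rewrite <- (comp_assoc (xi d)), xi_nat, comp_assoc, xi_2.
Qed.

Lemma xi_unique (z : forall d, Hom (p d) (q d)) :
  (forall d x, r' d x ∘ (z d ⊠ idm x) = r d x) -> forall d, z d = xi d.
Proof. intros E d; apply xi_of_tens_one; now rewrite E, xi_one. Qed.

End Comparison.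

Lemma rho_action_map : is_action_map (p := act_one G) rho ((u0 ⋆ idm one) ∘ star0).
Proof.
  split.
  - apply rho_iso.
  - rewrite ali_0; exact (inv_iso' (Hal one)).
  - exact rho_nat.
  - exact rho_2.
  - exact rho_0.
  - exact rho_coherent.
Qed.

End Action.

(** * Enriched naturality squares *)

Section Squares.
Context {B : SymCat} {K : EnrCat B}.

Let HB : is_braided B := bc_law B.

(** The naturality condition of an enriched natural transformation, for generalized
    elements f, g of the hom objects: freeing it from the functors on either side
    avoids comparing composites of enriched functors. *)
Definition sq {x y x' y' : K} {a b : B} (f : Hom a (ehom K x y)) (g : Hom b (ehom K x' y'))
    (h : Hom a b) (k : Hom one (ehom K x x')) (l : Hom one (ehom K y y')) : Prop :=
  postc x l ∘ f = prec y' k ∘ (g ∘ h).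

Lemma ecomp_thom_l (w x y z : K) (a b c : B) (h : Hom a (ehom K y z)) (g : Hom b (ehom K x y))
    (f : Hom c (ehom K w x)) :
  ecomp K w x z ∘ ((ecomp K x y z ∘ (h ⊠ g)) ⊠ f) =
  ecomp K w y z ∘ ((h ⊠ (ecomp K w x y ∘ (g ⊠ f))) ∘ ass a b c).
Proof.
  rewrite <- (comp_idl f) at 1; rewrite (thom_comp HB), <- comp_assoc, ecomp_assoc.
  rewrite !comp_assoc, (ass_nat HB), <- (comp_assoc (idm _ ⊠ _)), <- (thom_comp HB).
  now rewrite comp_idl.
Qed.

Lemma ass_luni (x : B) : ass one one x ∘ (luni one ⊠ idm x) = idm one ⊠ luni x.
Proof. strictify HB; reflexivity. Qed.

Lemma ass_runi (x : B) : ass x one one ∘ (runi x ⊠ idm one) = idm x ⊠ luni one.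
Proof. strictify HB; reflexivity. Qed.

Lemma ass_runi_luni (x : B) :
  ass one x one ∘ ((luni x ⊠ idm one) ∘ runi x) = (idm one ⊠ runi x) ∘ luni x.
Proof. strictify HB; reflexivity. Qed.

Lemma postc_comp (w x y z : K) (g : Hom one (ehom K y z)) (f : Hom one (ehom K x y)) :
  postc w (ucomp g f) = postc w g ∘ postc w f.
Proof.
  unfold postc, ucomp.
  transitivity (ecomp K w y z ∘ ((g ⊠ (ecomp K w x y ∘ ((f ⊠ idm _) ∘ luni _))) ∘ luni _)).
  - rewrite <- (comp_assoc (ecomp K x y z)), (wh_comp_r HB), <- !comp_assoc, ecomp_thom_l.
    rewrite !comp_assoc, <- (comp_assoc (ass _ _ _)), ass_luni; f_equal.
    rewrite <- !comp_assoc, <- (thom_comp HB), comp_idr; reflexivity.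
  - rewrite !comp_assoc; f_equal; rewrite <- (luni_nat HB), <- !comp_assoc.
    f_equal; rewrite !comp_assoc; apply (thom_split1 HB).
Qed.

Lemma prec_comp (w x y z : K) (g : Hom one (ehom K y z)) (f : Hom one (ehom K x y)) :
  prec w (ucomp g f) = prec w f ∘ prec w g.
Proof.
  unfold prec, ucomp.
  transitivity (ecomp K x y w ∘ (((ecomp K y z w ∘ ((idm _ ⊠ g) ∘ runi _)) ⊠ f) ∘ runi _)).
  - rewrite <- (comp_assoc (ecomp K y z w)), (thom_comp_l HB _ _ f), <- !comp_assoc.
    rewrite ecomp_thom_l, !comp_assoc, <- (comp_assoc (ass _ _ _)), ass_runi; f_equal.
    now rewrite <- !comp_assoc, <- (thom_comp HB), comp_idr.
  - rewrite !comp_assoc; f_equal; rewrite <- (runi_nat HB), <- !comp_assoc.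
    f_equal; rewrite !comp_assoc; apply (thom_split2 HB).
Qed.

Lemma postc_prec (x x' y y' : K) (k : Hom one (ehom K x x')) (l : Hom one (ehom K y y')) :
  postc x l ∘ prec y k = prec y' k ∘ postc x' l.
Proof.
  unfold postc, prec.
  transitivity (ecomp K x y y' ∘ ((l ⊠ (ecomp K x x' y ∘ ((idm _ ⊠ k) ∘ runi _))) ∘ luni _)).
  - rewrite !comp_assoc; f_equal; rewrite <- (luni_nat HB), <- !comp_assoc.
    f_equal; rewrite !comp_assoc; symmetry; apply (thom_split1 HB).
  - transitivity (ecomp K x x' y' ∘
      (((ecomp K x' y y' ∘ ((l ⊠ idm _) ∘ luni _)) ⊠ k) ∘ runi _)).
    + rewrite <- (comp_assoc (ecomp K x' y y')), (thom_comp_l HB _ _ k), <- !comp_assoc.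
      rewrite ecomp_thom_l, !comp_assoc, ass_runi_luni; f_equal.
      now rewrite <- !comp_assoc, <- (thom_comp HB), comp_idr.
    + rewrite !comp_assoc; f_equal; rewrite <- (runi_nat HB), <- !comp_assoc.
      f_equal; rewrite !comp_assoc; apply (thom_split2 HB).
Qed.

Lemma postc_id (x y : K) : postc x (eid K y) = idm (ehom K x y).
Proof.
  unfold postc; rewrite <- comp_assoc, ecomp_idl; apply (lun_inv HB).
Qed.

Lemma prec_id (x y : K) : prec y (eid K x) = idm (ehom K x y).
Proof.
  unfold prec; rewrite <- comp_assoc, ecomp_idr; apply (run_inv HB).
Qed.

(** Vertical composition of transformations; postcomposition and precomposition
    commute by associativity. *)
Lemma sq_vert {x y x' y' x'' y'' : K} {a b c : B}
    (f : Hom a (ehom K x y)) (g : Hom b (ehom K x' y')) (e : Hom c (ehom K x'' y''))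
    (h : Hom a b) (h' : Hom b c) (k : @Hom (und K) x x') (k' : @Hom (und K) x' x'')
    (l : @Hom (und K) y y') (l' : @Hom (und K) y' y'') :
  sq f g h k l -> sq g e h' k' l' -> sq f e (h' ∘ h) (k' ∘ k) (l' ∘ l).
Proof.
  unfold sq; intros E E'; cbn.
  rewrite postc_comp, prec_comp, comp_assoc, E, <- comp_assoc, postc_prec, !comp_assoc.
  now rewrite <- (comp_assoc (postc _ _)), E', !comp_assoc.
Qed.

Lemma sq_id {x y : K} {a : B} (f : Hom a (ehom K x y)) :
  sq f f (idm a) (eid K x) (eid K y).
Proof. unfold sq; now rewrite postc_id, prec_id, comp_idr. Qed.

Lemma sq_inv {x y x' y' : K} {a b : B}
    (f : Hom a (ehom K x y)) (g : Hom b (ehom K x' y'))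
    (h : Hom a b) hi (k : @Hom (und K) x x') ki (l : @Hom (und K) y y') li :
  is_inverse h hi -> is_inverse k ki -> is_inverse l li -> sq f g h k l -> sq g f hi ki li.
Proof.
  intros [_ Eh] [_ Ek] [El _] E; unfold sq in *; cbn in Ek, El.
  transitivity (postc x' li ∘ (postc x' l ∘ (prec y ki ∘ (f ∘ hi)))).
  - rewrite <- (comp_assoc (postc x' l)), postc_prec, comp_assoc, <- (comp_assoc (postc x l)), E.
    rewrite !comp_assoc, Eh, comp_idr, <- (comp_assoc (prec y' ki)), <- prec_comp, Ek.
    now rewrite prec_id, comp_idl.
  - now rewrite <- comp_assoc, <- postc_comp, El, postc_id, comp_idl.
Qed.

Lemma sq_pre {x y x' y' : K} {a b a' b' : B}
    (f : Hom a (ehom K x y)) (g : Hom b (ehom K x' y'))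
    (h : Hom a b) (k : Hom one (ehom K x x')) (l : Hom one (ehom K y y'))
    (m : Hom a' a) (n : Hom b' b) (h' : Hom a' b') :
  h ∘ m = n ∘ h' -> sq f g h k l -> sq (f ∘ m) (g ∘ n) h' k l.
Proof.
  unfold sq; intros Em E; rewrite <- comp_assoc, E, !comp_assoc; do 2 f_equal; apply Em.
Qed.

Lemma sq_mor {x y : K} (k : Hom one (ehom K x y)) :
  sq (eid K x) (eid K y) (idm one) k k.
Proof.
  unfold sq, postc, prec; rewrite comp_idr, !comp_assoc.
  rewrite <- (luni_nat HB), <- (runi_nat HB), <- !(comp_assoc (_ ⊠ _)).
  rewrite <- !(thom_comp HB), !comp_idl, !comp_idr, <- (luni_one HB).
  now transitivity k; [apply (ucomp_idr k) | symmetry; apply (ucomp_idl k)].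
Qed.

End Squares.

Section EnrichedFunctors.
Context {A B : SymCat} {L : EnrCat A} {M : EnrCat B} (F : EnrFun L M) (HF : is_enr_fun F).

Let HA : is_braided A := bc_law A.
Let HB : is_braided B := bc_law B.
Let HM : is_mon_fun (ef_hat F) := ef_hat_law HF.

Lemma fun_postc (w x y : L) (l : Hom one (ehom L x y)) :
  ef_hom F w y ∘ fhom (ef_hat F) (postc w l) = postc (F w) (ufun F l) ∘ ef_hom F w x.
Proof.
  unfold postc; rewrite !(fhom_comp HM), (fhom_luni HA HB HM).
  rewrite <- (comp_assoc (fhom _ (l ⊠ _))), <- (f2_nat HM), (fhom_id HM).
  rewrite !comp_assoc, <- (luni_nat HB), <- !(comp_assoc (ef_hom F w y)).
  rewrite comp_assoc, <- (comp_assoc (fhom _ _) (f2 _ _ _)), <- (comp_assoc (ef_hom F w y)).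
  rewrite (ef_comp HF), !comp_assoc; f_equal; rewrite <- !comp_assoc; f_equal.
  rewrite <- !(thom_comp HB), !comp_idl, !comp_idr; unfold ufun; now rewrite !comp_assoc.
Qed.

Lemma fun_prec (w x y : L) (l : Hom one (ehom L x y)) :
  ef_hom F x w ∘ fhom (ef_hat F) (prec w l) = prec (F w) (ufun F l) ∘ ef_hom F y w.
Proof.
  unfold prec; rewrite !(fhom_comp HM), (fhom_runi HA HB HM).
  rewrite <- (comp_assoc (fhom _ (_ ⊠ l))), <- (f2_nat HM), (fhom_id HM).
  rewrite !comp_assoc, <- (runi_nat HB).
  rewrite <- (comp_assoc (fhom _ _) (f2 _ _ _)), <- (comp_assoc (ef_hom F x w)).
  rewrite (ef_comp HF), !comp_assoc; f_equal; rewrite <- !comp_assoc; f_equal.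
  rewrite <- !(thom_comp HB), !comp_idl, !comp_idr; unfold ufun; now rewrite !comp_assoc.
Qed.

(** Whiskering with an enriched functor. *)
Lemma sq_fun {x y x' y' : L} {a b : A} (f : Hom a (ehom L x y))
    (g : Hom b (ehom L x' y')) (h : Hom a b) (k : Hom one (ehom L x x'))
    (l : Hom one (ehom L y y')) :
  sq f g h k l ->
  sq (ef_hom F x y ∘ fhom (ef_hat F) f) (ef_hom F x' y' ∘ fhom (ef_hat F) g)
    (fhom (ef_hat F) h) (ufun F k) (ufun F l).
Proof.
  unfold sq; intro E.
  rewrite <- comp_assoc, <- fun_postc, comp_assoc, <- (fhom_comp HM), E.
  now rewrite !(fhom_comp HM), <- comp_assoc, fun_prec, !comp_assoc.
Qed.

Lemma ufun_id (x : L) : ufun F (eid L x) = eid M (F x).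
Proof. apply (ef_id HF). Qed.

End EnrichedFunctors.

Lemma ufun_comp_ef {A B C : SymCat} {L : EnrCat A} {M : EnrCat B} {N : EnrCat C}
    (G : EnrFun M N) (F : EnrFun L M) (HG : is_mon_fun (ef_hat G)) {x y : L}
    (f : Hom one (ehom L x y)) :
  ufun (comp_ef G F) f = ufun G (ufun F f).
Proof. unfold ufun; cbn; now rewrite !(fhom_comp HG), !comp_assoc. Qed.

Lemma ufun_times {X Y V : EBData} (F : EBFunData X Y) (HF : is_mon_fun (ef_hat F))
    {x x' : X} {v v' : V} (f : Hom one (ehom X x x')) (h : Hom one (ehom V v v')) :
  @ufun _ _ (prod_eb X V) (prod_eb Y V) (times_id F V) (x, v) (x', v') (f, h) =
  (ufun F f, h).
Proof.
  unfold ufun; cbn; f_equal; now rewrite ?(fhom_id HF), ?comp_idl, ?comp_idr.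
Qed.

Lemma ufun_comp_times {X Y V T : EBData} (G : EBFunData (prod_eb Y V) T) (F : EBFunData X Y)
    (HG : is_mon_fun (ef_hat G)) (HF : is_mon_fun (ef_hat F))
    {x x' : X} {v v' : V} (f : Hom one (ehom X x x')) (h : Hom one (ehom V v v')) :
  @ufun _ _ (prod_eb X V) T (comp_eb G (times_id F V)) (x, v) (x', v') (f, h) =
  @ufun _ _ (prod_eb Y V) T G (F x, v) (F x', v') (ufun F f, h).
Proof.
  transitivity (ufun G (@ufun _ _ (prod_eb X V) (prod_eb Y V) (times_id F V) (x, v) (x', v')
      (f, h))).
  - exact (ufun_comp_ef (times_id F V) HG _).
  - now rewrite (ufun_times HF).
Qed.

(** The identity on the second variable contributes only identities. *)
Lemma comp_times_f2 {X Y V T : EBData} (G : EBFunData (prod_eb Y V) T) (F : EBFunData X Y)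
    (HF : is_enr_fun F) (x y : X) (v w : V) :
  f2 (und_mf (comp_eb G (times_id F V))) (x, v) (y, w) =
  @comp (und T) _ _ _
    (@ufun _ _ (prod_eb Y V) T G (et (F x) (F y), et v w) (F (et x y), et v w)
       (g2 F x y, eid V (et v w)))
    (g2 G (F x, v) (F y, w)).
Proof.
  change (@comp (und T) _ _ _
    (@ufun _ _ (prod_eb Y V) T G (et (F x) (F y), et v w) (F (et x y), et v w)
       (ucomp (ufun F (eid X (et x y))) (g2 F x y), eid V (et v w)))
    (g2 G (F x, v) (F y, w)) = @comp (und T) _ _ _
    (@ufun _ _ (prod_eb Y V) T G (et (F x) (F y), et v w) (F (et x y), et v w)
       (g2 F x y, eid V (et v w)))
    (g2 G (F x, v) (F y, w))).
  rewrite (ufun_id HF).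
  now rewrite (comp_idl (c := und Y) (g2 F x y) : ucomp (eid Y _) (g2 F x y) = _).
Qed.

Lemma comp_times_f0 {X Y V T : EBData} (G : EBFunData (prod_eb Y V) T) (F : EBFunData X Y)
    (HF : is_enr_fun F) :
  f0 (und_mf (comp_eb G (times_id F V))) =
  @comp (und T) _ _ _
    (@ufun _ _ (prod_eb Y V) T G (e1, e1) (F e1, e1) (g0 F, eid V e1)) (g0 G).
Proof.
  change (@comp (und T) _ _ _
    (@ufun _ _ (prod_eb Y V) T G (e1, e1) (F e1, e1)
       (ucomp (ufun F (eid X e1)) (g0 F), eid V e1))
    (g0 G) = @comp (und T) _ _ _
    (@ufun _ _ (prod_eb Y V) T G (e1, e1) (F e1, e1) (g0 F, eid V e1)) (g0 G)).
  rewrite (ufun_id HF).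
  now rewrite (comp_idl (c := und Y) (g0 F) : ucomp (eid Y _) (g0 F) = _).
Qed.

Lemma comp_ef_law {A B C : SymCat} {L : EnrCat A} {M : EnrCat B} {N : EnrCat C}
    (G : EnrFun M N) (F : EnrFun L M) :
  is_enr_fun G -> is_enr_fun F -> is_enr_fun (comp_ef G F).
Proof.
  intros HG HF; pose proof (bc_law C) as HC; pose proof (ef_hat_law HG) as HM.
  split.
  - exact (comp_mf_mon HC HM (ef_hat_law HF)).
  - intro x; refine (eq_trans (ufun_comp_ef F HM (eid L x)) _).
    now rewrite (ufun_id HF), (ufun_id HG).
  - intros x y z; cbn.
    rewrite (thom_comp HC), <- (comp_assoc (ecomp N _ _ _)), <- (ef_comp HG), !comp_assoc.
    f_equal; rewrite (f2_nat HM), <- !comp_assoc; f_equal; rewrite <- !(fhom_comp HM).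
    f_equal; rewrite comp_assoc; apply (ef_comp HF).
Qed.

Lemma sq_pair {A B : SymCat} {L : EnrCat A} {M : EnrCat B} {x y x' y' : L} {u v u' v' : M}
    {a a' : A} {b b' : B} (f : Hom a (ehom L x y)) (g : Hom a' (ehom L x' y')) (h : Hom a a')
    (k : Hom one (ehom L x x')) (l : Hom one (ehom L y y'))
    (f' : Hom b (ehom M u v)) (g' : Hom b' (ehom M u' v')) (h' : Hom b b')
    (k' : Hom one (ehom M u u')) (l' : Hom one (ehom M v v')) :
  sq f g h k l -> sq f' g' h' k' l' ->
  @sq _ (prod_enr L M) (x, u) (y, v) (x', u') (y', v') (a, b) (a', b')
    (f, f') (g, g') (h, h') (k, k') (l, l').
Proof. unfold sq; intros E E'; cbn; f_equal; assumption. Qed.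

Section BraidedEnriched.
Context {X : EBData} (HX : is_eb X).

Notation A := (eb_base X).
Let HA : is_braided A := bc_law A.
Let HU : is_braided (und_bm X) := eb_und HX.

Definition etens {x x' y y' : X} {a b : A} (f : Hom a (ehom X x x')) (g : Hom b (ehom X y y')) :
    Hom (a ⊗ b) (ehom X (et x y) (et x' y')) :=
  eth x x' y y' ∘ (f ⊠ g).

Lemma etens_comp {x x' y y' : X} {a b a' b' : A} (f : Hom a (ehom X x x'))
    (g : Hom b (ehom X y y')) (m : Hom a' a) (n : Hom b' b) :
  etens (f ∘ m) (g ∘ n) = etens f g ∘ (m ⊠ n).
Proof. unfold etens; now rewrite (thom_comp HA), comp_assoc. Qed.

Lemma etens_id {x x' y y' : X} :
  etens (idm (ehom X x x')) (idm (ehom X y y')) = eth x x' y y'.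
Proof. unfold etens; now rewrite (thom_id HA), comp_idr. Qed.

Lemma sq_etens {x1 y1 x1' y1' x2 y2 x2' y2' : X} {a a' b b' : A}
    (f : Hom a (ehom X x1 y1)) (g : Hom a' (ehom X x1' y1')) (h : Hom a a')
    (k : @Hom (und_bm X) x1 x1') (l : @Hom (und_bm X) y1 y1')
    (f' : Hom b (ehom X x2 y2)) (g' : Hom b' (ehom X x2' y2')) (h' : Hom b b')
    (k' : @Hom (und_bm X) x2 x2') (l' : @Hom (und_bm X) y2 y2') :
  sq f g h k l -> sq f' g' h' k' l' -> sq (etens f f') (etens g g') (h ⊠ h') (k ⊠ k') (l ⊠ l').
Proof.
  intros E E'; exact (sq_fun (eb_tens HX) (sq_pair E E')).
Qed.

Lemma sq_lun {x y : X} {a : A} (f : Hom a (ehom X x y)) :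
  sq (etens (eid X e1) f) f (lun a) (el x) (el y).
Proof.
  assert (E : sq (eth e1 e1 x y ∘ ((eid X e1 ∘ idm (@one A)) ⊠ idm (ehom X x y)))
    (idm (ehom X x y)) (lun (ehom X x y)) (el x) (el y)) by exact (en_eq (eb_lun HX) x y).
  rewrite comp_idr in E; rewrite <- (comp_idr (eid X e1)), <- (comp_idl f), etens_comp.
  exact (sq_pre (lun_nat HA f) E).
Qed.

Lemma sq_run {x y : X} {a : A} (f : Hom a (ehom X x y)) :
  sq (etens f (eid X e1)) f (run a) (er x) (er y).
Proof.
  assert (E : sq (eth x y e1 e1 ∘ (idm (ehom X x y) ⊠ (eid X e1 ∘ idm (@one A))))
    (idm (ehom X x y)) (run (ehom X x y)) (er x) (er y)) by exact (en_eq (eb_run HX) x y).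
  rewrite comp_idr in E; rewrite <- (comp_idr (eid X e1)), <- (comp_idl f), etens_comp.
  exact (sq_pre (run_nat HA f) E).
Qed.

Lemma sq_br {x y x' y' : X} {a b : A} (f : Hom a (ehom X x y)) (g : Hom b (ehom X x' y')) :
  sq (etens f g) (etens g f) (br a b) (ec x x') (ec y y').
Proof.
  assert (E : sq (eth x y x' y' ∘ (idm (ehom X x y) ⊠ idm (ehom X x' y')))
    (eth x' y' x y ∘ (idm (ehom X x' y') ⊠ idm (ehom X x y)))
    (br (ehom X x y) (ehom X x' y')) (ec x x') (ec y y'))
    by exact (en_eq (eb_br HX) (x, x') (y, y')).
  rewrite <- (comp_idl f), <- (comp_idl g), !etens_comp.
  exact (sq_pre (br_nat HA f g) E).
Qed.

Lemma sq_ass {x y x' y' x'' y'' : X} {a b c : A} (f : Hom a (ehom X x y))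
    (g : Hom b (ehom X x' y')) (h : Hom c (ehom X x'' y'')) :
  sq (etens (etens f g) h) (etens f (etens g h)) (ass a b c) (ea x x' x'') (ea y y' y'').
Proof.
  assert (E : sq (eth (et x x') (et y y') x'' y'' ∘ ((eth x y x' y'
        ∘ ((idm (ehom X x y) ∘ idm _) ⊠ (idm (ehom X x' y') ∘ idm _))) ⊠ idm (ehom X x'' y'')))
      (eth x y (et x' x'') (et y' y'') ∘ ((idm (ehom X x y) ∘ idm _) ⊠
         (eth x' y' x'' y'' ∘ ((idm (ehom X x' y') ∘ idm _) ⊠ idm (ehom X x'' y'')))))
      (ass (ehom X x y) (ehom X x' y') (ehom X x'' y'')) (ea x x' x'') (ea y y' y''))
    by exact (en_eq (eb_ass HX) (x, x', x'') (y, y', y'')).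
  rewrite !comp_idl in E.
  rewrite <- (comp_idl f), <- (comp_idl g), <- (comp_idl h), !etens_comp.
  exact (sq_pre (ass_nat HA f g h) E).
Qed.

Lemma sq_assi {x y x' y' x'' y'' : X} {a b c : A} (f : Hom a (ehom X x y))
    (g : Hom b (ehom X x' y')) (h : Hom c (ehom X x'' y'')) :
  sq (etens f (etens g h)) (etens (etens f g) h) (assi a b c) (eai x x' x'') (eai y y' y'').
Proof.
  exact (sq_inv (ass_inv HA a b c) (ass_inv HU x x' x'') (ass_inv HU y y' y'') (sq_ass f g h)).
Qed.

Lemma sq_runi {x y : X} {a : A} (f : Hom a (ehom X x y)) :
  sq f (etens f (eid X e1)) (runi a) (eri x) (eri y).
Proof. exact (sq_inv (run_inv HA a) (run_inv HU x) (run_inv HU y) (sq_run f)). Qed.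

Lemma sq_luni {x y : X} {a : A} (f : Hom a (ehom X x y)) :
  sq f (etens (eid X e1) f) (luni a) (eli x) (eli y).
Proof. exact (sq_inv (lun_inv HA a) (lun_inv HU x) (lun_inv HU y) (sq_lun f)). Qed.

(** The middle interchange is composed of associators and a braiding, so its
    naturality is composed of theirs. *)
Lemma sq_swap {x1 y1 x2 y2 x3 y3 x4 y4 : X} {a b c d : A} (f : Hom a (ehom X x1 y1))
    (g : Hom b (ehom X x2 y2)) (h : Hom c (ehom X x3 y3)) (k : Hom d (ehom X x4 y4)) :
  sq (etens (etens f g) (etens h k)) (etens (etens f h) (etens g k)) (swap_mid a b c d)
    (@swap_mid (und_bm X) x1 x2 x3 x4) (@swap_mid (und_bm X) y1 y2 y3 y4).
Proof.
  refine (sq_vert (sq_vert (sq_ass f g (etens h k)) (sq_etens (sq_id f) _)) (sq_assi f h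
      (etens g k))).
  exact (sq_vert (sq_vert (sq_assi g h k) (sq_etens (sq_br g h) (sq_id k))) (sq_ass h g k)).
Qed.

End BraidedEnriched.

(** * The canonical construction *)

Section CanonicalLaws.
Context {A : SymCat} {L : BrModule A} (H : Enriched L).

Let HA : is_braided A := bc_law A.
Let HL : is_braided L := bc_law L.

(** Inverse to currying, written by the counit. *)
Definition transpose {a : A} {x y : L} (f : Hom a (ih H x y)) : Hom (a ⊙ x) y :=
  ev H x y ∘ (f ⊡ idm x).

Lemma transpose_inj (a : A) (x y : L) (f g : Hom a (ih H x y)) : transpose f = transpose g ->
    f = g.
Proof. apply cur_ext. Qed.

Lemma transpose_comp (a b : A) (x y : L) (f : Hom b (ih H x y)) (h : Hom a b) :
  transpose (f ∘ h) = transpose f ∘ (h ⊡ idm x).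
Proof. unfold transpose; now rewrite mhom_comp_l, comp_assoc. Qed.

Lemma transpose_cur (a : A) (x y : L) (f : Hom (a ⊙ x) y) : transpose (cur H f) = f.
Proof. apply ev_cur. Qed.

Lemma transpose_id (x y : L) : transpose (idm (ih H x y)) = ev H x y.
Proof. unfold transpose; rewrite mhom_id; apply comp_idr. Qed.

Lemma transpose_slide (a b : A) (x y z : L) (f : Hom b (ih H y z)) (h : Hom a b) (k : Hom x y) :
  transpose f ∘ (h ⊡ k) = ev H y z ∘ ((f ∘ h) ⊡ k).
Proof. unfold transpose; now rewrite comp_assoc, <- mhom_comp, comp_idl. Qed.

Lemma transpose_can_comp (a b : A) (x y z : L) (g : Hom b (ih H y z)) (f : Hom a (ih H x y)) :
  transpose (can_comp H x y z ∘ (g ⊠ f)) = transpose g ∘ ((idm b ⊡ transpose f) ∘ mass L b a x).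
Proof.
  rewrite transpose_comp; unfold can_comp; rewrite transpose_cur, !comp_assoc, mass_nat.
  rewrite <- (comp_assoc (idm _ ⊡ ev H x y)), <- mhom_comp, comp_idl.
  rewrite <- (comp_assoc (transpose g)), transpose_slide, comp_idr; unfold transpose; now
      rewrite !comp_assoc.
Qed.

Definition split_act (a : A) (x : L) (b : A) (y : L) :
    Hom ((a ⊗ b) ⊙ (x ⊗ y)) ((a ⊙ x) ⊗ (b ⊙ y)) :=
  f2i (mact L) (a, x) (b, y).

Definition join_act (a : A) (x : L) (b : A) (y : L) :
    Hom ((a ⊙ x) ⊗ (b ⊙ y)) ((a ⊗ b) ⊙ (x ⊗ y)) :=
  f2 (mact L) (a, x) (b, y).

Lemma join_inv (a : A) (x : L) (b : A) (y : L) :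
  is_inverse (join_act a x b y) (split_act a x b y).
Proof. exact (f2_inv (mact_law L) (a, x) (b, y)). Qed.

Lemma split_act_nat (a a' b b' : A) (x x' y y' : L) (f : Hom a a') (g : Hom b b')
    (h : Hom x x') (k : Hom y y') :
  split_act a' x' b' y' ∘ ((f ⊠ g) ⊡ (h ⊠ k)) =
  ((f ⊡ h) ⊠ (g ⊡ k)) ∘ split_act a x b y.
Proof.
  apply (swap_inverse (join_inv a' x' b' y') (join_inv a x b y)).
  exact (@f2_nat _ _ _ (mact_law L) (a, x) (a', x') (b, y) (b', y') (f, h) (g, k)).
Qed.

Lemma transpose_can_tens (a b : A) (x x' y y' : L) (f : Hom a (ih H x x')) (g : Hom b (ih H y
    y')) :
  transpose (can_tens H x x' y y' ∘ (f ⊠ g)) = (transpose f ⊠ transpose g) ∘ split_act a x b y.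
Proof.
  rewrite transpose_comp; unfold can_tens; rewrite transpose_cur, <- (thom_id HL).
  change (f2i (mact L) (ih H x x', x) (ih H y y', y)) with
    (split_act (ih H x x') x (ih H y y') y).
  rewrite comp_assoc.
  rewrite split_act_nat, <- comp_assoc, <- (thom_comp HL); reflexivity.
Qed.

Lemma transpose_can_mor (x y : L) (f : Hom x y) : transpose (can_mor H f) = f ∘ munit L x.
Proof. apply transpose_cur. Qed.

Lemma can_mor_id (x : L) : can_mor H (idm x) = can_id H x.
Proof. unfold can_mor, can_id; now rewrite comp_idl. Qed.

Lemma transpose_postc (a : A) (x y z : L) (f : Hom a (ih H x y)) (h : Hom y z) :
  transpose (postc (L := can_enr H) x (can_mor H h) ∘ f) = h ∘ transpose f.
Proof.
  rewrite transpose_comp; unfold transpose at 2; rewrite <- comp_assoc; f_equal.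
  unfold postc; cbn [ecomp ehom can_enr eob].
  rewrite <- comp_assoc, transpose_comp, transpose_can_comp, transpose_can_mor, transpose_id.
  rewrite !comp_assoc, <- (comp_assoc (munit L _)), munit_nat, !comp_assoc.
  rewrite <- (comp_assoc (munit L _)), munit_mass, <- mhom_comp_l.
  now rewrite (proj2 (lun_inv HA _)), mhom_id, comp_idr.
Qed.

Lemma transpose_prec (a : A) (x y z : L) (f : Hom a (ih H y z)) (h : Hom x y) :
  transpose (prec (L := can_enr H) z (can_mor H h) ∘ f) = transpose f ∘ (idm a ⊡ h).
Proof.
  rewrite transpose_comp; unfold transpose at 2; rewrite comp_assoc, <- mhom_slide, <-
      comp_assoc; f_equal.
  unfold prec; cbn [ecomp ehom can_enr eob].
  rewrite <- comp_assoc, transpose_comp, transpose_can_comp, transpose_can_mor, transpose_id.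
  rewrite mhom_comp_r, !comp_assoc, <- (comp_assoc (idm _ ⊡ munit L x)), triangle_mod.
  rewrite <- mhom_comp_l, (proj2 (run_inv HA _)), mhom_id; now rewrite comp_idr.
Qed.

(** Naturality squares in the canonical construction say that L-morphisms intertwine
    the transposed hom maps. *)
Lemma sq_transpose_iff (a b : A) (x y x' y' : L) (f : Hom a (ih H x y)) (g : Hom b (ih H x' y'))
    (h : Hom a b) (k : Hom x x') (l : Hom y y') :
  postc (L := can_enr H) x (can_mor H l) ∘ f =
    prec (L := can_enr H) y' (can_mor H k) ∘ (g ∘ h) <->
  l ∘ transpose f = transpose g ∘ (h ⊡ k).
Proof.
  assert (E : transpose (prec (L := can_enr H) y' (can_mor H k) ∘ (g ∘ h)) = transpose g ∘ (h
      ⊡ k))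
    by now rewrite transpose_prec, transpose_comp, comp_assoc, <- mhom_comp, comp_idl, comp_idr.
  split; intro K.
  - rewrite <- E, <- K; symmetry; apply transpose_postc.
  - apply transpose_inj; rewrite E, <- K; apply transpose_postc.
Qed.

(** The bijection between morphisms of L and underlying morphisms, which preserves all
    of the structure. *)
Definition can_und {x y : L} (f : Hom x y) : @Hom (und_bm (canonical H)) x y := can_mor H f.

Lemma can_und_surj (x y : L) (f : @Hom (und_bm (canonical H)) x y) : exists g, f = can_und g.
Proof.
  exists (transpose (f : Hom one (ih H x y)) ∘ inv_of (munit_iso L x)).
  unfold can_und; apply transpose_inj; rewrite transpose_can_mor, comp_assoc, inv_of_l;
      symmetry; apply comp_idr.
Qed.

Lemma can_und_inj (x y : L) (f g : Hom x y) : can_und f = can_und g -> f = g.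
Proof.
  intro E; apply (epi_of_iso (munit_iso L x)).
  rewrite <- !transpose_can_mor; exact (f_equal transpose E).
Qed.

Lemma can_und_id (x : L) : idm (x : und_bm (canonical H)) = can_und (idm x).
Proof. symmetry; apply can_mor_id. Qed.

Lemma can_und_comp (x y z : L) (g : Hom y z) (f : Hom x y) :
  @comp (und_bm (canonical H)) x y z (can_und g) (can_und f) = can_und (g ∘ f).
Proof.
  change (can_comp H x y z ∘ ((can_mor H g ⊠ can_mor H f) ∘ luni one) = can_mor H (g ∘ f)).
  apply transpose_inj; rewrite <- comp_assoc, transpose_comp, transpose_can_comp,
      !transpose_can_mor.
  rewrite mhom_comp_r, !comp_assoc, <- (comp_assoc (idm _ ⊡ munit L x)), triangle_mod.
  rewrite <- mhom_comp_l, <- (lun_one HA), (proj2 (lun_inv HA _)), mhom_id, comp_idr.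
  now rewrite munit_nat.
Qed.

(** The unitor of the action is monoidal. *)
Lemma split_munit (x y : L) :
  (munit L x ⊠ munit L y) ∘ split_act one x one y =
  munit L (x ⊗ y) ∘ (lun one ⊡ idm (x ⊗ y)).
Proof.
  apply (epi_of_iso (inv_iso (join_inv one x one y))).
  rewrite comp_assoc, (proj1 (join_inv one x one y)), comp_idr.
  pose proof (mn_2 (munit_mon L) x y) as E; cbn in E.
  rewrite !comp_idl in E; rewrite comp_assoc; symmetry; exact E.
Qed.

Definition unit_act : Hom (@one L) (@one A ⊙ one) := f0 (mact L).

Lemma unit_act_iso : is_iso unit_act.
Proof. exact (inv_iso (f0_inv (mact_law L))). Qed.

Lemma munit_0 : munit L one ∘ unit_act = idm one.
Proof.
  pose proof (mn_0 (munit_mon L)) as E; cbn in E; rewrite !comp_idl in E.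
  rewrite <- E; f_equal.
  transitivity ((idm one ⊡ idm one) ∘ unit_act); [| reflexivity].
  now rewrite mhom_id, comp_idl.
Qed.

Lemma can_und_thom (x x' y y' : L) (f : Hom x x') (g : Hom y y') :
  @thom (und_bm (canonical H)) x x' y y' (can_und f) (can_und g) = can_und (f ⊠ g).
Proof.
  change (can_tens H x x' y y' ∘ ((can_mor H f ⊠ can_mor H g) ∘ luni one) =
    can_mor H (f ⊠ g)).
  apply transpose_inj; rewrite <- comp_assoc, transpose_comp, transpose_can_tens,
      !transpose_can_mor.
  rewrite (thom_comp HL), !comp_assoc, <- (comp_assoc (munit L x ⊠ _)), split_munit, comp_assoc.
  now rewrite <- mhom_comp_l, (proj2 (lun_inv HA _)), mhom_id, comp_idr.
Qed.

Lemma can_und_inverse (x y : L) (f : Hom x y) (g : Hom y x) :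
  is_inverse f g -> is_inverse (can_und f) (can_und g).
Proof. intros [a b]; split; rewrite can_und_comp, ?a, ?b; symmetry; apply can_und_id. Qed.

Ltac fold_can_und :=
  repeat match goal with
  | |- context [@ass (und_bm (canonical H)) ?x ?y ?z] =>
      change (@ass (und_bm (canonical H)) x y z) with (can_und (@ass L x y z))
  | |- context [@assi (und_bm (canonical H)) ?x ?y ?z] =>
      change (@assi (und_bm (canonical H)) x y z) with (can_und (@assi L x y z))
  | |- context [@lun (und_bm (canonical H)) ?x] =>
      change (@lun (und_bm (canonical H)) x) with (can_und (@lun L x))
  | |- context [@luni (und_bm (canonical H)) ?x] =>
      change (@luni (und_bm (canonical H)) x) with (can_und (@luni L x))
  | |- context [@run (und_bm (canonical H)) ?x] =>
      change (@run (und_bm (canonical H)) x) with (can_und (@run L x))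
  | |- context [@runi (und_bm (canonical H)) ?x] =>
      change (@runi (und_bm (canonical H)) x) with (can_und (@runi L x))
  | |- context [@br (und_bm (canonical H)) ?x ?y] =>
      change (@br (und_bm (canonical H)) x y) with (can_und (@br L x y))
  | |- context [@bri (und_bm (canonical H)) ?x ?y] =>
      change (@bri (und_bm (canonical H)) x y) with (can_und (@bri L x y))
  | |- context [@tob (und_bm (canonical H)) ?x ?y] =>
      change (@tob (und_bm (canonical H)) x y) with (@tob L x y)
  | |- context [@one (und_bm (canonical H))] =>
      change (@one (und_bm (canonical H))) with (@one L)
  | f : @Hom (bm_cat (und_bm (canonical H))) _ _ |- _ =>
      let g := fresh f in destruct (can_und_surj f) as [g ->]
  end.

Lemma can_und_braided : is_braided (und_bm (canonical H)).
Proof.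
  split; intros; fold_can_und.
  all: try (apply can_und_inverse; apply HL).
  all: repeat rewrite ?can_und_id, ?can_und_thom, ?can_und_comp.
  all: try (apply f_equal; apply HL).
Qed.

Lemma swap_mid_sym (a b c d : A) : swap_mid a c b d ∘ swap_mid a b c d = idm _.
Proof.
  unfold swap_mid; strictify HA.
  now rewrite <- !(wh_comp HA a), (brv_sym HA _ (sc_sym b c)), !(thom_id HA).
Qed.

(** The associator of the action is monoidal. *)
Lemma split_mass (a b a' b' : A) (x x' : L) :
  (mass L a b x ⊠ mass L a' b' x')
    ∘ (split_act (a ⊗ b) x (a' ⊗ b') x' ∘ (swap_mid a a' b b' ⊡ idm (x ⊗ x'))) =
  split_act a (b ⊙ x) a' (b' ⊙ x')
    ∘ ((idm (a ⊗ a') ⊡ split_act b x b' x') ∘ mass L (a ⊗ a') (b ⊗ b') (x ⊗ x')).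
Proof.
  pose proof (mn_2 (mass_mon L) (a, b, x) (a', b', x')) as E; cbn in E.
  rewrite !comp_idl in E.
  change (mass L (a ⊗ a') (b ⊗ b') (x ⊗ x')
      ∘ ((((idm _ ⊠ idm _) ∘ swap_mid a b a' b') ⊡ idm (x ⊗ x'))
         ∘ join_act (a ⊗ b) x (a' ⊗ b') x') =
    ((idm _ ⊡ ((idm (b ⊗ b') ⊡ idm (x ⊗ x')) ∘ join_act b x b' x'))
      ∘ join_act a (b ⊙ x) a' (b' ⊙ x'))
      ∘ (mass L a b x ⊠ mass L a' b' x')) in E.
  rewrite (thom_id HA), comp_idl, mhom_id, comp_idl in E.
  assert (K : split_act a (b ⊙ x) a' (b' ⊙ x') ∘ ((idm _ ⊡ split_act b x b' x')
      ∘ (mass L (a ⊗ a') (b ⊗ b') (x ⊗ x') ∘ (swap_mid a b a' b' ⊡ idm (x ⊗ x')))) =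
    (mass L a b x ⊠ mass L a' b' x') ∘ split_act (a ⊗ b) x (a' ⊗ b') x').
  { apply (swap_inverse (join_inv a (b ⊙ x) a' (b' ⊙ x')) (join_inv (a ⊗ b) x (a' ⊗ b') x')).
    rewrite !comp_assoc, E, <- !comp_assoc, <- mhom_comp_r, (proj1 (join_inv _ _ _ _)).
    now rewrite mhom_id, comp_idl. }
  rewrite <- comp_assoc, <- K, !comp_assoc, <- mhom_comp_l, swap_mid_sym, mhom_id, comp_idr.
  reflexivity.
Qed.

(** Transposed, this is monoidality of the associator of the action. *)
Lemma tens_ef_comp (x y z x' y' z' : L) :
  can_tens H x z x' z' ∘ ((can_comp H x y z ⊠ can_comp H x' y' z')
    ∘ swap_mid (ih H y z) (ih H y' z') (ih H x y) (ih H x' y')) =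
  can_comp H (x ⊗ x') (y ⊗ y') (z ⊗ z') ∘ (can_tens H y z y' z' ⊠ can_tens H x y x' y').
Proof.
  assert (E : forall a b c : L, can_comp H a b c = can_comp H a b c ∘ (idm _ ⊠ idm _))
    by (intros; now rewrite (thom_id HA), comp_idr).
  assert (E' : forall a b c d : L, can_tens H a b c d = can_tens H a b c d ∘ (idm _ ⊠ idm _))
    by (intros; now rewrite (thom_id HA), comp_idr).
  apply transpose_inj.
  rewrite <- comp_assoc, transpose_comp, transpose_can_tens, transpose_can_comp.
  rewrite (E x y z), (E x' y' z'), (E' y z y' z'), (E' x y x' y').
  rewrite !transpose_can_comp, !transpose_can_tens, !transpose_id.
  rewrite !(thom_comp HL), !comp_assoc, split_mass.
  rewrite mhom_comp_r, !comp_assoc; f_equal.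
  assert (E3 : split_act (ih H y z) y (ih H y' z') y' ∘ (idm _ ⊡ (ev H x y ⊠ ev H x' y')) =
      ((idm _ ⊡ ev H x y) ⊠ (idm _ ⊡ ev H x' y')) ∘ split_act _ _ _ _)
    by (rewrite <- (thom_id HA); apply split_act_nat).
  now rewrite <- (comp_assoc (split_act _ y _ y')), E3, !comp_assoc.
Qed.

Lemma split_ass (a b c : A) (x y z : L) :
  ass (a ⊙ x) (b ⊙ y) (c ⊙ z)
    ∘ ((split_act a x b y ⊠ idm (c ⊙ z)) ∘ split_act (a ⊗ b) (x ⊗ y) c z) =
  (idm (a ⊙ x) ⊠ split_act b y c z)
    ∘ (split_act a x (b ⊗ c) (y ⊗ z) ∘ (ass a b c ⊡ ass x y z)).
Proof.
  pose proof (f2_ass (mact_law L) (a, x) (b, y) (c, z)) as E.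
  change ((ass a b c ⊡ ass x y z) ∘ (join_act (a ⊗ b) (x ⊗ y) c z
       ∘ (join_act a x b y ⊠ idm (c ⊙ z))) =
    join_act a x (b ⊗ c) (y ⊗ z)
      ∘ ((idm (a ⊙ x) ⊠ join_act b y c z) ∘ ass (a ⊙ x) (b ⊙ y) (c ⊙ z))) in E.
  rewrite <- (comp_assoc (join_act a x _ _)) in E.
  symmetry; rewrite <- comp_assoc.
  exact (swap_inverse (inverse_comp (join_inv a x (b ⊗ c) (y ⊗ z))
    (inverse_thom HL (inverse_id (a ⊙ x)) (join_inv b y c z)))
    (inverse_comp (join_inv (a ⊗ b) (x ⊗ y) c z) (inverse_thom HL (join_inv a x b y)
    (inverse_id (c ⊙ z)))) (eq_sym E)).
Qed.

Lemma split_lun (a : A) (x : L) :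
  lun (a ⊙ x) ∘ ((munit L one ⊠ idm (a ⊙ x)) ∘ split_act one one a x) = lun a ⊡ lun x.
Proof.
  assert (E : (lun a ⊡ lun x) ∘ (join_act one one a x ∘ (unit_act ⊠ idm (a ⊙ x))) =
    lun (a ⊙ x)) by exact (f2_lun (mact_law L) (a, x)).
  apply (epi_of_iso (inv_iso (join_inv one one a x))).
  assert (I : is_iso (unit_act)) by apply (inv_iso (f0_inv (mact_law L))).
  apply (epi_of_iso (thom_iso HL unit_act_iso (id_iso (a ⊙ x)))).
  rewrite !comp_assoc, E, <- (comp_assoc (split_act _ _ _ _)), (proj1 (join_inv _ _ _ _)).
  rewrite comp_idl.
  rewrite <- (wh_comp_r HL), munit_0, (thom_id HL); apply comp_idr.
Qed.

Lemma split_run (a : A) (x : L) :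
  run (a ⊙ x) ∘ ((idm (a ⊙ x) ⊠ munit L one) ∘ split_act a x one one) = run a ⊡ run x.
Proof.
  assert (E : (run a ⊡ run x) ∘ (join_act a x one one ∘ (idm (a ⊙ x) ⊠ unit_act)) =
    run (a ⊙ x)) by exact (f2_run (mact_law L) (a, x)).
  apply (epi_of_iso (inv_iso (join_inv a x one one))).
  assert (I : is_iso (unit_act)) by apply (inv_iso (f0_inv (mact_law L))).
  apply (epi_of_iso (thom_iso HL (id_iso (a ⊙ x)) unit_act_iso)).
  rewrite !comp_assoc, E, <- (comp_assoc (split_act _ _ _ _)), (proj1 (join_inv _ _ _ _)).
  rewrite comp_idl.
  rewrite <- (wh_comp HL), munit_0, (thom_id HL); apply comp_idr.
Qed.

Lemma split_br (a b : A) (x y : L) :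
  br (a ⊙ x) (b ⊙ y) ∘ split_act a x b y = split_act b y a x ∘ (br a b ⊡ br x y).
Proof.
  symmetry; apply (swap_inverse (join_inv b y a x) (join_inv a x b y)).
  symmetry; exact (f2_br (mact_law L) (a, x) (b, y)).
Qed.

Ltac drop_id := repeat rewrite ?(thom_id HA), ?comp_idl, ?comp_idr.

(** On hom objects every axiom transposes to the compatibility of the action, which is
    a braided monoidal functor, with the corresponding constraints of A and L. *)
Lemma can_eb : is_eb (canonical H).
Proof.
  split; [split | split; [split |] | split; [split |] | split; [split |] | split; [split |] |].
  - apply (tens_mon HA).
  - intros [x x']; cbn.
    change (@thom (und_bm (canonical H)) x x x' x' (can_id H x) (can_id H x') =
      can_id H (x ⊗ x')).
    rewrite <- !can_mor_id, <- (thom_id HL); apply can_und_thom.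
  - intros [x x'] [y y'] [z z']; apply tens_ef_comp.
  - cbn; intros; apply (ass_nat HA).
  - cbn; intros; drop_id; apply (ass_tens HA).
  - cbn; drop_id; apply (ass_tens_one HA).
  - intros [[x y] z] [[x' y'] z']; cbn; drop_id; apply sq_transpose_iff.
    rewrite <- (comp_idr (can_tens H x x' y y')), <- (comp_idr (can_tens H y y' z z')).
    rewrite <- !(thom_id HA), !transpose_can_tens, !transpose_id.
    rewrite (thom_comp_l HL), (thom_comp_r HL), !comp_assoc, <- (comp_assoc (ass _ _ _)),
        (ass_nat HL).
    now rewrite !comp_assoc, split_ass.
  - cbn; intros; apply (lun_nat HA).
  - cbn; intros; drop_id; apply (lun_tens HA).
  - cbn; drop_id; apply (lun_inv HA).
  - intros x y; cbn; drop_id; rewrite <- (comp_idl (lun (ih H x y))); apply sq_transpose_iff.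
    rewrite transpose_can_tens, !transpose_id, <- can_mor_id, transpose_can_mor, comp_idl.
    rewrite (thom_split2 HL (munit L one)), !comp_assoc, <- (comp_assoc (lun y)), (lun_nat HL).
    now rewrite !comp_assoc, split_lun.
  - cbn; intros; apply (run_nat HA).
  - cbn; intros; drop_id; apply (run_tens HA).
  - cbn; drop_id; rewrite <- (lun_one HA); apply (lun_inv HA).
  - intros x y; cbn; drop_id; rewrite <- (comp_idl (run (ih H x y))); apply sq_transpose_iff.
    rewrite transpose_can_tens, !transpose_id, <- can_mor_id, transpose_can_mor, comp_idl.
    rewrite (thom_split1 HL _ (munit L one)), !comp_assoc, <- (comp_assoc (run y)), (run_nat HL).
    now rewrite !comp_assoc, split_run.
  - cbn; intros; apply (br_nat HA).
  - cbn; intros; drop_id; apply (br_tens HA), sc_sym.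
  - cbn; drop_id; apply (br_one_tens HA).
  - intros [x y] [x' y']; cbn; drop_id; apply sq_transpose_iff.
    rewrite <- (comp_idr (can_tens H x x' y y')), <- (comp_idr (can_tens H y y' x x')).
    rewrite <- !(thom_id HA), !transpose_can_tens, !transpose_id.
    now rewrite <- comp_assoc, (br_nat HL), !comp_assoc, split_br.
  - apply can_und_braided.
Qed.

End CanonicalLaws.

(** * Braided functors between enriched braided categories *)

(** The underlying category of a product and the product of the underlying
    categories have the same data. *)
Definition und_prod {X Y : EBData} {C : BMData} (F : MonFun (und_bm (prod_eb X Y)) C) :
    MonFun (prod_bm (und_bm X) (und_bm Y)) C :=
  {| fob := fun z : prod_bm (und_bm X) (und_bm Y) => fob F z;
     fhom := fun x y (f : Hom x y) => @fhom _ _ F x y f;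
     f2 := fun x y => f2 F x y; f2i := fun x y => f2i F x y;
     f0 := f0 F; f0i := f0i F |}.

Lemma und_prod_law {X Y : EBData} {C : BMData} (F : MonFun (und_bm (prod_eb X Y)) C) :
  is_br_fun F -> is_br_fun (und_prod F).
Proof.
  intro HF; split; [split |].
  - exact (fhom_id HF).
  - exact (fun x y z => @fhom_comp _ _ _ HF x y z).
  - exact (f2_inv HF).
  - exact (f0_inv HF).
  - exact (fun x x' y y' => @f2_nat _ _ _ HF x x' y y').
  - exact (f2_ass HF).
  - exact (f2_lun HF).
  - exact (f2_run HF).
  - exact (f2_br HF).
Qed.

Definition one_eb (X : EBData) : EBFunData unit_eb X :=
  {| ebf := one_ef X : EnrFun unit_eb X;
     g2 := fun _ _ => el (@e1 X); g2i := fun _ _ => eli (@e1 X);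
     g0 := eid X e1; g0i := eid X e1 |}.

Lemma one_eb_law {X : EBData} (HX : is_eb X) : is_ebf (one_eb X).
Proof.
  pose proof (bc_law (eb_base X)) as HA; pose proof (eb_und HX) as HU.
  split.
  - split.
    + apply (one_mf_law HA).
    + intros []; cbn; now rewrite !comp_idr.
    + intros [] [] []; cbn.
      rewrite comp_idl, (thom_split1 HA), <- comp_assoc, ecomp_idl; symmetry.
      apply (lun_nat HA).
  - apply (one_mf_law HA).
  - split.
    + apply (f2_mon_nat (C := unit_bm) unit_is_braided HA (one_mf_law HA)).
    + intros [[] []] [[] []].
      change (sq (eth e1 e1 e1 e1 ∘ ((eid X e1 ∘ idm (@one (eb_base X)))
          ⊠ (eid X e1 ∘ idm (@one (eb_base X)))))
        (eid X e1 ∘ idm one) (lun one) (el e1) (el e1)).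
      rewrite comp_idr; apply (sq_lun HX).
  - split.
    + apply (f0_mon_nat HA (one_mf_law HA)).
    + intros [] [].
      change (sq (eid X e1) (eid X e1 ∘ idm (@one (eb_base X))) (idm one) (eid X e1) (eid X e1)).
      rewrite comp_idr; apply sq_id.
  - pose proof (one_mf_law HU) as HO.
    assert (E : forall x y (f : @Hom (und_bm unit_eb) x y),
        fhom (und_mf (one_eb X)) f = idm (@one (und_bm X)))
      by (intros [] [] []; cbn; unfold ufun; cbn; now rewrite !comp_idr).
    split; [split |].
    + intros []; apply E.
    + intros [] [] [] [] []; rewrite !E; symmetry; apply comp_idl.
    + intros [] []; exact (f2_inv HO tt tt).
    + exact (f0_inv HO).
    + intros [] [] [] [] [] []; rewrite !E; exact (@f2_nat _ _ _ HO tt tt tt tt tt tt).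
    + intros [] [] []; rewrite E; exact (f2_ass HO tt tt tt).
    + intros []; rewrite E; exact (f2_lun HO tt).
    + intros []; rewrite E; exact (f2_run HO tt).
    + intros [] []; rewrite E; exact (f2_br HO tt tt).
Qed.

Lemma und_comp_law {X Y V : EBData} (HV : is_braided (und_bm V)) (G : EBFunData Y V)
    (F : EBFunData X Y) :
  is_ebf G -> is_ebf F -> is_br_fun (und_mf (comp_eb G F)).
Proof.
  intros HG HF.
  refine (rehom_law (F := comp_mf (und_mf G) (und_mf F)) (h := fun _ _ _ => _) _
    (comp_mf_law HV (ebf_und HG) (ebf_und HF))).
  intros x y f; exact (ufun_comp_ef F (ebf_hat HG) f).
Qed.

(** A functor out of the unit category receives a natural transformation from the
    functor picking the unit, made of its own unit constraints. *)
Section FromUnit.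
Context {Y : EBData} (HY : is_eb Y) (F : EBFunData unit_eb Y).
Context (HF : is_enr_fun F) (HF' : is_mon_fun (und_mf F)).

Definition unit_hat (a : unit) : @Hom (eb_base Y) one (ef_hat F a) :=
  match a with tt => f0 (ef_hat F) end.

Definition unit_ob (a : unit) : @Hom (und_bm Y) one (F a) :=
  match a with tt => g0 F end.

Lemma unit_nat_law : @is_enr_nat _ _ _ _ (one_eb Y) F unit_hat unit_ob.
Proof.
  pose proof (bc_law (eb_base Y)) as HB.
  split; [exact (unit_mon_nat HB (ef_hat_law HF)) |].
  intros [] [].
  change (postc e1 (g0 F) ∘ eid Y e1 =
    prec (F tt) (g0 F) ∘ (ef_hom F tt tt ∘ f0 (ef_hat F))).
  pose proof (ef_id HF tt) as E.
  assert (E' : fhom (ef_hat F) (x := tt) (y := tt) tt = idm _)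
    by exact (fhom_id (ef_hat_law HF) tt).
  change (ef_hom F tt tt ∘ (fhom (ef_hat F) (x := tt) (y := tt) tt ∘ f0 (ef_hat F)) =
    eid Y (F tt)) in E.
  rewrite E', comp_idl in E; rewrite E, <- (comp_idr (eid Y (F tt))).
  exact (sq_mor (g0 F)).
Qed.

Lemma unit_nat_mon : @is_mon_nat _ _ (und_mf (one_eb Y)) (und_mf F) unit_ob.
Proof.
  pose proof (eb_und HY) as HU.
  assert (E : fhom (und_mf F) (x := tt) (y := tt) tt = idm _) by exact (fhom_id HF' tt).
  assert (E1 : @ufun _ _ unit_eb Y (one_eb Y) tt tt tt = @idm (und_bm Y) one)
    by (unfold ufun; cbn; now rewrite !comp_idr).
  split.
  - intros [] [] [].
    change (@comp (und_bm Y) _ _ _ (g0 F) (@ufun _ _ unit_eb Y (one_eb Y) tt tt tt) =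
      @comp (und_bm Y) _ _ _ (fhom (und_mf F) (x := tt) (y := tt) tt) (g0 F)).
    rewrite E, E1; exact (eq_trans (comp_idr (c := und_bm Y) _) (eq_sym (comp_idl (c := und_bm
        Y) _))).
  - intros [] []; pose proof (f0_lun HU HF') as K.
    refine (eq_trans (eq_sym K) (eq_trans (f_equal (fun k => @comp (und_bm Y) _ _ _ k _) E) _)).
    apply (comp_idl (c := und_bm Y)).
  - apply (comp_idr (c := und_bm Y)).
Qed.

Definition unit_nat : EBNat (one_eb Y) F :=
  @Build_EBNat _ _ (one_eb Y) F unit_hat unit_ob unit_nat_law unit_nat_mon.

Lemma unit_nat_iso : is_ebnat_iso unit_nat.
Proof.
  split; intros [].
  - exact (inv_iso (f0_inv (ef_hat_law HF))).
  - exact (inv_iso (f0_inv HF')).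
Qed.

End FromUnit.

Section Regular.
Context {X W : EBData} (HX : is_eb X) (HW : is_eb W).
Context (g : EBFunData (prod_eb W X) X) (Hg : is_ebf g).

Let HA : is_braided (eb_base X) := bc_law (eb_base X).
Let HB : is_braided (eb_base W) := bc_law (eb_base W).
Let HU : is_braided (und_bm X) := eb_und HX.
Let HV : is_braided (und_bm W) := eb_und HW.

Definition ghat : MonFun (prod_bm (eb_base W) (eb_base X)) (eb_base X) := ef_hat g.
Definition gund : MonFun (prod_bm (und_bm W) (und_bm X)) (und_bm X) := und_prod (und_mf g).

Lemma ghat_law : is_br_fun ghat.
Proof. exact (ebf_hat Hg). Qed.

Lemma gund_law : is_br_fun gund.
Proof. exact (und_prod_law (ebf_und Hg)). Qed.

Definition enr_hom (w w' : W) (x x' : X) :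
    Hom (ghat (ehom W w w', ehom X x x')) (ehom X (g (w, x)) (g (w', x'))) :=
  ef_hom g (w, x) (w', x').

(** The enriched action map on generalized elements of hom objects. *)
Definition enr_star {w w' : W} {x x' : X} {b a}
    (f : Hom b (ehom W w w')) (h : Hom a (ehom X x x')) :
    Hom (ghat (b, a)) (ehom X (g (w, x)) (g (w', x'))) :=
  enr_hom w w' x x' ∘ star ghat f h.

Lemma enr_star_comp {w w' : W} {x x' : X} {b a b' a'}
    (f : Hom b (ehom W w w')) (h : Hom a (ehom X x x')) (m : Hom b' b) (n : Hom a' a) :
  enr_star (f ∘ m) (h ∘ n) = enr_star f h ∘ star ghat m n.
Proof.
  unfold enr_star; rewrite comp_assoc; f_equal; symmetry; apply (star_comp ghat_law).
Qed.

Lemma enr_star_id (w w' : W) (x x' : X) :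
  enr_hom w w' x x' = enr_star (idm (ehom W w w')) (idm (ehom X x x')).
Proof. unfold enr_star; rewrite (star_id ghat_law); symmetry; apply comp_idr. Qed.

Lemma enr_star_eid (w : W) (x : X) :
  enr_star (eid W w) (eid X x) ∘ star0 ghat = eid X (g (w, x)).
Proof.
  unfold enr_star; rewrite comp_assoc; exact (ef_id (ebf_enr Hg) (w, x)).
Qed.

Lemma enr_star_ecomp {w w' w'' : W} {x x' x'' : X} {b a b' a'}
    (f' : Hom b' (ehom W w' w'')) (h' : Hom a' (ehom X x' x''))
    (f : Hom b (ehom W w w')) (h : Hom a (ehom X x x')) :
  ecomp X _ _ _ ∘ (enr_star f' h' ⊠ enr_star f h) =
  enr_star (ecomp W w w' w'' ∘ (f' ⊠ f)) (ecomp X x x' x'' ∘ (h' ⊠ h)) ∘ star2 ghat b' a' b a.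
Proof.
  assert (E := ef_comp (ebf_enr Hg) (w, x) (w', x') (w'', x'')).
  change (enr_hom w w'' x x'' ∘ (star ghat (ecomp W w w' w'') (ecomp X x x' x'')
      ∘ star2 ghat (ehom W w' w'') (ehom X x' x'') (ehom W w w') (ehom X x x')) =
    ecomp X (g (w, x)) (g (w', x')) (g (w'', x''))
      ∘ (enr_hom w' w'' x' x'' ⊠ enr_hom w w' x x')) in E.
  rewrite enr_star_comp; unfold enr_star at 1 2; rewrite (thom_comp HA), <- comp_assoc, <- E.
  rewrite !comp_assoc, (star_f2 ghat_law); unfold enr_star; now rewrite !comp_assoc.
Qed.

Lemma sq_star {w1 w2 w1' w2' : W} {x1 x2 x1' x2' : X} {b b' a a'}
    (f : Hom b (ehom W w1 w2)) (f' : Hom b' (ehom W w1' w2')) (m : Hom b b')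
    (k : @Hom (und_bm W) w1 w1') (l : @Hom (und_bm W) w2 w2')
    (h : Hom a (ehom X x1 x2)) (h' : Hom a' (ehom X x1' x2')) (n : Hom a a')
    (k' : @Hom (und_bm X) x1 x1') (l' : @Hom (und_bm X) x2 x2') :
  sq f f' m k l -> sq h h' n k' l' ->
  sq (enr_star f h) (enr_star f' h') (star ghat m n) (star gund k k') (star gund l l').
Proof. intros E E'; exact (sq_fun (ebf_enr Hg) (sq_pair E E')). Qed.

Lemma sq_star2 {w1 w2 w1' w2' : W} {x1 x2 x1' x2' : X} {b b' a a'}
    (f : Hom b (ehom W w1 w2)) (f' : Hom b' (ehom W w1' w2'))
    (h : Hom a (ehom X x1 x2)) (h' : Hom a' (ehom X x1' x2')) :
  sq (etens (enr_star f h) (enr_star f' h')) (enr_star (etens f f') (etens h h'))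
    (star2 ghat b a b' a') (star2 gund w1 x1 w1' x1') (star2 gund w2 x2 w2' x2').
Proof.
  assert (E : sq (etens (enr_star (idm (ehom W w1 w2)) (idm (ehom X x1 x2)))
        (enr_star (idm (ehom W w1' w2')) (idm (ehom X x1' x2'))))
      (enr_star (eth w1 w2 w1' w2') (eth x1 x2 x1' x2')) (star2 ghat _ _ _ _)
      (star2 gund w1 x1 w1' x1') (star2 gund w2 x2 w2' x2'))
    by exact (en_eq (ebf_2 Hg) ((w1, x1), (w1', x1')) ((w2, x2), (w2', x2'))).
  unfold etens at 2 3; rewrite enr_star_comp.
  rewrite <- (comp_idl f), <- (comp_idl f'), <- (comp_idl h), <- (comp_idl h').
  rewrite !enr_star_comp, etens_comp, !comp_idl.
  refine (sq_pre _ E); apply (star_f2 ghat_law).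
Qed.

Lemma gund_hom {w w' : W} {x x' : X} (f : @Hom (und_bm W) w w') (h : @Hom (und_bm X) x x') :
  star gund f h = enr_star f h ∘ star0 ghat.
Proof. unfold enr_star; rewrite comp_assoc; reflexivity. Qed.

Definition act_one_eb : EBFunData W X :=
  {| ebf := {| ef_hat := act_one ghat : MonFun (eb_base W) (eb_base X);
               ef_ob := fun w => g (w, e1);
               ef_hom := fun w w' => enr_star (idm (ehom W w w')) (eid X e1) |} : EnrFun W X;
     g2 := fun w w' => f2 (act_one gund) w w';
     g2i := fun w w' => f2i (act_one gund) w w';
     g0 := f0 (act_one gund); g0i := f0i (act_one gund) |}.

Lemma act_one_ufun {w w' : W} (f : @Hom (und_bm W) w w') :
  ufun act_one_eb f = fhom (act_one gund) f.
Proof.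
  transitivity (enr_star (idm (ehom W w w')) (eid X e1)
    ∘ (star ghat f (idm (@one (eb_base X))) ∘ star0 ghat)); [reflexivity |].
  rewrite <- comp_assoc, <- enr_star_comp, comp_idl, comp_idr.
  symmetry; exact (gund_hom f (idm (@one (und_bm X)))).
Qed.

Lemma act_one_eb_law : is_ebf act_one_eb.
Proof.
  pose proof (act_one_law HB HA ghat_law) as Hp.
  split.
  - split.
    + exact Hp.
    + intro w.
      change (enr_star (idm (ehom W w w)) (eid X e1)
        ∘ (star ghat (eid W w) (idm (@one (eb_base X))) ∘ star0 ghat) = eid X (g (w, e1))).
      rewrite <- comp_assoc, <- enr_star_comp, comp_idl, comp_idr; apply enr_star_eid.
    + intros w w' w''.
      change (enr_star (idm (ehom W w w'')) (eid X e1)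
          ∘ (star ghat (ecomp W w w' w'') (idm (@one (eb_base X)))
             ∘ (star ghat (idm _) (lun (@one (eb_base X)))
                ∘ star2 ghat (ehom W w' w'') one (ehom W w w') one)) =
        ecomp X _ _ _ ∘ (enr_star (idm (ehom W w' w'')) (eid X e1)
          ⊠ enr_star (idm (ehom W w w')) (eid X e1))).
      rewrite enr_star_ecomp, <- !comp_assoc, <- !enr_star_comp, !comp_idl, !comp_idr; f_equal.
      rewrite (thom_id HB), comp_idr; f_equal.
      rewrite (thom_split1 HA), <- comp_assoc, ecomp_idl; symmetry; apply (lun_nat HA).
  - exact Hp.
  - split; [exact (f2_mon_nat HB HA Hp) |].
    intros [w w'] [v v'].
    change (sq (eth (g (w, e1)) (g (v, e1)) (g (w', e1)) (g (v', e1))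
        ∘ ((enr_star (idm (ehom W w v)) (eid X e1) ∘ star ghat (idm (ehom W w v)) (idm (@one
            (eb_base X))))
           ⊠ (enr_star (idm (ehom W w' v')) (eid X e1)
              ∘ star ghat (idm (ehom W w' v')) (idm (@one (eb_base X))))))
      (enr_star (idm _) (eid X e1) ∘ star ghat (eth w v w' v') (idm (@one (eb_base X))))
      (star ghat (idm _) (lun (@one (eb_base X))) ∘ star2 ghat (ehom W w v) one (ehom W w' v')
          one)
      (star gund (idm (et w w' : und_bm W)) (lun (@one (und_bm X))) ∘ star2 gund w e1 w' e1)
      (star gund (idm (et v v' : und_bm W)) (lun (@one (und_bm X))) ∘ star2 gund v e1 v' e1)).
    rewrite !(star_id ghat_law), !comp_idr, <- enr_star_comp, comp_idl, comp_idr.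
    refine (sq_vert (sq_star2 (idm _) (idm _) (eid X e1) (eid X e1)) _).
    rewrite !etens_id.
    refine (sq_star (sq_id _) _).
    apply (sq_lun HX).
  - split; [exact (f0_mon_nat HA Hp) |].
    intros [] [].
    change (sq (eid X e1) (enr_star (idm _) (eid X e1) ∘ star ghat (eid W e1) (idm (@one
        (eb_base X))))
      (star0 ghat) (star0 gund) (star0 gund)).
    rewrite <- enr_star_comp, comp_idl, comp_idr.
    assert (E : sq (eid X e1) (enr_star (eid W e1) (eid X e1)) (star0 ghat)
      (star0 gund) (star0 gund)) by exact (en_eq (ebf_0 Hg) tt tt).
    exact E.
  - pose proof (act_one_law HV HU gund_law) as Hu.
    refine (rehom_law (F := act_one gund) (h := fun _ _ _ => _) _ Hu).
    intros w w' f; apply act_one_ufun.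
Qed.

End Regular.

(** * The regular action of the transparent objects *)

Section RegularAction.
Context {X : EBData} (HX : is_eb X).
Context (P : X -> Prop) (P_tens : forall x y, P x -> P y -> P (et x y)) (P_one : P e1).

Notation A := (eb_base X).
Let HA : is_braided A := bc_law A.
Let HU : is_braided (und_bm X) := eb_und HX.

(** P is kept abstract so that transparency may be expressed in any presentation of
    the underlying braided category. *)
Definition full_enr : EnrCat A :=
  {| eob := {x : X | P x};
     ehom := fun x y => ehom X (proj1_sig x) (proj1_sig y);
     eid := fun x => eid X (proj1_sig x);
     ecomp := fun x y z => ecomp X (proj1_sig x) (proj1_sig y) (proj1_sig z);
     ecomp_idl := fun x y => ecomp_idl (proj1_sig x) (proj1_sig y);
     ecomp_idr := fun x y => ecomp_idr (proj1_sig x) (proj1_sig y);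
     ecomp_assoc := fun x y z w =>
       ecomp_assoc (proj1_sig x) (proj1_sig y) (proj1_sig z) (proj1_sig w) |}.

Definition full_eb : EBData :=
  {| eb_base := A; eb_cat := full_enr;
     et := fun x y : full_enr => exist P (et (proj1_sig x) (proj1_sig y))
       (P_tens (proj2_sig x) (proj2_sig y)) : full_enr;
     eth := fun x x' y y' : full_enr =>
       eth (proj1_sig x) (proj1_sig x') (proj1_sig y) (proj1_sig y');
     e1 := exist P e1 P_one : full_enr;
     ea := fun x y z : full_enr => ea (proj1_sig x) (proj1_sig y) (proj1_sig z);
     eai := fun x y z : full_enr => eai (proj1_sig x) (proj1_sig y) (proj1_sig z);
     el := fun x : full_enr => el (proj1_sig x);
     eli := fun x : full_enr => eli (proj1_sig x);
     er := fun x : full_enr => er (proj1_sig x);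
     eri := fun x : full_enr => eri (proj1_sig x);
     ec := fun x y : full_enr => ec (proj1_sig x) (proj1_sig y);
     eci := fun x y : full_enr => eci (proj1_sig x) (proj1_sig y) |}.

Notation Z := full_eb.

Definition incl_ob (z : Z) : X := proj1_sig z.

Context (HZ : is_eb Z).
Context (P_transparent : forall x : X, P x <-> transparent (C := und_bm X) x).

Definition reg_eb : EBFunData (prod_eb Z X) X :=
  {| ebf := {| ef_hat := tens_mf A : MonFun (prod_sym A A) A;
               ef_ob := fun z : prod_enr Z X => et (incl_ob (fst z)) (snd z) : X;
               ef_hom := fun z z' : prod_enr Z X =>
                 @eth X (incl_ob (fst z)) (incl_ob (fst z')) (snd z) (snd z') |}
             : EnrFun (prod_eb Z X) X;
     g2 := fun z z' : prod_enr Z X =>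
       @swap_mid (und_bm X) (incl_ob (fst z)) (snd z) (incl_ob (fst z')) (snd z');
     g2i := fun z z' : prod_enr Z X =>
       @swap_midi (und_bm X) (incl_ob (fst z)) (snd z) (incl_ob (fst z')) (snd z');
     g0 := @luni (und_bm X) one; g0i := @lun (und_bm X) one |}.

(** Transparency of the first variable makes the tensor product of the underlying
    category braided. *)
Lemma reg_eb_law : is_ebf reg_eb.
Proof.
  pose (i := fun z : prod_enr Z X => (incl_ob (fst z), snd z) : prod_enr X X).
  split.
  - split.
    + apply (tens_mon HA).
    + exact (fun z => ef_id (eb_tens HX) (i z)).
    + exact (fun x y z => ef_comp (eb_tens HX) (i x) (i y) (i z)).
  - apply sym_tens_law.
  - split; [exact (f2_mon_nat (prod_is_braided HA HA) HA (sym_tens_law A)) |].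
    intros [[x x'] [y y']] [[z z'] [w w']].
    change (sq (etens (@eth X (incl_ob x) (incl_ob z) x' z'
           ∘ (idm (ehom X (incl_ob x) (incl_ob z)) ⊠ idm (ehom X x' z')))
        (@eth X (incl_ob y) (incl_ob w) y' w' ∘ (idm (ehom X (incl_ob y) (incl_ob w)) ⊠ idm
            (ehom X y' w'))))
      (etens (@eth X (incl_ob x) (incl_ob z) (incl_ob y) (incl_ob w)) (@eth X x' z' y' w'))
      (swap_mid (ehom X (incl_ob x) (incl_ob z)) (ehom X x' z')
         (ehom X (incl_ob y) (incl_ob w)) (ehom X y' w'))
      (@swap_mid (und_bm X) (incl_ob x) x' (incl_ob y) y') (@swap_mid (und_bm X) (incl_ob z)
          z' (incl_ob w) w')).
    rewrite !(thom_id HA), !comp_idr, <- !(etens_id (X := X)).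
    apply (sq_swap HX).
  - split; [exact (f0_mon_nat HA (tens_mon HA)) |].
    intros [] []; exact (sq_luni HX (eid X e1)).
  - pose proof (tens_mon HU) as HT.
    pose (j := fun z : und_bm (prod_eb Z X) => (incl_ob (fst z), snd z) : prod_bm (und_bm X)
        (und_bm X)).
    split; [split |].
    + exact (fun z => fhom_id HT (j z)).
    + exact (fun x y z g f => @fhom_comp _ _ _ HT (j x) (j y) (j z) g f).
    + exact (fun x y => f2_inv HT (j x) (j y)).
    + exact (f0_inv HT).
    + exact (fun x x' y y' f g => @f2_nat _ _ _ HT (j x) (j x') (j y) (j y') f g).
    + exact (fun x y z => f2_ass HT (j x) (j y) (j z)).
    + exact (fun x => f2_lun HT (j x)).
    + exact (fun x => f2_run HT (j x)).
    + intros [x x'] [y y'].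
      refine (@tens_br _ HU (incl_ob x) x' (incl_ob y) y' _).
      exact (proj1 (P_transparent (incl_ob x)) (proj2_sig x) y').
Qed.

Lemma reg_alpha_law :
  is_enr_nat (comp_eb reg_eb (times_id (one_eb Z) X)) (snd_eb unit_eb X)
    (fun a : eb_base (prod_eb unit_eb X) => @lun A (snd a))
    (fun x : prod_eb unit_eb X => @el X (snd x)).
Proof.
  split; [split |].
  - intros [[] a] [[] b] [[] f]; exact (lun_nat HA f).
  - intros [[] a] [[] b]; cbn; rewrite ?(thom_id HA), ?comp_idl, ?comp_idr.
    apply (lun_tens HA).
  - cbn; repeat rewrite ?(thom_id HA), ?comp_idl, ?comp_idr; apply (lun_inv HA).
  - intros [[] x] [[] y].
    change (sq (eth e1 e1 x y ∘ ((eid X e1 ∘ idm (@one A)) ⊠ idm (ehom X x y)))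
      (idm (ehom X x y)) (lun (ehom X x y)) (el x) (el y)).
    rewrite comp_idr; apply (sq_lun HX).
Qed.

Lemma reg_alpha_mon :
  @is_mon_nat _ _ (und_mf (comp_eb reg_eb (times_id (one_eb Z) X))) (und_mf (snd_eb unit_eb X))
    (fun x : prod_eb unit_eb X => @el X (snd x)).
Proof.
  assert (E : @ufun _ _ unit_eb Z (one_eb Z) tt tt tt = @idm (und_bm X) one)
    by (unfold ufun; cbn; now rewrite !comp_idr).
  split.
  - intros [[] x] [[] y] [[] f].
    change (@comp (und_bm X) _ _ _ (@lun (und_bm X) y)
       (@ufun _ _ (prod_eb unit_eb X) X (comp_eb reg_eb (times_id (one_eb Z) X)) (tt, x) (tt, y)
          (tt, f)) =
      @comp (und_bm X) _ _ _ (idm (ehom X x y) ∘ (f ∘ idm one)) (@lun (und_bm X) x)).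
    rewrite comp_idl, comp_idr.
    refine (eq_trans (f_equal (fun k => @comp (und_bm X) _ _ _ (@lun (und_bm X) y) k)
      (@ufun_comp_times _ _ _ _ reg_eb (one_eb Z) (tens_mon HA) (one_mf_law HA)
        tt tt x y tt f)) _).
    rewrite E; exact (lun_nat HU f).
  - intros [[] x] [[] y].
    change (@comp (und_bm X) _ _ _ (lun (@tob (und_bm X) x y))
      (@comp (und_bm X) _ _ _
        (@thom (und_bm X) _ _ _ _
          (@comp (und_bm X) _ _ _ (@ufun _ _ unit_eb Z (one_eb Z) tt tt tt) (lun (@one (und_bm
            X))))
          (idm (@tob (und_bm X) x y)))
        (@swap_mid (und_bm X) one x one y)) =
      @comp (und_bm X) _ _ _ (idm (@tob (und_bm X) x y)) (@lun (und_bm X) x ⊠ @lun (und_bm X) y)).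
    rewrite E, !comp_idl; apply (lun_tens HU).
  - change (@comp (und_bm X) _ _ _ (lun (@one (und_bm X)))
      (@comp (und_bm X) _ _ _
        (@thom (und_bm X) _ _ _ _
          (@comp (und_bm X) _ _ _ (@ufun _ _ unit_eb Z (one_eb Z) tt tt tt) (idm (@one (und_bm
            X))))
          (idm (@one (und_bm X))))
        (luni (@one (und_bm X)))) = idm (@one (und_bm X))).
    rewrite E, comp_idl, (thom_id HU), comp_idl; apply (lun_inv HU).
Qed.

Definition reg_alpha :
    EBNat (comp_eb reg_eb (times_id (one_eb Z) X)) (snd_eb unit_eb X) :=
  @Build_EBNat _ _ (comp_eb reg_eb (times_id (one_eb Z) X)) (snd_eb unit_eb X)
    (fun a : eb_base (prod_eb unit_eb X) => @lun A (snd a))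
    (fun x : prod_eb unit_eb X => @el X (snd x)) reg_alpha_law reg_alpha_mon.

Lemma reg_alpha_iso : is_ebnat_iso reg_alpha.
Proof.
  split.
  - intros [[] a]; exact (inv_iso (lun_inv HA a)).
  - intros [[] x]; exact (inv_iso (lun_inv HU x)).
Qed.

Definition regular : UnitalAction X Z :=
  {| act_u := {| ebf_data := one_eb Z; ebf_law := one_eb_law HZ |};
     act_g := {| ebf_data := reg_eb; ebf_law := reg_eb_law |};
     act_alpha := reg_alpha; act_alpha_iso := reg_alpha_iso |}.

Definition corestrict {W : EBData} (F : EBFunData W X) (PF : forall w, P (F w)) : EBFunData W Z :=
  {| ebf := {| ef_hat := ef_hat F : MonFun (eb_base W) (eb_base Z);
               ef_ob := fun w => exist P (F w) (PF w) : Z;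
               ef_hom := fun w w' => ef_hom F w w' |} : EnrFun W Z;
     g2 := fun w w' => g2 F w w'; g2i := fun w w' => g2i F w w';
     g0 := g0 F; g0i := g0i F |}.

Lemma corestrict_law {W : EBData} (F : EBFunData W X) (PF : forall w, P (F w)) :
  is_ebf F -> is_ebf (corestrict (F := F) PF).
Proof.
  intro HF; split.
  - pose proof (ebf_enr HF) as E; split; [exact (ef_hat_law E) | exact (ef_id E) | exact
      (ef_comp E)].
  - exact (ebf_hat HF).
  - split; [exact (en_hat_law (ebf_2 HF)) | exact (en_eq (ebf_2 HF))].
  - split; [exact (en_hat_law (ebf_0 HF)) | exact (en_eq (ebf_0 HF))].
  - pose proof (ebf_und HF) as E; split; [split |].
    + exact (fhom_id E).
    + exact (@fhom_comp _ _ _ E).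
    + exact (f2_inv E).
    + exact (f0_inv E).
    + exact (@f2_nat _ _ _ E).
    + exact (f2_ass E).
    + exact (f2_lun E).
    + exact (f2_run E).
    + exact (f2_br E).
Qed.

(** Underlying functor, followed by the inclusion. *)
Definition und_out {W : EBData} (F : EBFunData W Z) : MonFun (und_bm W) (und_bm X) :=
  {| fob := fun w : und_bm W => incl_ob (F w) : und_bm X;
     fhom := fun w w' f => @fhom _ _ (und_mf F) w w' f;
     f2 := fun w w' => g2 F w w'; f2i := fun w w' => g2i F w w';
     f0 := g0 F; f0i := g0i F |}.

Lemma und_out_law {W : EBData} (F : EBFunData W Z) : is_ebf F -> is_br_fun (und_out F).
Proof.
  intro HF; pose proof (ebf_und HF) as E; split; [split |].
  - exact (fhom_id E).
  - exact (@fhom_comp _ _ _ E).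
  - exact (f2_inv E).
  - exact (f0_inv E).
  - exact (@f2_nat _ _ _ E).
  - exact (f2_ass E).
  - exact (f2_lun E).
  - exact (f2_run E).
  - exact (f2_br E).
Qed.

End RegularAction.

Arguments rho : simpl never.
Arguments ucomp : simpl never.

(** Simplifying both statements first keeps functors out of their types: comparing
    such functors directly would unfold product categories. *)
Ltac exact_cbn K :=
  let t := type of K in
  let t' := eval cbn in t in
  let K' := fresh in
  assert (K' : t') by exact K;
  lazymatch goal with
  | |- ?c => let c' := eval cbn in c in cut c'; [exact (fun k => k) | exact K']
  end.

(** * Action morphisms into the regular action, background and underlying *)

Section UnitalActions.
Context {X W : EBData} (HX : is_eb X) (HW : is_eb W) (S : UnitalAction X W).

Notation A := (eb_base X).
Notation B := (eb_base W).
Let HA : is_braided A := bc_law A.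
Let HB : is_braided B := bc_law B.
Let HU : is_braided (und_bm X) := eb_und HX.
Let HV : is_braided (und_bm W) := eb_und HW.

Notation g := (ebf_data (act_g S)).
Notation u := (ebf_data (act_u S)).
Let Hg : is_ebf g := ebf_law (act_g S).
Let Hu : is_ebf u := ebf_law (act_u S).

Definition uhat : B := ef_hat u tt.
Definition uhat0 : Hom one uhat := f0 (ef_hat u).
Definition uhat0i : Hom uhat one := f0i (ef_hat u).
Definition uhat2 : Hom (uhat ⊗ uhat) uhat := f2 (ef_hat u) tt tt.
Definition ahat (a : A) : Hom (ghat g (uhat, a)) a := nhat (act_alpha S) (tt, a).

Lemma ahat_iso (a : A) : is_iso (ahat a).
Proof. exact (proj1 (act_alpha_iso S) (tt, a)). Qed.

Definition ahati (a : A) : Hom a (ghat g (uhat, a)) := inv_of (ahat_iso a).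

Lemma hat_unital_action : is_unital_action (G := ghat g) uhat0 uhat0i uhat2 ahat ahati.
Proof.
  pose proof (ebf_hat Hu) as Hh.
  assert (E : fhom (ef_hat u) (x := tt) (y := tt) tt = idm uhat) by exact (fhom_id Hh tt).
  pose proof (en_hat_law (nlaw (act_alpha S))) as Ha.
  split.
  - exact (f0_inv Hh).
  - pose proof (f2_run Hh tt) as K.
    change (@fhom _ _ (ef_hat u) tt tt tt ∘ (uhat2 ∘ (idm uhat ⊠ uhat0)) = run uhat) in K.
    now rewrite E, comp_idl in K.
  - intro a; apply inv_of_spec.
  - intros a b h; pose proof (@mn_nat _ _ _ _ _ Ha (tt, a) (tt, b) (tt, h)) as K.
    change (ahat b ∘ star (ghat g) (@fhom _ _ (ef_hat u) tt tt tt) h = h ∘ ahat a) in K.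
    now rewrite E in K.
  - intros a b; pose proof (mn_2 Ha (tt, a) (tt, b)) as K.
    change (ahat (a ⊗ b) ∘ (star (ghat g) (@fhom _ _ (ef_hat u) tt tt tt ∘ uhat2) (idm (a ⊗ b))
      ∘ star2 (ghat g) uhat a uhat b) = idm (a ⊗ b) ∘ (ahat a ⊠ ahat b)) in K.
    now rewrite E, !comp_idl in K.
  - pose proof (mn_0 Ha) as K.
    change (ahat one ∘ (star (ghat g) (@fhom _ _ (ef_hat u) tt tt tt ∘ uhat0) (idm (@one A))
      ∘ star0 (ghat g)) = idm (@one A)) in K.
    now rewrite E, !comp_idl in K.
Qed.

Definition uu : und_bm W := u tt.
Definition uu0 : @Hom (und_bm W) one uu := g0 u.
Definition uu0i : @Hom (und_bm W) uu one := g0i u.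
Definition uu2 : @Hom (und_bm W) (uu ⊗ uu) uu := g2 u tt tt.
Definition aund (x : und_bm X) : @Hom (und_bm X) (gund g (uu, x)) x := act_alpha S (tt, x).

Lemma aund_iso (x : und_bm X) : is_iso (aund x).
Proof. exact (proj2 (act_alpha_iso S) (tt, x)). Qed.

Definition aundi (x : und_bm X) : @Hom (und_bm X) x (gund g (uu, x)) := inv_of (aund_iso x).

Lemma und_unital_action : is_unital_action (G := gund g) uu0 uu0i uu2 aund aundi.
Proof.
  pose proof (ebf_und Hu) as Hh.
  assert (E : @ufun _ _ unit_eb W u tt tt tt = idm uu) by exact (fhom_id Hh tt).
  pose proof (nmon (act_alpha S)) as Ha.
  split.
  - exact (f0_inv Hh).
  - pose proof (f2_run Hh tt) as K.
    change (@comp (und_bm W) _ _ _ (@ufun _ _ unit_eb W u tt tt tt)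
      (uu2 ∘ (idm uu ⊠ uu0)) = run uu) in K.
    now rewrite E, comp_idl in K.
  - intro a; apply inv_of_spec.
  - intros x y h; pose proof (@mn_nat _ _ _ _ _ Ha (tt, x) (tt, y) (tt, h)) as K.
    change (@comp (und_bm X) _ _ _ (aund y)
      (@ufun _ _ (prod_eb unit_eb X) X (comp_eb g (times_id u X)) (tt, x) (tt, y) (tt, h)) =
      @comp (und_bm X) _ _ _ (@comp A _ _ _ (idm (ehom X x y)) (@comp A _ _ _ h (idm (@one
          A)))) (aund x)) in K.
    rewrite comp_idl, comp_idr in K; rewrite <- K; f_equal; symmetry.
    refine (eq_trans (@ufun_comp_times _ _ _ _ g u (ebf_hat Hg) (ebf_hat Hu) tt tt x y tt h) _).
    rewrite E; reflexivity.
  - intros x y; pose proof (mn_2 Ha (tt, x) (tt, y)) as K.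
    rewrite (comp_times_f2 g (ebf_enr Hu)) in K.
    refine (eq_trans K _); apply (comp_idl (c := und X)).
  - pose proof (mn_0 Ha) as K.
    rewrite (comp_times_f0 g (ebf_enr Hu)) in K.
    exact K.
Qed.

Context (P : X -> Prop) (P_tens : forall x y, P x -> P y -> P (et x y)) (P_one : P e1).
Notation Z := (full_eb P_tens P_one).
Context (HZ : is_eb Z).
Context (P_transparent : forall x : X, P x <-> transparent (C := und_bm X) x).

Notation T := (regular HX HZ P_transparent).
Notation R := (reg_eb P_tens P_one).

Section ActionMorphism.
Context (p : ActHom S T).

Let Hp : is_ebf (ah_p p) := ebf_law (ah_p p).

Definition phat : MonFun B A := ef_hat (ah_p p).
Definition pund : MonFun (und_bm W) (und_bm X) := und_out (ah_p p).

Lemma phat_law : is_br_fun phat.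
Proof. exact (ebf_hat Hp). Qed.

Lemma pund_law : is_br_fun pund.
Proof. exact (und_out_law Hp). Qed.

Definition rhat (b : B) (a : A) : Hom (phat b ⊗ a) (ghat g (b, a)) := nhat (ah_rho p) (b, a).
Definition shat : Hom one (phat uhat) := nhat (ah_sigma p) tt.

Lemma hat_action_map : is_action_map (G := ghat g) ahat rhat shat.
Proof.
  pose proof (en_hat_law (nlaw (ah_rho p))) as Hr.
  pose proof phat_law as Hh.
  split.
  - intros b a; exact (proj1 (ah_rho_iso p) (b, a)).
  - exact (proj1 (ah_sigma_iso p) tt).
  - intros b b' a a' f h; exact (@mn_nat _ _ _ _ _ Hr (b, a) (b', a') (f, h)).
  - intros b b' a a'; pose proof (mn_2 Hr (b, a) (b', a')) as K.
    change (rhat (b ⊗ b') (a ⊗ a') ∘ (((fhom phat (idm (b ⊗ b')) ∘ f2 phat b b')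
      ⊠ idm (a ⊗ a')) ∘ swap_mid (phat b) a (phat b') a') =
      star2 (ghat g) b a b' a' ∘ (rhat b a ⊠ rhat b' a')) in K.
    now rewrite (fhom_id Hh), comp_idl in K.
  - pose proof (mn_0 Hr) as K.
    change (rhat one one ∘ (((fhom phat (idm (@one B)) ∘ f0 phat) ⊠ idm (@one A))
      ∘ luni (@one A)) = star0 (ghat g)) in K.
    now rewrite (fhom_id Hh), comp_idl in K.
  - intro a; exact (proj1 (ah_coherent p) a).
Qed.

Definition rund (w : und_bm W) (x : und_bm X) :
    @Hom (und_bm X) (pund w ⊗ x) (gund g (w, x)) := ah_rho p (w, x).
Definition sund : @Hom (und_bm X) one (pund uu) := ah_sigma p tt.

Lemma und_action_map : is_action_map (G := gund g) aund rund sund.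
Proof.
  pose proof (nmon (ah_rho p)) as Hr.
  split.
  - intros w x; exact (proj2 (ah_rho_iso p) (w, x)).
  - destruct (proj2 (ah_sigma_iso p) tt) as [i [K K']]; exists i; split; [exact K | exact K'].
  - intros w w' x x' f h; pose proof (@mn_nat _ _ _ _ _ Hr (w, x) (w', x') (f, h)) as K.
    assert (E : @fhom _ _ (und_mf (comp_eb (act_g T) (times_id (ah_p p) X))) (w, x) (w', x')
        (f, h) =
        @thom (und_bm X) (pund w) (pund w') x x' (fhom pund f) h)
      by exact (@ufun_comp_times _ _ _ _ (act_g T) (ah_p p) (tens_mon HA) (ebf_hat Hp)
        w w' x x' f h).
    rewrite E in K; unfold star, rund; exact_cbn K.
  - intros w w' x x'; pose proof (mn_2 Hr (w, x) (w', x')) as K.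
    rewrite (comp_times_f2 (act_g T) (ebf_enr Hp)) in K.
    unfold star2, rund, swap_mid; exact_cbn K.
  - pose proof (mn_0 Hr) as K.
    rewrite (comp_times_f0 (act_g T) (ebf_enr Hp)) in K.
     unfold star0, rund; exact_cbn K.
  - intro x; exact (proj2 (ah_coherent p) x).
Qed.

Definition p_enr (w w' : W) :
    @Hom A (phat (ehom W w w')) (ehom X (pund w) (pund w')) :=
  ef_hom (ah_p p) w w'.

Lemma sq_rho {w w' : W} {x x' : X} {b : B} {a : A} (f : Hom b (ehom W w w'))
    (h : Hom a (ehom X x x')) :
  sq (etens (p_enr w w' ∘ fhom phat f) h) (enr_star g f h) (rhat b a)
    (rund w x) (rund w' x').
Proof.
  pose proof (en_eq (nlaw (ah_rho p)) (w, x) (w', x')) as K.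
  change (sq (@eth X (pund w) (pund w') x x'
      ∘ ((p_enr w w' ∘ fhom phat (idm (ehom W w w'))) ⊠ idm (ehom X x x')))
    (enr_hom g w w' x x') (rhat (ehom W w w') (ehom X x x')) (rund w x) (rund w' x')) in K.
  rewrite (fhom_id phat_law), comp_idr in K.
  unfold enr_star; rewrite <- (comp_idl h) at 1; rewrite etens_comp.
  exact (sq_pre (am_nat hat_action_map f h) K).
Qed.

End ActionMorphism.

Section Comparison.
Context (p q : ActHom S T).

Let Hp : is_mon_fun (phat p) := phat_law p.
Let Hq : is_mon_fun (phat q) := phat_law q.
Let Hp' : is_mon_fun (pund p) := pund_law p.
Let Hq' : is_mon_fun (pund q) := pund_law q.

Definition rhati (b : B) (a : A) : Hom (ghat g (b, a)) (phat q b ⊗ a) :=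
  inv_of (am_iso (hat_action_map q) b a).
Definition rundi (w : und_bm W) (x : und_bm X) :
    @Hom (und_bm X) (gund g (w, x)) (pund q w ⊗ x) := inv_of (am_iso (und_action_map q) w x).

Lemma rhati_inv (b : B) (a : A) : is_inverse (rhat q b a) (rhati b a).
Proof. apply inv_of_spec. Qed.

Lemma rundi_inv (w : und_bm W) (x : und_bm X) : is_inverse (rund q w x) (rundi w x).
Proof. apply inv_of_spec. Qed.

Definition xihat (b : B) : Hom (phat p b) (phat q b) := xi (rhat p) rhati b.
Definition xiund (w : und_bm W) : @Hom (und_bm X) (pund p w) (pund q w) := xi (rund p) rundi w.

(** xi is composed of natural isomorphisms, evaluated at the unit object of X. *)
Lemma sq_xi (w w' : W) :
  sq (p_enr p w w') (p_enr q w w') (xihat (ehom W w w')) (xiund w) (xiund w').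
Proof.
  assert (Ep : sq (etens (p_enr p w w') (eid X e1)) (enr_star g (idm (ehom W w w')) (eid X e1))
      (rhat p (ehom W w w') one) (rund p w e1) (rund p w' e1)).
  { pose proof (sq_rho p (idm (ehom W w w')) (eid X e1)) as K.
    now rewrite (fhom_id Hp), comp_idr in K. }
  assert (Eq : sq (etens (p_enr q w w') (eid X e1)) (enr_star g (idm (ehom W w w')) (eid X e1))
      (rhat q (ehom W w w') one) (rund q w e1) (rund q w' e1)).
  { pose proof (sq_rho q (idm (ehom W w w')) (eid X e1)) as K.
    now rewrite (fhom_id Hq), comp_idr in K. }
  assert (Eq' := sq_inv (rhati_inv (ehom W w w') one) (rundi_inv w e1) (rundi_inv w' e1) Eq).
  exact (sq_vert (sq_vert (sq_vert (sq_runi HX (p_enr p w w')) Ep) Eq') (sq_run HX (p_enr q w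
      w'))).
Qed.

Lemma xi_law : @is_enr_nat _ _ W Z (ah_p p) (ah_p q) xihat xiund.
Proof.
  split; [split |].
  - exact (fun b b' f => xi_nat HA (hat_action_map p) (hat_action_map q) rhati_inv f).
  - exact (xi_2 HA Hp Hq (hat_action_map p) (hat_action_map q) rhati_inv).
  - exact (xi_0 HA (hat_action_map p) (hat_action_map q) rhati_inv).
  - exact sq_xi.
Qed.

Lemma xi_mon : @is_mon_nat _ _ (und_mf (ah_p p)) (und_mf (ah_p q)) xiund.
Proof.
  split.
  - exact (fun w w' f => xi_nat HU (und_action_map p) (und_action_map q) rundi_inv f).
  - exact (xi_2 HU Hp' Hq' (und_action_map p) (und_action_map q) rundi_inv).
  - exact (xi_0 HU (und_action_map p) (und_action_map q) rundi_inv).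
Qed.

Definition xi_eb : EBNat (ah_p p) (ah_p q) :=
  @Build_EBNat _ _ (ah_p p) (ah_p q) xihat xiund xi_law xi_mon.

Lemma xi_eb_2mor : is_act_2mor p q xi_eb.
Proof.
  split; split.
  - exact (xi_unit HA hat_unital_action (hat_action_map p) (hat_action_map q) rhati_inv).
  - exact (xi_unit HU und_unital_action (und_action_map p) (und_action_map q) rundi_inv).
  - exact (xi_all HB HA hat_unital_action Hp Hq (hat_action_map p) (hat_action_map q) rhati_inv).
  - exact (xi_all HV HU und_unital_action Hp' Hq' (und_action_map p) (und_action_map q)
      rundi_inv).
Qed.

Lemma xi_eb_unique (z : EBNat (ah_p p) (ah_p q)) : is_act_2mor p q z -> ebnat_eq z xi_eb.
Proof.
  intros [_ [E E']]; split.
  - exact (xi_unique HA (hat_action_map q) rhati_inv E).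
  - exact (@xi_unique _ _ HU _ _ _ (pund p) (pund q) (rund p) _ _ (und_action_map q) _ rundi_inv
      (fun w => z w) E').
Qed.

End Comparison.

Section Existence.

Lemma act_one_transparent (w : W) : P (act_one_eb g w).
Proof. apply P_transparent, (action_transparent HV HU (gund_law Hg) und_unital_action w). Qed.

Definition med_p : EBFun W Z :=
  {| ebf_data := corestrict P_tens P_one act_one_transparent;
     ebf_law := corestrict_law P_tens P_one act_one_transparent (act_one_eb_law HX HW Hg) |}.

Let Hp : is_ebf med_p := ebf_law med_p.

Let Hpu : is_enr_fun (comp_eb med_p u) := comp_ef_law (ebf_enr Hp) (ebf_enr Hu).
Let Hpu' : is_mon_fun (und_mf (comp_eb med_p u)) := und_comp_law (eb_und HZ) Hp Hu.

Definition med_sigma : EBNat (act_u T) (comp_eb med_p u) := unit_nat HZ Hpu Hpu'.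

Definition med_hat (z : eb_base (prod_eb W X)) :
    @Hom A (ef_hat (comp_eb R (times_id med_p X)) z) (ef_hat g z) :=
  match z with (b, a) => rho (G := ghat g) uhat0i ahati b a end.

Definition med_und (z : prod_eb W X) :
    @Hom (und_bm X) (comp_eb R (times_id med_p X) z) (g z) :=
  match z with (w, x) => rho (G := gund g) uu0i aundi w x end.

Let Oh := rho_action_map HB HA (ghat_law Hg) hat_unital_action.
Let Ou := rho_action_map HV HU (gund_law Hg) und_unital_action.

Definition u_enr : Hom uhat (ehom W uu uu) := ef_hom u tt tt.

Lemma sq_unit0 : sq u_enr (eid W e1) uhat0i uu0i uu0i.
Proof.
  pose proof (ebf_hat Hu) as Hh.
  apply (sq_inv (f0_inv Hh) (f0_inv (ebf_und Hu)) (f0_inv (ebf_und Hu))).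
  pose proof (en_eq (ebf_0 Hu) tt tt) as K.
  assert (E : fhom (ef_hat u) (x := tt) (y := tt) tt = idm uhat) by exact (fhom_id Hh tt).
  change (sq (eid W e1) (u_enr ∘ fhom (ef_hat u) (x := tt) (y := tt) tt) uhat0 uu0 uu0) in K.
  rewrite E, comp_idr in K; exact K.
Qed.

Lemma sq_alpha {x x' : X} {a : A} (h : Hom a (ehom X x x')) :
  sq h (enr_star g u_enr h) (ahati a) (aundi x) (aundi x').
Proof.
  refine (sq_inv (un_inv hat_unital_action a) (un_inv und_unital_action x) (un_inv
      und_unital_action x') _).
  pose proof (ebf_hat Hu) as Hh.
  assert (E : fhom (ef_hat u) (x := tt) (y := tt) tt = idm uhat) by exact (fhom_id Hh tt).
  pose proof (en_eq (nlaw (act_alpha S)) (tt, x) (tt, x')) as K.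
  change (sq (enr_hom g uu uu x x' ∘ star (ghat g) (u_enr ∘ fhom (ef_hat u) (x := tt) (y :=
      tt) tt)
    (idm (ehom X x x'))) (idm (ehom X x x')) (ahat (ehom X x x')) (aund x) (aund x')) in K.
  rewrite E, comp_idr in K.
  rewrite <- (comp_idr u_enr), <- (comp_idl h), (enr_star_comp Hg).
  exact (sq_pre (un_nat hat_unital_action h) K).
Qed.

(** The naturality square of rho is pasted from those of the inverse of alpha, the
    structure morphism of g, and g applied to the unit isomorphisms. *)
Lemma med_rho_law : @is_enr_nat _ _ (prod_eb W X) X (comp_eb R (times_id med_p X)) g
  med_hat med_und.
Proof.
  pose proof (ebf_hat Hp) as Hh.
  split; [split |].
  - intros [b a] [b' a'] [f h]; exact (am_nat Oh f h).
  - intros [b a] [b' a'].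
    change (rho (G := ghat g) uhat0i ahati (b ⊗ b') (a ⊗ a') ∘ (((fhom (act_one (ghat g)) (idm
        (b ⊗ b')) ∘ f2 (act_one (ghat g)) b b')
      ⊠ idm (a ⊗ a')) ∘ swap_mid (act_one (ghat g) b) a (act_one (ghat g) b') a') =
      star2 (ghat g) b a b' a' ∘ (rho (G := ghat g) uhat0i ahati b a ⊠ rho (G := ghat g)
          uhat0i ahati b' a')).
    rewrite (fhom_id (act_one_law HB HA (ghat_law Hg))), comp_idl; apply (am_2 Oh).
  - change (rho (G := ghat g) uhat0i ahati one one ∘ (((fhom (act_one (ghat g)) (idm (@one B))
      ∘ f0 (act_one (ghat g))) ⊠ idm (@one A))
      ∘ luni (@one A)) = star0 (ghat g)).
    rewrite (fhom_id (act_one_law HB HA (ghat_law Hg))), comp_idl; apply (am_0 Oh).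
  - intros [w x] [w' x'].
    change (sq (eth (g (w, e1)) (g (w', e1)) x x'
       ∘ ((enr_star g (idm (ehom W w w')) (eid X e1)
           ∘ star (ghat g) (idm (ehom W w w')) (idm (@one A))) ⊠ idm (ehom X x x')))
      (enr_hom g w w' x x') (rho (G := ghat g) uhat0i ahati (ehom W w w') (ehom X x x'))
      (rho (G := gund g) uu0i aundi w x) (rho (G := gund g) uu0i aundi w' x')).
    rewrite (star_id (ghat_law Hg)), comp_idr, (enr_star_id Hg).
    refine (sq_vert (sq_vert (sq_etens HX (sq_id _) (sq_alpha (idm (ehom X x x')))) (sq_star2
        Hg _ _ _ _)) _).
    refine (sq_star Hg _ (sq_lun HX (idm (ehom X x x')))).
    exact (sq_vert (sq_etens HW (sq_id _) sq_unit0) (sq_run HW (idm (ehom W w w')))).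
Qed.

Lemma med_rho_mon :
  @is_mon_nat _ _ (und_mf (comp_eb R (times_id med_p X))) (und_mf g) med_und.
Proof.
  split.
  - intros [w x] [w' x'] [f h].
    assert (E : @fhom _ _ (und_mf (comp_eb R (times_id med_p X))) (w, x) (w', x') (f, h) =
      @thom (und_bm X) (act_one (gund g) w) (act_one (gund g) w') x x'
        (fhom (act_one (gund g)) f) h).
    { refine (eq_trans (@ufun_comp_times _ _ _ _ R med_p (tens_mon HA) (ebf_hat Hp)
        w w' x x' f h) _).
      exact (f_equal (fun k => @thom (und_bm X) (act_one (gund g) w) (act_one (gund g) w') x
          x' k h)
        (act_one_ufun Hg f)). }
    rewrite E; pose proof (am_nat Ou f h) as K; unfold star, med_und in *; exact_cbn K.
  - intros [w x] [w' x']; pose proof (am_2 Ou w w' x x') as K.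
    rewrite (comp_times_f2 R (ebf_enr Hp)).
    unfold star2, med_und, swap_mid in *; exact_cbn K.
  - pose proof (am_0 Ou) as K.
    rewrite (comp_times_f0 R (ebf_enr Hp)).
    unfold star0, med_und in *; exact_cbn K.
Qed.

Definition med_rho : EBNat (comp_eb (act_g T) (times_id med_p X)) g :=
  @Build_EBNat _ _ (comp_eb R (times_id med_p X)) g med_hat med_und med_rho_law med_rho_mon.

Lemma med_rho_iso : is_ebnat_iso med_rho.
Proof.
  split.
  - intros [b a]; exact (am_iso Oh b a).
  - intros [w x]; exact (am_iso Ou w x).
Qed.

Lemma med_coherent : @act_coherent _ _ _ S T med_p med_sigma med_rho.
Proof.
  split.
  - exact (am_coherent Oh).
  - intro x; pose proof (am_coherent Ou x) as K.
    change (star (gund g) uu0 (idm (@one (und_bm X)))) with (fhom (act_one (gund g)) uu0) in K.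
    rewrite <- (act_one_ufun Hg) in K.
    unfold star0 in K.
    exact_cbn K.
Qed.

Definition mediating : ActHom S T :=
  {| ah_p := med_p; ah_sigma := med_sigma; ah_rho := med_rho;
     ah_sigma_iso := unit_nat_iso HZ Hpu Hpu'; ah_rho_iso := med_rho_iso;
     ah_coherent := med_coherent |}.

End Existence.

End UnitalActions.

(** Mediating morphisms exist by [mediating] and are uniquely isomorphic by
    [xi_eb_2mor] and [xi_eb_unique]. *)
Theorem regular_terminal {X : EBData} (HX : is_eb X) (P : X -> Prop)
    (P_tens : forall x y, P x -> P y -> P (et x y)) (P_one : P e1)
    (HZ : is_eb (full_eb P_tens P_one))
    (P_transparent : forall x : X, P x <-> transparent (C := und_bm X) x) :
  is_terminal_action (regular HX HZ P_transparent).
Proof.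
  intros W S HW; split.
  - exact (inhabits (mediating HX HW S HZ P_transparent)).
  - intros p q; exists (xi_eb p q); split.
    + exact (xi_eb_2mor HW p q).
    + exact (fun z => xi_eb_unique (z := z)).
Qed.

Section MugerCenter.
Context {A : SymCat} {L : BrModule A} (H : Enriched L).

Lemma transparent_und_iff (x : L) :
  transparent (C := L) x <-> transparent (C := und_bm (canonical H)) x.
Proof.
  split; intros t y; specialize (t y).
  - change (@comp (und_bm (canonical H)) _ _ _ (can_und H (@br L y x)) (can_und H (@br L x y)) =
      @idm (und_bm (canonical H)) (@tob L x y)).
    now rewrite can_und_comp, t, can_und_id.
  - apply (can_und_inj (H := H)); rewrite <- can_und_comp, <- can_und_id; exact t.
Qed.

Definition muger_full : EBData :=
  @full_eb (canonical H) (@transparent L)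
    (fun x y => transparent_tens (bc_law L) (x := x) (y := y)) (transparent_one (bc_law L)).

(** Both sides have the same data; only the proofs of the axioms of an enriched category
    differ. *)
Lemma canonical_muger : canonical (muger_enriched H) = muger_full.
Proof.
  pose (K := full_enr (X := canonical H) (@transparent L)).
  (* both sides, as values of one function of the proofs of the axioms *)
  pose (mk := fun p q r =>
    @Build_EBData A (@Build_EnrCat A K (@ehom A K) (eid K) (ecomp K) p q r)
     (@et muger_full) (@eth muger_full) (@e1 muger_full) (@ea muger_full) (@eai muger_full)
     (@el muger_full) (@eli muger_full) (@er muger_full) (@eri muger_full)
     (@ec muger_full) (@eci muger_full)).
  transitivity (mk (@can_idl _ _ (muger_enriched H)) (@can_idr _ _ (muger_enriched H))
      (@can_assoc _ _ (muger_enriched H))).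
  - reflexivity.
  - transitivity (mk (@ecomp_idl A K) (@ecomp_idr A K) (@ecomp_assoc A K)); [| reflexivity].
    f_equal; apply proof_irrelevance.
Qed.

End MugerCenter.

Theorem corollary6p11 (A : SymCat) (L : BrModule A) (H : Enriched L) :
  is_E2_center (canonical H) (canonical (muger_enriched H)).
Proof.
  pose proof (can_eb H) as HX.
  pose proof (can_eb (muger_enriched H)) as HZ.
  split; [exact HX | split; [exact HZ |]].
  revert HZ; rewrite canonical_muger; intro HZ.
  exists (regular HX HZ (transparent_und_iff H)).
  apply regular_terminal.
Qed.
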